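(* Let $f_1\in L^2(\Omega_1)$, $f_2\in L^2(\Omega_2)$, and $u_{2,\mathfrak{h}}^0\in\mathbb{V}_{2,\mathfrak{h}}$. Let $\{u_{h,\mathfrak{h}}^i\}_{i\ge0}\subset\mathbb{H}_{h,\mathfrak{h}}$, $u_{h,\mathfrak{h}}^i=u_{1,h}^i+u_{2,\mathfrak{h}}^i$, be generated by the discrete alternating scheme: $u_{h,\mathfrak{h}}^0=0+u_{2,\mathfrak{h}}^0$ and, for $i\ge1$: $u_{1,h}^{2i-1}\in\mathbb{V}_{1,h}$ is the solution of (D1) with $u_{2,\mathfrak{h}}$ replaced by $u_{2,\mathfrak{h}}^{2i-2}$; $u_{2,\mathfrak{h}}^{2i-1}=u_{2,\mathfrak{h}}^{2i-2}$; $u_{2,\mathfrak{h}}^{2i}\in\mathbb{V}_{2,\mathfrak{h}}$ is the solution of (D2) with $u_{1,h}$ replaced by $u_{1,h}^{2i-1}$; $u_{1,h}^{2i}=u_{1,h}^{2i-1}$. (The equations (D1) and (D2) are given in the context.) Then the sequence converges to the unique solution $(u_{1,h},u_{2,\mathfrak{h}})\in\mathbb{V}_{1,h}\times\mathbb{V}_{2,\mathfrak{h}}$ of the discrete coupled system (D1)–(D2): $$u_{1,h}^i\to u_{1,h}\ \text{in}\ \mathbb{V}_{1,h},\qquad u_{2,\mathfrak{h}}^i\to u_{2,\mathfrak{h}}\ \text{in}\ \mathbb{V}_{2,\mathfrak{h}},\qquad i\uparrow\infty .$$ Moreover, the method is geometrically convergent: there exists $\kappa\in(0,1)$ such that $$|u_{1,h}-u_{1,h}^i|_{\tilde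 H^{s_1}(\Omega_1)}+|u_{2,\mathfrak{h}}-u_{2,\mathfrak{h}}^i|_{\tilde H^{s_2}(\Omega_2)}\lesssim\kappa^i\qquad\forall i\in\mathbb{N}.$$
   Context: Setting. Let $n\ge 2$, $s_1,s_2\in(0,1)$, and let $\Omega_1,\Omega_2\subset\mathbb{R}^n$ be open, connected, bounded Lipschitz polytopes with $\overline{\Omega}_1\cap\overline{\Omega}_2=\emptyset$; $d:=\mathrm{dist}(\Omega_1,\Omega_2)>0$. $\Omega^c$ denotes the complement of $\Omega$ in $\mathbb{R}^n$. The kernel $J:\mathbb{R}^n\to\mathbb{R}$ is measurable and satisfies: $J(z)\ge 0$ and $J(z)=J(-z)$ for a.e. $z$; $J\in L^1(\mathbb{R}^n)$; there exists $r>d$ such that $B_r(0)\subset\mathrm{supp}(J)$. For $i\in\{1,2\}$, $\mathcal{C}_i=c(n,s_i)/2$, where $c(n,s_i)>0$ is the normalization constant of the fractional Laplacian $(-\Delta)^{s_i}$ on $\mathbb{R}^n$. Spaces. For $s\in(0,1)$, $\tilde H^s(\Omega)$ is the closure of $C_0^\infty(\Omega)$ in $H^s(\mathbb{R}^n)$ (equivalently, functions of $H^s(\mathbb{R}^n)$ supported in $\overline\Omega$), with norm $|v|_{\tilde H^s(\Omega)}^2=\int_{\mathbb{R}^n}\int_{\mathbb{R}^n}\frac{|v(x)-v(y)|^2}{|x-y|^{n+2s}}\,\mathrm{d}x\,\mathrm{d}y$; its elements vanish outside $\Omega$. Finite element spaces. $\mathscr{T}_{1,h}$ and $\mathscr{T}_{2,\mathfrak{h}}$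 are members of families of conforming, quasi-uniform meshes of $\overline\Omega_1$ and $\overline\Omega_2$ made of closed simplices $T$, with mesh sizes $h=\max\{\mathrm{diam}(T):T\in\mathscr{T}_{1,h}\}$ and $\mathfrak{h}=\max\{\mathrm{diam}(T):T\in\mathscr{T}_{2,\mathfrak{h}}\}$. $\mathbb{V}_{1,h}$ is the space of continuous functions on $\overline\Omega_1$ that are affine on each $T\in\mathscr{T}_{1,h}$ and vanish on $\partial\Omega_1$; $\mathbb{V}_{2,\mathfrak{h}}$ is the analogous space for $\Omega_2$ and $\mathscr{T}_{2,\mathfrak{h}}$. Functions are extended by zero, so $\mathbb{V}_{1,h}\subset\tilde H^{s_1}(\Omega_1)$ and $\mathbb{V}_{2,\mathfrak{h}}\subset\tilde H^{s_2}(\Omega_2)$; $\mathbb{H}_{h,\mathfrak{h}}:=\mathbb{V}_{1,h}\oplus\mathbb{V}_{2,\mathfrak{h}}$. Discrete coupled system. (D1) for all $v_{1,h}\in\mathbb{V}_{1,h}$: $$\mathcal{C}_1\int_{\Omega_2^c}\int_{\Omega_2^c}\frac{(u_{1,h}(x)-u_{1,h}(y))(v_{1,h}(x)-v_{1,h}(y))}{|x-y|^{n+2s_1}}\,\mathrm{d}y\,\mathrm{d}x+\int_{\Omega_1}\int_{\Omega_2}J(x-y)(u_{1,h}(x)-u_{2,\mathfrak{h}}(y))v_{1,h}(x)\,\mathrm{d}y\,\mathrm{d}x=\int_{\Omega_1}f_1v_{1,h}\,\mathrm{d}x;$$ (D2) for all $v_{2,\mathfrak{h}}\in\mathbb{V}_{2,\mathfrak{h}}$: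 $$\mathcal{C}_2\int_{\Omega_1^c}\int_{\Omega_1^c}\frac{(u_{2,\mathfrak{h}}(x)-u_{2,\mathfrak{h}}(y))(v_{2,\mathfrak{h}}(x)-v_{2,\mathfrak{h}}(y))}{|x-y|^{n+2s_2}}\,\mathrm{d}y\,\mathrm{d}x+\int_{\Omega_1}\int_{\Omega_2}J(x-y)(u_{2,\mathfrak{h}}(y)-u_{1,h}(x))v_{2,\mathfrak{h}}(y)\,\mathrm{d}y\,\mathrm{d}x=\int_{\Omega_2}f_2v_{2,\mathfrak{h}}\,\mathrm{d}x.$$ Convention. $a\lesssim b$ means $a\le Cb$ with a constant $C>0$ independent of $a$, $b$ and of the discretization parameters; in the geometric bound $C$ is in particular independent of the iteration index $i$ (it may depend on the data $f_1,f_2$ and on the initial guess). Convergence in the finite-dimensional spaces $\mathbb{V}_{1,h}$, $\mathbb{V}_{2,\mathfrak{h}}$ is with respect to the norms $|\cdot|_{\tilde H^{s_1}(\Omega_1)}$, $|\cdot|_{\tilde H^{s_2}(\Omega_2)}$. *)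

(* Defs.v *)
From HB Require Import structures.
From mathcomp Require Import all_boot all_order all_algebra.
From mathcomp Require Import all_classical all_reals all_analysis.

Set Implicit Arguments.
Unset Strict Implicit.
Unset Printing Implicit Defensive.
Import Order.TTheory GRing.Theory Num.Theory.
Import numFieldNormedType.Exports.

Local Open Scope classical_set_scope.
Local Open Scope ring_scope.

Definition measure_row_display : measure_display -> measure_display.
Proof. exact. Qed.

(* Row vectors carry the product sigma-algebra, as [n.-tuple T] does in the
   library; for real entries it is the Borel sigma-algebra of R^n. *)
Section measurable_row.
Context {d} {T : measurableType d} (n : nat).

Let coors : 'I_n -> 'rV[T]_n -> T := fun i x => x ord0 i.

Let row_set0 : g_sigma_preimage coors set0.
Proof. exact: sigma_algebra0. Qed.

Let row_setC A : g_sigma_preimage coors A -> g_sigma_preimage coors (~` A).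
Proof. exact: sigma_algebraC. Qed.

Let row_bigcup (F : (set 'rV[T]_n)^nat) :
  (forall i, g_sigma_preimage coors (F i)) ->
  g_sigma_preimage coors (\bigcup_i (F i)).
Proof. exact: sigma_algebra_bigcup. Qed.

HB.instance Definition _ := @isMeasurable.Build (measure_row_display d)
  'rV[T]_n (g_sigma_preimage coors) row_set0 row_setC row_bigcup.

End measurable_row.

Lemma measurable_coord d (T : measurableType d) n (i : 'I_n) :
  measurable_fun [set: 'rV[T]_n] (fun x : 'rV[T]_n => x ord0 i).
Proof.
move=> _ Y mY; rewrite setTI; apply: sub_sigma_algebra => /=.
rewrite -bigcup_seq/=; exists i => /=; first by rewrite mem_index_enum.
by exists Y => //; rewrite setTI.
Qed.

Lemma measurable_fun_rowP d1 d2 (T1 : measurableType d1)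
    (T2 : measurableType d2) n (f : T1 -> 'rV[T2]_n) :
  (forall i, measurable_fun [set: T1] (fun x => f x ord0 i)) ->
  measurable_fun [set: T1] f.
Proof.
move=> mf _ Y mY; rewrite setTI; move: Y mY.
suff : @measurable _ 'rV[T2]_n `<=` [set A | measurable (f @^-1` A)] by [].
apply: smallest_sub.
  split=> /=; first by rewrite preimage_set0.
    by move=> A mA; rewrite setTD preimage_setC; exact: measurableC.
  by move=> F mF; rewrite preimage_bigcup; exact: bigcup_measurable.
rewrite -bigcup_seq/=; apply: bigcup_sub => i _ _ [B mB <-] /=.
by rewrite setTI; have := mf i measurableT B mB; rewrite setTI.
Qed.

Lemma sigma_finite_prod d1 d2 (T1 : measurableType d1)
    (T2 : measurableType d2) (R : realType)
    (m1 : {sigma_finite_measure set T1 -> \bar R})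
    (m2 : {sigma_finite_measure set T2 -> \bar R}) :
  sigma_finite setT (m1 \x m2)%E.
Proof.
have /sigma_finiteP[F [TF ndF Foo]] := sigma_finiteT m1.
have /sigma_finiteP[G [TG ndG Goo]] := sigma_finiteT m2.
exists (fun n => F n `*` G n).
  rewrite -setXTT TF TG predeqE => -[x y]; split.
    move=> [/= [n _ Fnx] [k _ Gky]]; exists (maxn n k) => //; split.
    - by move: x Fnx; exact/subsetPset/ndF/leq_maxl.
    - by move: y Gky; exact/subsetPset/ndG/leq_maxr.
  by move=> [n _ []/= ? ?]; split; exists n.
move=> k; have [? ?] := Foo k; have [? ?] := Goo k.
split; first exact: measurableX.
by rewrite product_measure1E// lte_mul_pinfty// ge0_fin_numE.
Qed.

(* Lebesgue measure on R^n: the n-fold product of the one-dimensional one. *)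
Section lebesgue_step.
Context {R : realType} {n : nat}.
Variable mu : {sigma_finite_measure set 'rV[R]_n -> \bar R}.

Definition cons_row (p : measurableTypeR R * 'rV[R]_n) : 'rV[R]_n.+1 :=
  row_mx (const_mx p.1 : 'rV[R]_1) p.2.

Definition uncons_row (x : 'rV[R]_n.+1) : measurableTypeR R * 'rV[R]_n :=
  (x ord0 ord0, \row_j x ord0 (lift ord0 j)).

Lemma cons_row0 p : cons_row p ord0 ord0 = p.1.
Proof.
rewrite /cons_row mxE; case: splitP => [j _|k /= E]; first by rewrite mxE.
by have := E; rewrite add1n.
Qed.

Lemma cons_row_lift p j : cons_row p ord0 (lift ord0 j) = p.2 ord0 j.
Proof.
rewrite /cons_row mxE; case: splitP => [k /= E|k /= E].
  by have := ltn_ord k; rewrite -E.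
by congr (p.2 _ _); apply/val_inj; move: E; rewrite /bump/= !add1n => -[].
Qed.

Lemma cons_rowK : cancel cons_row uncons_row.
Proof.
move=> [a x]; rewrite /uncons_row cons_row0; congr pair.
by apply/rowP => j; rewrite mxE cons_row_lift.
Qed.

Lemma measurable_cons_row : measurable_fun setT cons_row.
Proof.
apply: measurable_fun_rowP => i; have [j ->|->] := unliftP ord0 i.
  under eq_fun do rewrite cons_row_lift.
  exact: measurableT_comp (measurable_coord _) measurable_snd.
under eq_fun do rewrite cons_row0.
exact: measurable_fst.
Qed.

Lemma measurable_uncons_row : measurable_fun setT uncons_row.
Proof.
apply: measurable_fun_pair; first exact: measurable_coord.
apply: measurable_fun_rowP => i /=.
under eq_fun do rewrite mxE.
exact: measurable_coord.
Qed.

Definition lebesgue_step : set 'rV[R]_n.+1 -> \bar R :=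
  pushforward (lebesgue_measure \x mu)%E cons_row.

Let step0 : lebesgue_step set0 = 0%E.
Proof. by rewrite /lebesgue_step /pushforward preimage_set0 measure0. Qed.

Let step_ge0 A : (0 <= lebesgue_step A)%E.
Proof. by rewrite /lebesgue_step /pushforward; exact: measure_ge0. Qed.

Let step_sigma_additive : semi_sigma_additive lebesgue_step.
Proof.
move=> F mF tF mUF; rewrite /lebesgue_step /pushforward preimage_bigcup.
have mp A : measurable A -> measurable (cons_row @^-1` A).
  by move=> mA; rewrite -[X in measurable X]setTI; exact: measurable_cons_row.
apply: measure_semi_sigma_additive.
- by move=> k; exact: mp.
- apply/trivIsetP => /= i j _ _ ij; rewrite -preimage_setI.
  by move/trivIsetP : tF => /(_ _ _ _ _ ij) ->//; rewrite preimage_set0.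
- by rewrite -preimage_bigcup; exact: mp.
Qed.

HB.instance Definition _ := isMeasure.Build _ _ _
  lebesgue_step step0 step_ge0 step_sigma_additive.

Let step_sigma_finite : sigma_finite setT lebesgue_step.
Proof.
have [F FT mF] : sigma_finite setT (lebesgue_measure \x mu)%E.
  exact: sigma_finite_prod.
exists (fun k => uncons_row @^-1` F k).
  by rewrite -preimage_bigcup -FT preimage_setT.
move=> k; have [mFk Fk] := mF k; split.
  rewrite -[X in measurable X]setTI; exact: measurable_uncons_row.
rewrite /lebesgue_step /pushforward -comp_preimage.
by rewrite (_ : uncons_row \o cons_row = id)//; apply/funext/cons_rowK.
Qed.

HB.instance Definition _ := Measure_isSigmaFinite.Build _ _ _
  lebesgue_step step_sigma_finite.

End lebesgue_step.

Section lebesgue_base.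
Context {R : realType}.

Definition lebesgue_zero : set 'rV[R]_0 -> \bar R := dirac (0 : 'rV[R]_0).
HB.instance Definition _ := Measure.on lebesgue_zero.

Let zero_sigma_finite : sigma_finite setT lebesgue_zero.
Proof.
exists (fun=> setT); first by rewrite bigcup_const.
by move=> k; split=> //; rewrite /lebesgue_zero diracT ltry.
Qed.

HB.instance Definition _ := Measure_isSigmaFinite.Build _ _ _
  lebesgue_zero zero_sigma_finite.

End lebesgue_base.

Fixpoint leb {R : realType} (n : nat) :
    {sigma_finite_measure set 'rV[R]_n -> \bar R} :=
  match n return {sigma_finite_measure set 'rV[R]_n -> \bar R} with
  | 0 => lebesgue_zero
  | m.+1 => lebesgue_step (leb m)
  end.

Section Euclidean.
Context {R : realType} {n : nat}.
Implicit Types (x y : 'rV[R]_n) (S : set 'rV[R]_n).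

(* The library norm on ['rV[R]_n] is the sup norm; it has the same topology
   and bounded sets as the Euclidean norm [enorm]. *)
Definition dotr x y : R := \sum_(i < n) x ord0 i * y ord0 i.
Definition enorm x : R := Num.sqrt (dotr x x).
Definition eball x (r : R) : set 'rV[R]_n := [set y | enorm (y - x) < r].

Definition set_dist S S' : R := inf [set enorm (p.1 - p.2) | p in S `*` S'].
Definition diam S : R := sup [set enorm (p.1 - p.2) | p in S `*` S].
Definition inradius S : R := sup [set r | exists x, eball x r `<=` S].

End Euclidean.

Section Simplices.
Context {R : realType} {n : nat}.
Implicit Types P Q : 'M[R]_(n.+1, n).

(* A simplex is encoded by the matrix whose rows are its n.+1 vertices.
   [face P A] is the convex hull of the vertices indexed by [A]; it is empty
   when [A] is. *)
Definition face P (A : {set 'I_n.+1}) : set 'rV[R]_n :=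
  [set x | exists w : 'rV[R]_n.+1,
    [/\ forall i, 0 <= w ord0 i, forall i, i \notin A -> w ord0 i = 0,
        \sum_i w ord0 i = 1 & x = w *m P]].

Definition simplex P : set 'rV[R]_n := face P [set: 'I_n.+1]%SET.

Definition nondegenerate P : bool :=
  row_free (\matrix_(i < n) (row (lift ord0 i) P - row ord0 P)).

Definition triangulates (S : set 'rV[R]_n) (T : seq 'M[R]_(n.+1, n)) : Prop :=
  (forall P, P \in T -> nondegenerate P) /\
  S = \bigcup_(P in [set` T]) simplex P.

End Simplices.

Section Domains.
Context {R : realType} {n : nat}.
Implicit Type Om : set 'rV[R]_n.

(* Near each boundary point [Om] is the strict epigraph, in the direction of
   the unit vector [e], of a Lipschitz function of the component orthogonal
   to [e]. *)
Definition lipschitz_boundary Om : Prop :=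
  forall x, (closure Om `\` Om°) x ->
  exists (r : R) (e : 'rV[R]_n) (phi : 'rV[R]_n -> R) (L : R),
    [/\ 0 < r, enorm e = 1,
        forall y z, `|phi y - phi z| <= L * enorm (y - z) &
        Om `&` eball x r =
        [set y | phi (y - dotr y e *: e) < dotr y e] `&` eball x r].

(* A polytope need not be convex: its closure is a finite union of simplices,
   which may overlap. *)
Definition polytope Om : Prop := exists T, triangulates (closure Om) T.

Definition lipschitz_polytope Om : Prop :=
  [/\ open Om, Om !=set0, connected Om, bounded_set Om &
      lipschitz_boundary Om /\ polytope Om].

End Domains.

Section FiniteElements.
Context {R : realType} {n : nat}.
Implicit Types (Om : set 'rV[R]_n) (T : seq 'M[R]_(n.+1, n)).

Definition conforming_mesh Om T : Prop :=
  triangulates (closure Om) T /\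
  (forall P Q, P \in T -> Q \in T ->
    exists A B : {set 'I_n.+1},
      simplex P `&` simplex Q = face P A /\ face P A = face Q B).

Definition mesh_size T : R := \big[Num.max/0]_(P <- T) diam (simplex P).

(* Shape regularity together with comparability of all element diameters,
   with the same constant for every mesh of the family. *)
Definition quasi_uniform (I : Type) (T : I -> seq 'M[R]_(n.+1, n)) : Prop :=
  exists2 sigma : R, 0 < sigma & forall k P, P \in T k ->
    diam (simplex P) <= sigma * inradius (simplex P) /\
    mesh_size (T k) <= sigma * diam (simplex P).

Definition mesh_family Om (I : Type) (T : I -> seq 'M[R]_(n.+1, n)) : Prop :=
  (forall k, conforming_mesh Om (T k)) /\ quasi_uniform T.

(* Continuous piecewise affine functions extended by zero: as [Om] is open,
   the last condition also covers the boundary values. *)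
Definition P1_space Om T : set ('rV[R]_n -> R) :=
  [set v | [/\ {within closure Om, continuous v},
      forall P, P \in T ->
        exists (a : 'rV[R]_n) (b : R), forall x, simplex P x ->
          v x = dotr a x + b &
      forall x, ~ Om x -> v x = 0]].

End FiniteElements.

Section Forms.
Context {R : realType} {n : nat}.
Implicit Types (s : R) (J f u v : 'rV[R]_n -> R) (D : set 'rV[R]_n).

(* c(n, s) is the inverse of the integral of (1 - cos z_1) / |z|^(n + 2 s);
   the sum selects the first coordinate of [z]. *)
Definition fraclap_const (m : nat) s : R :=
  (\int[leb m]_z ((1 - cos (\sum_(i < m | i == 0%N :> nat) z ord0 i))
                  / enorm z `^ (m%:R + 2 * s)))^-1.

(* On the diagonal the integrand is 0 / 0 = 0. *)
Definition gagliardo s D u v : R :=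
  \int[leb n]_(x in D) \int[leb n]_(y in D)
    ((u x - u y) * (v x - v y) / enorm (x - y) `^ (n%:R + 2 * s)).

Definition Hs_norm s v : \bar R :=
  ((\int[leb n]_x \int[leb n]_y
     (`|v x - v y| ^+ 2 / enorm (x - y) `^ (n%:R + 2 * s))%:E) `^ 2^-1)%E.

(* A kernel is only determined up to null sets, so its support is the
   essential one. *)
Definition ess_supp J : set 'rV[R]_n :=
  [set x | forall e : R, 0 < e ->
    (0 < leb n (eball x e `&` [set y | J y != 0%R]))%E].

Definition coupling_kernel (d : R) J : Prop :=
  [/\ measurable_fun setT J,
      {ae leb n, forall z, 0 <= J z},
      {ae leb n, forall z, J z = J (- z)},
      (leb n).-integrable setT (EFin \o J) &
      exists2 r : R, d < r & eball 0 r `<=` ess_supp J].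

Definition square_integrable D f : Prop :=
  measurable_fun D f /\ (leb n).-integrable D (fun x => (f x ^+ 2)%:E).

End Forms.

Section CoupledSystem.
Context {R : realType} {n : nat}.
Implicit Types (s : R) (Om : set 'rV[R]_n) (J f u v : 'rV[R]_n -> R).
Implicit Types V : set ('rV[R]_n -> R).

Definition equation1 s Om1 Om2 J f1 V1 u1 u2 : Prop :=
  forall v1, V1 v1 ->
    fraclap_const n s / 2 * gagliardo s (~` Om2) u1 v1 +
    \int[leb n]_(x in Om1) \int[leb n]_(y in Om2)
      (J (x - y) * (u1 x - u2 y) * v1 x) =
    \int[leb n]_(x in Om1) (f1 x * v1 x).

Definition equation2 s Om1 Om2 J f2 V2 u1 u2 : Prop :=
  forall v2, V2 v2 ->
    fraclap_const n s / 2 * gagliardo s (~` Om1) u2 v2 +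
    \int[leb n]_(x in Om1) \int[leb n]_(y in Om2)
      (J (x - y) * (u2 y - u1 x) * v2 y) =
    \int[leb n]_(x in Om2) (f2 x * v2 x).

Definition coupled_solution s1 s2 Om1 Om2 J f1 f2 V1 V2 u1 u2 : Prop :=
  [/\ V1 u1, V2 u2, equation1 s1 Om1 Om2 J f1 V1 u1 u2 &
      equation2 s2 Om1 Om2 J f2 V2 u1 u2].

Definition alternating_scheme s1 s2 Om1 Om2 J f1 f2 V1 V2 u0
    (u1 u2 : nat -> 'rV[R]_n -> R) : Prop :=
  [/\ u1 0%N = cst 0, u2 0%N = u0 & forall i,
    [/\ V1 (u1 i.*2.+1) /\
          equation1 s1 Om1 Om2 J f1 V1 (u1 i.*2.+1) (u2 i.*2),
        u2 i.*2.+1 = u2 i.*2,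
        V2 (u2 i.*2.+2) /\
          equation2 s2 Om1 Om2 J f2 V2 (u1 i.*2.+1) (u2 i.*2.+2) &
        u1 i.*2.+2 = u1 i.*2.+1]].

End CoupledSystem.

(* Main.v *)
Require Import Defs.
From HB Require Import structures.
From mathcomp Require Import all_boot all_order all_algebra.
From mathcomp Require Import all_classical all_reals all_analysis.
From mathcomp Require Import measurable_realfun lra ring.

Set Implicit Arguments.
Unset Strict Implicit.
Unset Printing Implicit Defensive.
Import Order.TTheory GRing.Theory Num.Theory.
Import numFieldNormedType.Exports.
Local Open Scope classical_set_scope.
Local Open Scope ring_scope.

(** The coupled system is the Euler-Lagrange equation of a quadratic energy on
[V1 x V2], and the scheme minimizes this energy alternately in its two
variables. The energy of the first half step is
[b1 v v = C_1 [v]^2 + int int J v^2], where [[v]] is the Gagliardo seminorm over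
the complement of [Om2]; that of the second one is analogous, and the two
variables interact only through [m v1 v2 = int int J(x - y) v1(x) v2(y)].

Why the scheme contracts: the inequality [2ab <= a^2 + b^2] bounds [2 m v1 v2]
by the sum of the coupling parts of the two energies. A fractional Poincare
inequality ([poincare]) shows that the coupling part is at most a share [q < 1]
of either energy, whence [2 m v1 v2 <= q (b1 v1 v1 + b2 v2 v2)]
([exchange_form_le]). Testing the error equation of a half step with its own
solution then gives [b1 e1 e1 <= q / (2 - q) * b2 e2 e2], and the same with the
roles exchanged ([solves1_error], [solves2_error]). The same share makes the
coupled form coercive, so that the coupled system and each half step are
uniquely solvable in finite dimension ([riesz_finite_dim]), and it bounds the
energy of the solution by the data. None of these constants depends on the
meshes, which is why one [C] serves all of them.

The Poincare inequality needs no compactness: a function vanishing outside [Om1]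
interacts with a cube far away from both domains, where it is zero, and this
part of the seminorm over the complement of [Om2] already dominates its square
integral. The seminorm on the whole space adds only the interaction of [Om1]
with [Om2], where the singular kernel is bounded because the closures are
disjoint compact sets ([disjoint_closure_separated], [gagliardo_full_le]).

The forms are defined by iterated real integrals, so their linearity requires
absolute convergence. It follows from a bound by the integrable kernel
[min(1, |z|^2) / |z|^(n + 2s)] ([integral_truncated_kernel_lty]), because finite
element functions, extended by zero, are bounded and Lipschitz on the whole
space: near a point only the affine pieces that agree with the function there
are active ([piecewise_affine_lipschitz]). The same kernel shows that the normalization
constant of the fractional Laplacian is positive ([fraclap_const_gt0]). *)

(** * Riesz representation in finite dimension *)

Section Riesz.
Context {R : realFieldType} {E : lmodType R}.
Implicit Types (V : set E) (u v w : E).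

Definition subspace V : Prop :=
  V 0 /\ forall (a : R) u v, V u -> V v -> V (a *: u + v).

(** Linearity is asked on a subset only, because the integral forms to which
this applies are linear merely where the integrals converge. *)
Definition linear_on V (l : E -> R) : Prop :=
  forall (a : R) u v, V u -> V v -> l (a *: u + v) = a * l u + l v.

Definition scalar_product_on V (b : E -> E -> R) : Prop :=
  [/\ forall w, V w -> linear_on V (b w),
      forall u v, V u -> V v -> b u v = b v u &
      forall u, V u -> u != 0 -> 0 < b u u].

Lemma subspaceZ V a u : subspace V -> V u -> V (a *: u).
Proof. by move=> [V0 VD] Vu; rewrite -[_ *: _]addr0; exact: VD. Qed.

Lemma subspaceD V u v : subspace V -> V u -> V v -> V (u + v).
Proof. by move=> [_ VD] Vu Vv; rewrite -[u]scale1r; exact: VD. Qed.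

Lemma subspaceB V u v : subspace V -> V u -> V v -> V (u - v).
Proof.
by move=> sV Vu Vv; rewrite addrC -scaleN1r; apply: sV.2.
Qed.

Lemma linear_onZ V l a u : subspace V -> linear_on V l -> V u ->
  l (a *: u) = a * l u.
Proof.
move=> [V0 _] ll Vu.
have l0 : l 0 = 0.
  have := ll 1 0 0 V0 V0; rewrite scaler0 addr0 mul1r => /eqP.
  by rewrite -subr_eq subrr eq_sym => /eqP.
by rewrite -[_ *: _]addr0 ll// l0 addr0.
Qed.

Lemma linear_onD V l u v : linear_on V l -> V u -> V v -> l (u + v) = l u + l v.
Proof. by move=> ll Vu Vv; rewrite -[u in LHS]scale1r ll// mul1r. Qed.

Lemma linear_onB V l u v : linear_on V l -> V u -> V v -> l (u - v) = l u - l v.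
Proof.
by move=> ll Vu Vv; rewrite addrC -scaleN1r ll// mulN1r addrC.
Qed.

Lemma scalar_product_ge0 V b u : subspace V -> scalar_product_on V b -> V u ->
  0 <= b u u.
Proof.
move=> sV [bl _ bp] Vu; have [->|u0] := eqVneq u 0; last exact/ltW/bp.
have V0 := sV.1.
by have := linear_onZ 0 sV (bl _ V0) V0; rewrite scaler0 mul0r => ->.
Qed.

(** By Gram-Schmidt on the number [N] of functionals that separate the points of
[V]: the kernel of the last one has codimension at most one, and by induction a
vector [w'] spanning a complement of it can be made orthogonal to it. The finite
dimension is expressed by separating functionals rather than by a basis, because
on a finite element space these are just the values at the vertices. *)
Lemma riesz_finite_dim (N : nat) (ev : nat -> E -> R) V b l :
  subspace V -> (forall i, (i < N)%N -> linear_on V (ev i)) ->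
  (forall u, V u -> (forall i, (i < N)%N -> ev i u = 0) -> u = 0) ->
  scalar_product_on V b -> linear_on V l ->
  exists2 u, V u & forall v, V v -> b u v = l v.
Proof.
elim: N V l => [|N IH] V l sV evl ev0 [bl bs bp] ll.
  exists 0; first exact: sV.1.
  have V0 := sV.1; move=> v Vv; rewrite (ev0 v)//.
  have := linear_onZ 0 sV ll V0; rewrite scaler0 mul0r => ->.
  by have := linear_onZ 0 sV (bl _ V0) V0; rewrite scaler0 mul0r => ->.
(* either the last functional is useless, or its kernel is a hyperplane of V *)
have [evN|] := pselect (forall u, V u -> ev N u = 0).
  apply: IH => //.
    by move=> i iN; apply: evl; rewrite ltnS ltnW.
  move=> u Vu evu; apply: ev0 => // i; rewrite ltnS leq_eqVlt => /predU1P[->|].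
    exact: evN.
  exact: evu.
move=> /existsNP[w /not_implyP[Vw /eqP evw]].
have eN : linear_on V (ev N) by exact: evl.
pose V' : set E := [set u | V u /\ ev N u = 0].
have V'V u : V' u -> V u by case.
have sV' : subspace V'.
  split; first split; [exact: sV.1| |].
    by have := linear_onZ 0 sV eN Vw; rewrite scale0r mul0r.
  move=> a u v [Vu u0] [Vv v0]; split; first exact: sV.2.
  by rewrite eN// u0 v0 mulr0 addr0.
have bV' : scalar_product_on V' b.
  split=> [z V'z a u v|u v|u].
  - by move=> /V'V Vu /V'V Vv; apply: bl => //; exact: V'V.
  - by move=> /V'V Vu /V'V Vv; exact: bs.
  - by move=> /V'V; exact: bp.
have rep k : linear_on V' k -> exists2 u, V' u & forall v, V' v -> b u v = k v.
  move=> lk; apply: IH => //.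
    by move=> i iN a u v /V'V Vu /V'V Vv; apply: evl => //; rewrite ltnS ltnW.
  move=> u [Vu evu0] evu; apply: ev0 => // i.
  by rewrite ltnS leq_eqVlt => /predU1P[->//|]; exact: evu.
have [|p V'p bp'] := rep (b w).
  by move=> a u v /V'V Vu /V'V Vv; exact: bl.
have [|u' V'u' bu'] := rep l.
  by move=> a u v /V'V Vu /V'V Vv; exact: ll.
have Vp := V'V _ V'p; have Vu' := V'V _ V'u'.
pose w' := w - p; have Vw' : V w' by exact: subspaceB.
have ew' : ev N w' = ev N w by rewrite (linear_onB eN)// V'p.2 subr0.
have w'0 : w' != 0.
  apply: contra_neq evw => w'0; rewrite -ew' w'0.
  by have := linear_onZ 0 sV eN Vw; rewrite scale0r mul0r.
have bw' v : V' v -> b w' v = 0.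
  move=> V'v; have Vv := V'V _ V'v.
  by rewrite bs// (linear_onB (bl _ Vv))// !(bs v)// bp'// subrr.
have bw'0 := bp _ Vw' w'0.
pose t := l w' / b w' w'.
exists (t *: w' + u'); first exact: sV.2.
move=> v Vv.
pose c := ev N v / ev N w'; pose v' := v - c *: w'.
have V'v' : V' v'.
  have Vcw : V (c *: w') by exact: subspaceZ.
  split; first exact: subspaceB.
  rewrite (linear_onB eN)// (linear_onZ _ sV eN)// /c divfK ?subrr//.
  by rewrite ew'.
have Vv' := V'V _ V'v'.
have Vu : V (t *: w' + u') by exact: sV.2.
have -> : v = c *: w' + v' by rewrite /v' addrC subrK.
have -> : b (t *: w' + u') (c *: w' + v') =
    c * b (t *: w' + u') w' + b (t *: w' + u') v' by exact: bl.
rewrite ll//; congr (c * _ + _).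
  rewrite bs// (bl _ Vw')// [b w' u']bw'// addr0 /t divfK//.
  by rewrite gt_eqF.
by rewrite bs// (bl _ Vv')// (bs v' w')// bw'// mulr0 add0r bs// bu'.
Qed.

Lemma riesz_unique V b l u u' : subspace V -> scalar_product_on V b ->
  V u -> V u' -> (forall v, V v -> b u v = l v) ->
  (forall v, V v -> b u' v = l v) -> u = u'.
Proof.
move=> sV [bl bs bp] Vu Vu' bu bu'; apply/eqP; rewrite -subr_eq0.
apply/negPn/negP => uu'.
have Vd : V (u - u') by exact: subspaceB.
have := bp _ Vd uu'.
by rewrite (linear_onB (bl _ Vd))// !(bs (u - u'))// bu// bu'// subrr ltxx.
Qed.

End Riesz.

(** * Alternating minimization of two coupled quadratic energies *)

Section AlternatingMinimization.
Context {R : realFieldType} {E1 E2 : lmodType R}.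
Context (V1 : set E1) (V2 : set E2).
Context (b1 : E1 -> E1 -> R) (b2 : E2 -> E2 -> R) (m : E1 -> E2 -> R) (q : R).
Hypothesis sV1 : subspace V1.
Hypothesis sV2 : subspace V2.
Hypothesis sb1 : scalar_product_on V1 b1.
Hypothesis sb2 : scalar_product_on V2 b2.
Hypothesis ml : forall w, V2 w -> linear_on V1 (m^~ w).
Hypothesis mr : forall v, V1 v -> linear_on V2 (m v).
Hypothesis q01 : 0 < q < 1.
Hypothesis mq : forall v w, V1 v -> V2 w -> 2 * m v w <= q * (b1 v v + b2 w w).
Context (l1 : E1 -> R) (l2 : E2 -> R).
Hypothesis ll1 : linear_on V1 l1.
Hypothesis ll2 : linear_on V2 l2.

Definition solves1 (x : E1) (y : E2) : Prop :=
  forall v, V1 v -> b1 x v = l1 v + m v y.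

Definition solves2 (x : E1) (y : E2) : Prop :=
  forall w, V2 w -> b2 y w = l2 w + m x w.

Definition contraction_factor : R := q / (2 - q).

Lemma contraction_factor_gt0 : 0 < contraction_factor.
Proof. by move/andP: q01 => [q0 q1]; rewrite divr_gt0//; lra. Qed.

Lemma contraction_factor_lt1 : contraction_factor < 1.
Proof. by move/andP: q01 => [q0 q1]; rewrite ltr_pdivrMr; lra. Qed.

(** Testing the error equation [b a = m] of one half step with its own solution
and absorbing the part of the coupling that it controls. *)
Lemma half_step_contraction (a b t : R) : a = t -> 2 * t <= q * (a + b) ->
  a <= contraction_factor * b.
Proof.
move=> <- h; move/andP: q01 => [q0 q1].
by rewrite /contraction_factor mulrAC ler_pdivlMr; lra.
Qed.

Lemma solves1_error x y x' y' : V1 x -> V1 x' -> V2 y -> V2 y' ->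
  solves1 x y -> solves1 x' y' ->
  b1 (x - x') (x - x') <= contraction_factor * b2 (y - y') (y - y').
Proof.
move=> Vx Vx' Vy Vy' h h'; have Ve := subspaceB sV1 Vx Vx'.
have Vf := subspaceB sV2 Vy Vy'.
apply: half_step_contraction (mq Ve Vf); case: sb1 => bl bs _.
rewrite {1}(linear_onB (bl _ Ve))// !(bs (x - x'))// h// h'//.
by rewrite (linear_onB (mr Ve))//; ring.
Qed.

Lemma solves2_error x y x' y' : V1 x -> V1 x' -> V2 y -> V2 y' ->
  solves2 x y -> solves2 x' y' ->
  b2 (y - y') (y - y') <= contraction_factor * b1 (x - x') (x - x').
Proof.
move=> Vx Vx' Vy Vy' h h'; have Ve := subspaceB sV1 Vx Vx'.
have Vf := subspaceB sV2 Vy Vy'; case: sb2 => bl bs _.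
have := mq Ve Vf; rewrite [X in q * X]addrC.
apply: half_step_contraction.
rewrite {1}(linear_onB (bl _ Vf))// !(bs (y - y'))// h// h'//.
by rewrite (linear_onB (ml Vf))//; ring.
Qed.

(** The form of the coupled system on the product space; both equations are
the two components of its Euler-Lagrange equation. *)
Definition coupled_form (u v : E1 * E2) : R :=
  b1 u.1 v.1 + b2 u.2 v.2 - m u.1 v.2 - m v.1 u.2.

Definition coupled_space : set (E1 * E2) := [set u | V1 u.1 /\ V2 u.2].

Lemma subspace_coupled : subspace coupled_space.
Proof.
split; first by split; [exact: sV1.1|exact: sV2.1].
by move=> a u v [Vu1 Vu2] [Vv1 Vv2]; split; [exact: sV1.2|exact: sV2.2].
Qed.

(** The mixed term uses up a fraction [q < 1] of the energy, which leaves the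
coupled form coercive. *)
Lemma coupled_form_ge u : coupled_space u ->
  (1 - q) * (b1 u.1 u.1 + b2 u.2 u.2) <= coupled_form u u.
Proof. by case=> Vu1 Vu2; have := mq Vu1 Vu2; rewrite /coupled_form; lra. Qed.

Lemma scalar_product_coupled : scalar_product_on coupled_space coupled_form.
Proof.
case: sb1 => bl1 bs1 bp1; case: sb2 => bl2 bs2 bp2; split.
- move=> w [Vw1 Vw2] a u v [Vu1 Vu2] [Vv1 Vv2]; rewrite /coupled_form/=.
  rewrite (bl1 _ Vw1)// (bl2 _ Vw2)// (mr Vw1)//.
  have -> : m (a *: u.1 + v.1) w.2 = a * m u.1 w.2 + m v.1 w.2 by exact: ml.
  by ring.
- move=> u v [Vu1 Vu2] [Vv1 Vv2]; rewrite /coupled_form.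
  by rewrite bs1// bs2//; ring.
- move=> u Vu u0; apply: lt_le_trans (coupled_form_ge Vu).
  case: Vu => Vu1 Vu2; move/andP: q01 => [q0 q1].
  rewrite mulr_gt0 ?subr_gt0//.
  have b1ge0 := scalar_product_ge0 sV1 sb1 Vu1.
  have b2ge0 := scalar_product_ge0 sV2 sb2 Vu2.
  have [u10|u10] := eqVneq u.1 0; last by rewrite ltr_pwDl// bp1.
  rewrite ltr_wpDl// bp2//; apply: contra_neq u0 => u20.
  by case: u u10 u20 {Vu1 Vu2 b1ge0 b2ge0} => ? ? /= -> ->.
Qed.

Lemma coupled_formP u : coupled_space u ->
  (solves1 u.1 u.2 /\ solves2 u.1 u.2) <->
  (forall v, coupled_space v -> coupled_form u v = l1 v.1 + l2 v.2).
Proof.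
case: sb1 => bl1 _ _; case: sb2 => bl2 _ _.
have V10 := sV1.1; have V20 := sV2.1.
move=> [Vu1 Vu2]; split=> [[h1 h2] v [Vv1 Vv2]|h].
  by rewrite /coupled_form h1// h2//; ring.
have lin0 (F : lmodType R) (V : set F) l : subspace V -> linear_on V l -> l 0 = 0.
  move=> sV ll; have := linear_onZ 0 sV ll sV.1.
  by rewrite scaler0 mul0r.
split=> [v Vv|v Vv].
  have := h (v, 0) (conj Vv V20); rewrite /coupled_form/=.
  rewrite (lin0 _ _ _ sV2 (bl2 _ Vu2)) (lin0 _ _ _ sV2 (mr Vu1)).
  by rewrite (lin0 _ _ _ sV2 ll2); lra.
have := h (0, v) (conj V10 Vv); rewrite /coupled_form/=.
rewrite (lin0 _ _ _ sV1 (bl1 _ Vu1)) (lin0 _ _ _ sV1 (ml Vu2)).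
by rewrite (lin0 _ _ _ sV1 ll1); lra.
Qed.

Lemma coupled_unique u u' : coupled_space u -> coupled_space u' ->
  solves1 u.1 u.2 -> solves2 u.1 u.2 ->
  solves1 u'.1 u'.2 -> solves2 u'.1 u'.2 -> u = u'.
Proof.
move=> Vu Vu' h1 h2 h1' h2'.
by apply: (riesz_unique subspace_coupled scalar_product_coupled Vu Vu');
  apply/coupled_formP.
Qed.

Lemma solves1_unique x x' y : V1 x -> V1 x' -> solves1 x y -> solves1 x' y ->
  x = x'.
Proof. exact: riesz_unique. Qed.

Lemma solves2_unique x y y' : V2 y -> V2 y' -> solves2 x y -> solves2 x y' ->
  y = y'.
Proof. exact: riesz_unique. Qed.

Section existence.
Context (N1 N2 : nat) (ev1 : nat -> E1 -> R) (ev2 : nat -> E2 -> R).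
Hypothesis evl1 : forall i, (i < N1)%N -> linear_on V1 (ev1 i).
Hypothesis evl2 : forall i, (i < N2)%N -> linear_on V2 (ev2 i).
Hypothesis ev10 :
  forall u, V1 u -> (forall i, (i < N1)%N -> ev1 i u = 0) -> u = 0.
Hypothesis ev20 :
  forall u, V2 u -> (forall i, (i < N2)%N -> ev2 i u = 0) -> u = 0.

Lemma solves1_exists y : V2 y -> exists2 x, V1 x & solves1 x y.
Proof.
move=> Vy; apply: (riesz_finite_dim sV1 evl1 ev10 sb1).
by move=> a u v Vu Vv /=; rewrite ll1// (ml Vy)//; ring.
Qed.

Lemma solves2_exists x : V1 x -> exists2 y, V2 y & solves2 x y.
Proof.
move=> Vx; apply: (riesz_finite_dim sV2 evl2 ev20 sb2).
by move=> a u v Vu Vv /=; rewrite ll2// (mr Vx)//; ring.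
Qed.

Lemma coupled_exists : exists2 u, coupled_space u &
  solves1 u.1 u.2 /\ solves2 u.1 u.2.
Proof.
pose ev i (u : E1 * E2) := if (i < N1)%N then ev1 i u.1 else ev2 (i - N1)%N u.2.
suff [u Vu hu] : exists2 u, coupled_space u & forall v, coupled_space v ->
    coupled_form u v = l1 v.1 + l2 v.2.
  by exists u => //; exact/coupled_formP.
apply: (@riesz_finite_dim _ _ (N1 + N2)%N ev) => //.
- exact: subspace_coupled.
- move=> i iN a u v [Vu1 Vu2] [Vv1 Vv2]; rewrite /ev; case: ltnP => iN1.
    exact: evl1.
  by apply: evl2 => //; rewrite ltn_subLR.
- move=> [x y] [/= Vx Vy] evu; congr pair.
    apply: ev10 => // i iN1; have := evu i (ltn_addr _ iN1).
    by rewrite /ev iN1.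
  apply: ev20 => // i iN2; have := evu (N1 + i)%N.
  by rewrite ltn_add2l /ev [(N1 + i < N1)%N]ltnNge leq_addr/= addKn; exact.
- exact: scalar_product_coupled.
- move=> a u v [Vu1 Vu2] [Vv1 Vv2]; rewrite ll1// ll2//; ring.
Qed.

End existence.

Lemma scalar_product_subl (E : lmodType R) (V : set E) b u v : subspace V ->
  scalar_product_on V b -> V u -> V v ->
  b (u - v) (u - v) <= 2 * b u u + 2 * b v v.
Proof.
move=> sV sb Vu Vv; case: (sb) => bl bs _.
have Vd := subspaceB sV Vu Vv; have Vs := subspaceD sV Vu Vv.
have := scalar_product_ge0 sV sb Vs.
rewrite (linear_onD (bl _ Vs))// (linear_onB (bl _ Vd))//.
rewrite !(bs (u + v))// !(bs (u - v))//.
rewrite !(linear_onB (bl _ Vu))// !(linear_onD (bl _ Vu))//.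
rewrite !(linear_onB (bl _ Vv))// !(linear_onD (bl _ Vv))//.
rewrite (bs v u)//; lra.
Qed.

Context (K : R).
Hypothesis lK1 : forall v, V1 v -> 2 * l1 v <= K + (1 - q) * b1 v v.
Hypothesis lK2 : forall v, V2 v -> 2 * l2 v <= K + (1 - q) * b2 v v.

(** Testing the coupled system with its own solution: one half of the coercive
energy absorbs the quadratic part of the bound on the loads. *)
Lemma coupled_energy u : coupled_space u -> solves1 u.1 u.2 ->
  solves2 u.1 u.2 -> b1 u.1 u.1 + b2 u.2 u.2 <= 2 * K / (1 - q).
Proof.
move=> Vu h1 h2; move/andP: q01 => [q0 q1].
have hu := (coupled_formP Vu).1 (conj h1 h2) u Vu.
have := coupled_form_ge Vu; rewrite hu; case: Vu => /lK1 k1 /lK2 k2.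
by rewrite ler_pdivlMr ?subr_gt0//; lra.
Qed.

Definition alternates (x : nat -> E1) (y : nat -> E2) : Prop := forall i,
  [/\ V1 (x i.*2.+1) /\ solves1 (x i.*2.+1) (y i.*2),
      y i.*2.+1 = y i.*2,
      V2 (y i.*2.+2) /\ solves2 (x i.*2.+1) (y i.*2.+2) &
      x i.*2.+2 = x i.*2.+1].

Lemma alternates_contraction u x y : coupled_space u ->
  solves1 u.1 u.2 -> solves2 u.1 u.2 -> V2 (y 0%N) -> alternates x y ->
  let D := b2 (u.2 - y 0%N) (u.2 - y 0%N) in
  forall i, V2 (y i.*2) /\
    b2 (u.2 - y i.*2) (u.2 - y i.*2) <= D * contraction_factor ^+ i.*2 /\
    b1 (u.1 - x i.*2.+1) (u.1 - x i.*2.+1) <=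
      D * contraction_factor ^+ i.*2.+1.
Proof.
move=> [Vu1 Vu2] h1 h2 Vy0 alt D.
have step1 i : V2 (y i.*2) ->
    b2 (u.2 - y i.*2) (u.2 - y i.*2) <= D * contraction_factor ^+ i.*2 ->
    b1 (u.1 - x i.*2.+1) (u.1 - x i.*2.+1) <=
      D * contraction_factor ^+ i.*2.+1.
  move=> Vy hy; have [[Vx hx] _ _ _] := alt i.
  apply: le_trans (solves1_error Vu1 Vx Vu2 Vy h1 hx) _.
  rewrite exprS mulrCA ler_wpM2l//.
  exact: ltW contraction_factor_gt0.
elim=> [|i [Vy [hy hx]]].
  have h : b2 (u.2 - y 0.*2) (u.2 - y 0.*2) <= D * contraction_factor ^+ 0.*2.
    by rewrite expr0 mulr1.
  by split=> //; split=> //; exact: step1.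
have [[Vx _] _ [Vy' hy'] _] := alt i.
rewrite doubleS; split=> //.
have h : b2 (u.2 - y i.*2.+2) (u.2 - y i.*2.+2) <=
    D * contraction_factor ^+ i.*2.+2.
  apply: le_trans (solves2_error Vu1 Vx Vu2 Vy' h2 hy') _.
  rewrite exprS mulrCA ler_wpM2l//.
  exact: ltW contraction_factor_gt0.
by split=> //; rewrite -doubleS; apply: step1; rewrite ?doubleS.
Qed.

(** An iterate is kept for one step after it has been updated, so that its error
lags one power of the factor behind the index: this is the reason for the
division by [contraction_factor], which also leaves room for the initial errors.
The constant [M] depends on the data and on the initial guess only. *)
Lemma alternates_geometric u x y : coupled_space u ->
  solves1 u.1 u.2 -> solves2 u.1 u.2 -> x 0%N = 0 -> V2 (y 0%N) ->
  alternates x y ->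
  let M := (4 * K / (1 - q) + 2 * b2 (y 0%N) (y 0%N)) / contraction_factor in
  forall i, [/\ V1 (x i), V2 (y i),
    b1 (u.1 - x i) (u.1 - x i) <= M * contraction_factor ^+ i &
    b2 (u.2 - y i) (u.2 - y i) <= M * contraction_factor ^+ i].
Proof.
move=> Vu h1 h2 x0 Vy0 alt M i.
have c0 := contraction_factor_gt0; have c1 := contraction_factor_lt1.
have [Vu1 Vu2] := Vu.
have contr := alternates_contraction Vu h1 h2 Vy0 alt.
have en := coupled_energy Vu h1 h2.
have en1 := scalar_product_ge0 sV1 sb1 Vu1.
have en2 := scalar_product_ge0 sV2 sb2 Vu2.
have en0 := scalar_product_ge0 sV2 sb2 Vy0.
have DM : b2 (u.2 - y 0%N) (u.2 - y 0%N) <= M * contraction_factor.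
  rewrite divfK ?gt_eqF//.
  apply: le_trans (scalar_product_subl sV2 sb2 Vu2 Vy0) _; lra.
have M0 : 0 <= M by rewrite divr_ge0 ?(ltW c0)//; lra.
have DM' : b2 (u.2 - y 0%N) (u.2 - y 0%N) <= M.
  by apply: le_trans DM _; rewrite ler_piMr// ltW.
set D := b2 _ _ in DM DM' contr.
have pow k : D * contraction_factor ^+ k <= M * contraction_factor ^+ k.+1.
  by rewrite exprS mulrA ler_wpM2r// exprn_ge0// ltW.
have pow' k : D * contraction_factor ^+ k <= M * contraction_factor ^+ k.
  by rewrite ler_wpM2r// exprn_ge0// ltW.
have [io|ie] := boolP (odd i).
  have -> : i = i./2.*2.+1 by rewrite -[LHS]odd_double_half io.
  have [Vy [hy hx]] := contr i./2; have [[Vx _] -> _ _] := alt i./2.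
  by split=> //; [exact: le_trans hx _|exact: le_trans hy _].
have iE : i = i./2.*2 by rewrite -[LHS]odd_double_half (negbTE ie).
have [Vy [hy _]] := contr i./2.
rewrite -iE in Vy hy; split=> //; last exact: le_trans hy _.
- rewrite iE; case: (i./2) => [|k]; first by rewrite x0; exact: sV1.1.
  by rewrite doubleS; have [[Vx _] _ _ ->] := alt k.
- rewrite iE; case: (i./2) => [|k].
    rewrite x0 subr0 expr0 mulr1.
    have : b1 u.1 u.1 <= M * contraction_factor.
      by rewrite divfK ?gt_eqF//; lra.
    by move/le_trans; apply; rewrite ler_piMr// ltW.
  rewrite doubleS; have [_ _ _ ->] := alt k.
  by have [_ [_ hx]] := contr k; exact: le_trans hx _.
Qed.

End AlternatingMinimization.

(** * Borel sets of the space of row vectors *)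

Section RowMeasurable.
Context {R : realType} {n : nat}.
Implicit Types x y : 'rV[R]_n.

Definition box x (r : R) : set 'rV[R]_n :=
  [set y | forall i, `|y ord0 i - x ord0 i| < r].

Lemma normvE x : `|x| = \big[Num.max/0]_(ij : 'I_1 * 'I_n) `|x ij.1 ij.2|.
Proof. exact: mx_normrE. Qed.

Lemma normv_ltP x (r : R) : 0 < r ->
  `|x| < r <-> forall i, `|x ord0 i| < r.
Proof.
move=> r0; rewrite normvE; split=> [/bigmax_ltP[_ h] i|h].
  exact: (h (ord0, i)).
by apply/bigmax_ltP; split=> // -[i j] _ /=; rewrite ord1.
Qed.

Lemma coord_le_normv x i : `|x ord0 i| <= `|x|.
Proof.
rewrite normvE.
exact: (le_bigmax _ (fun ij => `|x ij.1 ij.2|) (ord0, i)).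
Qed.

Lemma measurable_box x r : measurable (box x r).
Proof.
rewrite (_ : box x r = \bigcap_(i in [set: 'I_n])
    [set y : 'rV[R]_n | `|y ord0 i - x ord0 i| < r]); last first.
  by apply/seteqP; split=> y /= h i//; [move=> _; exact: h|exact: (h i)].
rewrite -bigsetI_fset_set; last exact: finite_finset.
apply: bigsetI_measurable => i _.
have -> : [set y : 'rV[R]_n | `|y ord0 i - x ord0 i| < r] =
   (fun y : 'rV[R]_n => `|y ord0 i - x ord0 i|) @^-1` `]-oo, r[.
  by apply/seteqP; split=> y /=; rewrite in_itv.
rewrite -[X in measurable X]setTI.
have : measurable_fun setT (fun y : 'rV[R]_n => `|y ord0 i - x ord0 i|).
  apply: measurableT_comp => //; apply: measurable_funB => //.
  exact: measurable_coord.
by apply => //; exact: measurable_itv.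
Qed.

(** Open sets are countable unions of boxes with rational centres and radii. *)
Lemma open_measurable_rV (U : set 'rV[R]_n) : open U -> measurable U.
Proof.
move=> oU.
pose ctr (q : 'rV[rat]_n) : 'rV[R]_n := map_mx ratr q.
pose P (qk : 'rV[rat]_n * nat) := box (ctr qk.1) qk.2.+1%:R^-1 `<=` U.
rewrite (_ : U = \bigcup_(qk in P) box (ctr qk.1) qk.2.+1%:R^-1).
  rewrite bigcup_mkcond; apply: countable_bigcupT_measurable => // qk.
  by case: ifPn => // _; exact: measurable_box.
apply/seteqP; split; last by move=> y [qk Pqk /Pqk].
move=> x Ux; have := open_nbhs_nbhs (conj oU Ux).
move=> /nbhs_ballP[e /= e0 eU].
have [k hk] : exists k : nat, k.+1%:R^-1 < e / 2.
  exists (Num.truncn (e / 2)^-1); rewrite invf_plt ?posrE ?divr_gt0//.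
  exact: truncnS_gt.
have k0 : 0 < k.+1%:R^-1 :> R by rewrite invr_gt0.
have qP (i : 'I_n) : exists q : rat, `|x ord0 i - ratr q| < k.+1%:R^-1.
  have /rat_in_itvoo[q] : x ord0 i - k.+1%:R^-1 < x ord0 i + k.+1%:R^-1.
    by rewrite ltrBlDr -addrA ltrDl addr_gt0.
  rewrite in_itv/= => /andP[h1 h2]; exists q.
  by rewrite distrC ltr_distl h1 h2.
have [q hq] := choice qP.
exists ((\row_i q i), k).
  move=> y /= hy; apply: eU; rewrite -ball_normE /= normv_ltP// => i.
  rewrite !mxE; have := hy i; rewrite !mxE => hyi.
  have := hq i.
  have -> : x ord0 i - y ord0 i = (x ord0 i - ratr (q i)) + (ratr (q i) - y ord0 i) by ring.
  move=> hx; apply: le_lt_trans (ler_normD _ _) _.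
  rewrite distrC in hyi; rewrite [e]splitr.
  by apply: lt_trans (ltrD hx hyi) _; exact: ltrD.
by move=> i /=; rewrite !mxE; exact: hq.
Qed.

Lemma continuous_measurable_rV (f : 'rV[R]_n -> R) :
  continuous f -> measurable_fun setT f.
Proof.
move=> /continuousP cf; apply: (measurability _ (RGenOpens.measurableE R)).
move=> _ [_ [a [b ->]] <-]; rewrite setTI.
by apply: open_measurable_rV; apply: cf; exact: interval_open.
Qed.

End RowMeasurable.

(** * Reflections and volumes of cubes *)

Section LebesgueRow.
Context {R : realType}.

Lemma lebesgue_measure_reflect (c : R) (A : set R) : measurable A ->
  lebesgue_measure ((fun a => c - a) @^-1` A) = lebesgue_measure A.
Proof.
move=> mA.
have mphi : measurable_fun [set: measurableTypeR R]
    (fun a : measurableTypeR R => (c - a : measurableTypeR R)).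
  by apply: measurable_funB.
pose phi : {mfun measurableTypeR R >-> measurableTypeR R} :=
  HB.pack (fun a : measurableTypeR R => (c - a : measurableTypeR R))
    (isMeasurableFun.Build _ _ _ _ _ mphi).
apply/esym; rewrite -[RHS]/(pushforward lebesgue_measure phi A).
apply: lebesgue_measure_unique => // _ [[a b]] _ <-.
rewrite /pushforward/=.
rewrite [X in _ = lebesgue_measure X](_ : _ = `[c - b, c - a[%classic); last first.
  by apply/seteqP; split=> y /=; rewrite !in_itv/= => /andP[h1 h2];
    apply/andP; split; lra.
rewrite !lebesgue_measure_itv/= !lte_fin.
by rewrite ltrD2l ltrN2; case: ifP => //; rewrite -!EFinB => _; congr EFin; ring.
Qed.

Lemma leb_cons n (A : set 'rV[R]_n.+1) :
  leb n.+1 A = (\int[lebesgue_measure]_a leb n [set z | A (cons_row (a, z))])%E.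
Proof.
rewrite /= /lebesgue_step /pushforward/= /product_measure1.
by apply: eq_integral => a _ /=; rewrite /xsection/=; congr (leb n _);
  apply/seteqP; split=> z /=; rewrite ?inE.
Qed.

(** By induction on the dimension, since a slice of the preimage is a reflected
slice. The map [y |-> x - y] is preferred to a translation because it is the one
under which a convolution kernel is integrated; translations are compositions of
two such maps. *)
Lemma leb_reflect n (x : 'rV[R]_n) (A : set 'rV[R]_n) : measurable A ->
  leb n ((fun y => x - y) @^-1` A) = leb n A.
Proof.
elim: n x A => [|n IH] x A mA.
  by congr (leb 0 _); apply/seteqP; split=> y /=; rewrite (thinmx0 (x - y)) (thinmx0 y).
have mB : measurable (cons_row @^-1` A : set (measurableTypeR R * 'rV[R]_n)).
  by rewrite -[X in measurable X]setTI; exact: measurable_cons_row.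
rewrite !leb_cons.
pose G (a : measurableTypeR R) := leb n [set z | A (cons_row (a, z))].
pose x0 := x ord0 ord0; pose x' : 'rV[R]_n := \row_j x ord0 (lift ord0 j).
have Gsec : G = fun a => leb n (xsection (cons_row @^-1` A) a).
  by apply/funext => a; congr (leb n _); apply/seteqP; split=> z /=;
    rewrite /xsection/= ?inE.
have mG : measurable_fun setT G.
  by rewrite Gsec; exact: measurable_fun_xsection.
have eqc (a : measurableTypeR R) z :
    x - cons_row (a, z) = cons_row (x0 - a, x' - z).
  apply/rowP => i; have [j ->|->] := unliftP ord0 i; rewrite mxE.
    by rewrite [in LHS]mxE !cons_row_lift !mxE.
  by rewrite [in LHS]mxE !cons_row0.
have G0 a : (0 <= G a)%E by exact: measure_ge0.
have -> : (fun a : measurableTypeR R =>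
    leb n [set z | ((fun y => x - y) @^-1` A) (cons_row (a, z))]) =
    G \o (fun a => x0 - a).
  apply/funext => a /=; rewrite /G -(IH x' [set z | A (cons_row (x0 - a, z))]); last first.
    rewrite (_ : [set z | _] = xsection (cons_row @^-1` A) (x0 - a)).
      exact: measurable_xsection.
    by apply/seteqP; split=> z /=; rewrite /xsection/= inE.
  congr (leb n _); apply/seteqP; split=> z /=; rewrite eqc//.
have mphi : measurable_fun [set: measurableTypeR R]
    (fun a : measurableTypeR R => (x0 - a : measurableTypeR R)).
  by apply: measurable_funB.
pose phi (a : measurableTypeR R) : measurableTypeR R := x0 - a.
transitivity (\int[pushforward lebesgue_measure phi]_a G a)%E.
  by rewrite (ge0_integral_pushforward mphi)// preimage_setT.
apply: eq_measure_integral => /= B mB' _.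
exact: lebesgue_measure_reflect.
Qed.

Definition cube n (c r : R) : set 'rV[R]_n :=
  [set z | forall i, c - r < z ord0 i < c + r].

Arguments cube : clear implicits.

Lemma measurable_cube n c r : measurable (cube n c r).
Proof.
rewrite (_ : cube n c r = box (const_mx c) r); first exact: measurable_box.
by apply/seteqP; split=> z /= h i; have := h i; rewrite mxE ltr_distl.
Qed.

Lemma leb_cube n c r : 0 <= r -> leb n (cube n c r) = ((2 * r) ^+ n)%:E.
Proof.
move=> r0; elim: n => [|n IH].
  rewrite expr0 (_ : cube 0 c r = setT); last first.
    by apply/seteqP; split=> z //= _ [].
  exact: diracT.
have -> : leb n.+1 (cube n.+1 c r) =
    (lebesgue_measure \x leb n)%E (`]c - r, c + r[%classic `*` cube n c r).
  rewrite /= /lebesgue_step /pushforward; congr (product_measure1 _ _ _).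
  apply/seteqP; split=> -[a z] /=; rewrite in_itv/=.
    move=> h; split; first by have := h ord0; rewrite cons_row0.
    by move=> i; have := h (lift ord0 i); rewrite cons_row_lift.
  move=> [h1 h2] i; have [j ->|->] := unliftP ord0 i.
    by rewrite cons_row_lift; exact: h2.
  by rewrite cons_row0.
rewrite product_measure1E//; last exact: measurable_cube.
rewrite [X in (_ * X)%E]IH [X in (X * _)%E](lebesgue_measure_itv `]c - r, c + r[)/= lte_fin.
case: ifPn => [_|].
  by rewrite -EFinB -EFinM exprS; congr EFin; congr (_ * _); ring.
rewrite -leNgt => h; have -> : r = 0 by lra.
by rewrite mul0e mulr0 exprS mul0r.
Qed.

End LebesgueRow.
Arguments cube {R}.

(** * Change of variables and the Euclidean norm *)

Section Kernel.
Context {R : realType} {n : nat}.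
Implicit Types x y z : 'rV[R]_n.

Lemma measurable_fun_subr x : measurable_fun setT (fun y => x - y).
Proof.
apply: measurable_fun_rowP => i; under eq_fun do rewrite mxE mxE.
by apply: measurable_funB => //; exact: measurable_coord.
Qed.

Lemma measurable_fun_subl y : measurable_fun setT (fun x : 'rV[R]_n => x - y).
Proof.
apply: measurable_fun_rowP => i; under eq_fun do rewrite mxE mxE.
by apply: measurable_funB => //; exact: measurable_coord.
Qed.

Lemma measurable_fun_opp_rV : measurable_fun setT (fun y : 'rV[R]_n => - y).
Proof.
apply: measurable_fun_rowP => i; under eq_fun do rewrite mxE.
by apply: measurableT_comp => //; exact: measurable_coord.
Qed.

Lemma measurable_fun_sub2 :
  measurable_fun setT (fun z : 'rV[R]_n * 'rV[R]_n => z.1 - z.2).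
Proof.
apply: measurable_fun_rowP => i; under eq_fun do rewrite !mxE.
apply: measurable_funB.
  exact: (measurableT_comp (measurable_coord i) measurable_fst).
exact: (measurableT_comp (measurable_coord i) measurable_snd).
Qed.

Lemma ge0_integral_reflect x (f : 'rV[R]_n -> \bar R) :
  measurable_fun setT f -> (forall z, 0 <= f z)%E ->
  (\int[leb n]_y f (x - y)%R = \int[leb n]_z f z)%E.
Proof.
move=> mf f0.
transitivity (\int[pushforward (leb n) (fun y => x - y)%R]_z f z)%E.
  rewrite (ge0_integral_pushforward (measurable_fun_subr x))//.
apply: eq_measure_integral => [|mphi B mB _]; first exact: measurable_fun_subr.
exact: leb_reflect.
Qed.

Lemma ge0_integral_shift y (f : 'rV[R]_n -> \bar R) :
  measurable_fun setT f -> (forall z, 0 <= f z)%E ->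
  (\int[leb n]_x f (x - y)%R = \int[leb n]_z f z)%E.
Proof.
move=> mf f0; pose g z := f (- z).
have mg : measurable_fun setT g.
  by apply: measurableT_comp => //; exact: measurable_fun_opp_rV.
have g0 z : (0 <= g z)%E by exact: f0.
transitivity (\int[leb n]_x g (y - x)%R)%E.
  by apply: eq_integral => x _; rewrite /g opprB.
rewrite ge0_integral_reflect//.
transitivity (\int[leb n]_z f (0 - z)%R)%E; last exact: ge0_integral_reflect.
by apply: eq_integral => z _; rewrite /g sub0r.
Qed.

Lemma measurable_enorm : measurable_fun setT (@enorm R n).
Proof.
have ms : measurable_fun setT (@Num.sqrt R).
  by apply: continuous_measurable_fun; exact: sqrt_continuous.
have md : measurable_fun setT (fun z : 'rV[R]_n => dotr z z).
  by apply: measurable_sum => i; apply: measurable_funM; exact: measurable_coord.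
exact: measurableT_comp ms md.
Qed.

Lemma enorm_ge0 z : 0 <= enorm z. Proof. exact: sqrtr_ge0. Qed.

Lemma dotr_ge0 z : 0 <= dotr z z.
Proof. by apply: sumr_ge0 => i _; rewrite -expr2 sqr_ge0. Qed.

Lemma enorm0 : enorm (0 : 'rV[R]_n) = 0.
Proof. by rewrite /enorm /dotr big1 ?sqrtr0// => i _; rewrite mxE mul0r. Qed.

Lemma coord_le_enorm z i : `|z ord0 i| <= enorm z.
Proof.
rewrite -sqrtr_sqr ler_sqrt; last exact: dotr_ge0.
rewrite /dotr (bigD1 i)//= expr2 lerDl sumr_ge0// => j _.
by rewrite -expr2 sqr_ge0.
Qed.

Lemma normv_le_enorm z : `|z| <= enorm z.
Proof.
rewrite normvE; apply/bigmax_leP; split; first exact: enorm_ge0.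
by move=> [i j] _ /=; rewrite (ord1 i); exact: coord_le_enorm.
Qed.

Lemma enorm_gt0 z : z != 0 -> 0 < enorm z.
Proof. by move=> z0; rewrite (lt_le_trans _ (normv_le_enorm z))// normr_gt0. Qed.

Lemma enorm_le_normv z : enorm z <= n.+1%:R * `|z|.
Proof.
rewrite -[leRHS]ger0_norm ?mulr_ge0// -sqrtr_sqr ler_sqrt ?sqr_ge0//.
rewrite /dotr; apply: (@le_trans _ _ (\sum_(i < n) `|z| ^+ 2)).
  apply: ler_sum => i _; rewrite -expr2 -real_normK ?num_real//.
  by rewrite lerXn2r ?nnegrE// coord_le_normv.
rewrite sumr_const card_ord exprMn -[leLHS]mulr_natl.
rewrite ler_wpM2r ?sqr_ge0// -natrX ler_nat.
by rewrite (leq_trans (leqnSn n))// -[leqLHS]mulr1 -mulnn leq_mul.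
Qed.

Lemma enormN z : enorm (- z) = enorm z.
Proof.
by rewrite /enorm /dotr; congr Num.sqrt; apply: eq_bigr => i _;
  rewrite !mxE mulrNN.
Qed.

Lemma enormB x y : enorm (x - y) = enorm (y - x).
Proof. by rewrite -enormN opprB. Qed.

End Kernel.

(** * Integrability of the truncated fractional kernel *)

Lemma nneseries_geometric_lty {R : realType} (C r : R) : 0 <= C -> 0 < r < 1 ->
  (\sum_(k <oo) (C * r ^+ k)%:E < +oo)%E.
Proof.
move=> C0 /andP[r0 r1].
apply: (@le_lt_trans _ _ (C * (1 - r)^-1)%:E); last exact: ltry.
apply: lime_le.
  apply: is_cvg_nneseries => k _ _.
  by rewrite lee_fin mulr_ge0// exprn_ge0// ltW.
apply: nearW => N; rewrite sumEFin lee_fin.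
apply: le_trans (geometric_le_lim N C0 r0 _); last by rewrite ger0_norm// ltW.
by rewrite /series/= big_mkord.
Qed.

Lemma ex_dyadic_shell {R : realType} (t : R) : 0 < t -> t <= 1 ->
  exists k, 2^-1 ^+ k.+1 < t <= 2^-1 ^+ k.
Proof.
move=> t0 t1.
have ex : exists k, 2^-1 ^+ k < t.
  have := @cvg_geometric R 1 2^-1; rewrite ger0_norm// invf_lt1// ltr1n => /(_ isT).
  move=> /cvgrPdist_lt/(_ t t0)[N _ /(_ N (leqnn N))] /=.
  rewrite sub0r normrN mul1r ger0_norm ?exprn_ge0//.
  by exists N.
case: (ex_minnP ex) => -[|k] hk mk; first by move: hk; rewrite expr0 ltNge t1.
exists k; rewrite hk/= leNgt; apply/negP => /mk.
by rewrite ltnn.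
Qed.

Lemma le_nneseries_term {R : realType} (f : nat -> \bar R) k :
  (forall i, 0 <= f i)%E -> (f k <= \sum_(i <oo) f i)%E.
Proof.
move=> f0; rewrite (nneseriesD1 (n := k))// leeDl//.
by apply: nneseries_ge0 => i _ _; exact: f0.
Qed.

Lemma integral_cst_cube {R : realType} n (a r : R) : 0 <= a -> 0 <= r ->
  (\int[leb n]_z (a * \1_(cube n 0 r) z)%:E = (a * (2 * r) ^+ n)%:E)%E.
Proof.
move=> a0 r0; have mc := @measurable_cube R n 0 r.
under eq_integral do rewrite EFinM.
rewrite ge0_integralZl_EFin//; last first.
  by apply/measurable_EFinP; exact: measurable_indic.
rewrite EFinM; congr (_ * _)%E; rewrite integral_indic// setIT.
exact: leb_cube.
Qed.

Section KernelIntegrable.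
Context {R : realType} {n : nat} (s : R).
Hypothesis s01 : 0 < s < 1.
Implicit Types x y z : 'rV[R]_n.

Let p : R := n%:R + 2 * s.
Let h : R := 2^-1.
Let hp : R := h `^ p.

(** Up to a constant, this bounds the Gagliardo density of every bounded
Lipschitz function: the Lipschitz condition tames the singularity at the origin,
and boundedness the behaviour at infinity. *)
Definition truncated_kernel z : R := Num.min 1 (enorm z ^+ 2) / enorm z `^ p.

Lemma truncated_kernel_ge0 z : 0 <= truncated_kernel z.
Proof. by rewrite divr_ge0 ?powR_ge0// le_min ler01 sqr_ge0. Qed.

Lemma measurable_truncated_kernel : measurable_fun setT truncated_kernel.
Proof.
apply: measurable_funM.
  apply: measurable_minr => //; apply: measurable_funX; exact: measurable_enorm.
have me : measurable_fun setT (fun z : 'rV[R]_n => enorm z `^ (- p)).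
  exact: measurableT_comp (measurable_powR (- p)) (@measurable_enorm R n).
by apply: eq_measurable_fun me => z _; rewrite powRN.
Qed.

Let h0 : 0 < h. Proof. by rewrite invr_gt0. Qed.
Let p0 : 0 < p.
Proof. by move/andP: s01 => [? ?]; rewrite ltr_wpDl ?ler0n// mulr_gt0. Qed.
Let hp0 : 0 < hp. Proof. exact: powR_gt0. Qed.

Let powh k : (h ^+ k) `^ p = hp ^+ k.
Proof.
by rewrite -powR_mulrn ?(ltW h0)// -powRrM mulrC powRrM powR_mulrn// powR_ge0.
Qed.

(** On the dyadic shell of radius about [2^-k], respectively [2^k], the kernel
is at most a constant; the products of these constants with the volumes of cubes
around the shells form geometric sequences of ratio [2^(2s-2)], respectively
[2^(-2s)]. The cubes overlap, which only enlarges the upper bound. *)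
Let near k z : R :=
  (h ^+ k) ^+ 2 / hp ^+ k.+1 * \1_(cube n 0 (2 * h ^+ k)) z.
Let far k z : R := hp ^+ k * \1_(cube n 0 (h ^+ k.+1)^-1) z.

Let near_ge0 k z : 0 <= near k z.
Proof. by rewrite mulr_ge0// divr_ge0 ?exprn_ge0 ?ltW// exprn_gt0. Qed.

Let far_ge0 k z : 0 <= far k z.
Proof. by rewrite mulr_ge0// exprn_ge0// ltW. Qed.

Let mcube r : measurable (cube n (0 : R) r). Proof. exact: measurable_cube. Qed.

Let mem_cube z r : enorm z < r -> z \in cube n 0 r.
Proof.
move=> zr; rewrite inE => i /=; rewrite !add0r -ltr_norml.
exact: le_lt_trans (coord_le_enorm z i) zr.
Qed.

Let kernel_le z : exists k, truncated_kernel z <= near k z \/ truncated_kernel z <= far k z.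
Proof.
have [->|z0] := eqVneq z 0.
  exists 0%N; left; apply: le_trans (near_ge0 0 0).
  by rewrite /truncated_kernel enorm0 expr0n/= [Num.min _ _]min_r ?ler01// mul0r.
have e0 := enorm_gt0 z0.
have [e1|e1] := leP (enorm z) 1.
  have [k /andP[k1 k2]] := ex_dyadic_shell e0 e1.
  exists k; left; rewrite /near indicE mem_cube/=; last first.
    apply: le_lt_trans k2 _; rewrite ltr_pMl ?exprn_gt0//.
    by rewrite ltr1n.
  rewrite mulr1 /truncated_kernel min_r; last first.
    by rewrite -[leRHS](expr1n _ 2) lerXn2r ?nnegrE// ltW.
  apply: ler_pM; rewrite ?sqr_ge0// ?invr_ge0 ?powR_ge0//.
    by rewrite lerXn2r// nnegrE ?ltW// exprn_gt0.
  rewrite lef_pV2 ?posrE ?powR_gt0// ?exprn_gt0//.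
  rewrite -powh; apply: ge0_ler_powR; rewrite ?nnegrE ?(ltW p0) ?(ltW k1)//;
    by rewrite ltW// exprn_gt0.
have i0 : 0 < (enorm z)^-1 by rewrite invr_gt0.
have i1 : (enorm z)^-1 <= 1 by rewrite invf_le1// ltW.
have [k /andP[k1 k2]] := ex_dyadic_shell i0 i1.
exists k; right; rewrite /far indicE mem_cube/=; last first.
  by rewrite -[ltLHS]invrK ltf_pV2 ?posrE// exprn_gt0.
rewrite mulr1 /truncated_kernel; apply: (@le_trans _ _ (enorm z `^ p)^-1).
  by rewrite ler_piMl ?invr_ge0 ?powR_ge0// ge_min lexx.
rewrite -powRN -mulN1r powRrM powR_inv1 ?(ltW e0)// -powh.
apply: ge0_ler_powR; rewrite ?nnegrE ?(ltW p0) ?(ltW i0)//.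
by rewrite ltW// exprn_gt0.
Qed.

Let h_neq0 : h != 0. Proof. by rewrite gt_eqF. Qed.

Let ratio01 t : 0 < t -> 0 < h `^ t < 1.
Proof.
move=> t0; rewrite powR_gt0//=.
have := @gt0_ltr_powR R t t0 h 1; rewrite powR1; apply; rewrite ?nnegrE//.
  exact: ltW.
by rewrite invf_lt1// ltr1n.
Qed.

Lemma integral_truncated_kernel_lty :
  (\int[leb n]_z (truncated_kernel z)%:E < +oo)%E.
Proof.
have mnear k : measurable_fun setT (EFin \o near k).
  by apply/measurable_EFinP; apply: measurable_funM.
have mfar k : measurable_fun setT (EFin \o far k).
  by apply/measurable_EFinP; apply: measurable_funM.
pose N z := (\sum_(k <oo) (near k z)%:E)%E.
pose F z := (\sum_(k <oo) (far k z)%:E)%E.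
have mN : measurable_fun setT N.
  by apply: ge0_emeasurable_sum => [k z _ _|k _]; [rewrite lee_fin|exact: mnear].
have mF : measurable_fun setT F.
  by apply: ge0_emeasurable_sum => [k z _ _|k _]; [rewrite lee_fin|exact: mfar].
have N0 z : (0 <= N z)%E by apply: nneseries_ge0 => k _ _; rewrite lee_fin.
have F0 z : (0 <= F z)%E by apply: nneseries_ge0 => k _ _; rewrite lee_fin.
apply: (@le_lt_trans _ _ (\int[leb n]_z (N z + F z))%E).
  apply: ge0_le_integral => //.
  - by move=> z _; rewrite lee_fin; exact: truncated_kernel_ge0.
  - by apply/measurable_EFinP; exact: measurable_truncated_kernel.
  - exact: emeasurable_funD.
  - move=> z _; have [k [hk|hk]] := kernel_le z.
      apply: (@le_trans _ _ (N z)); last by rewrite leeDl.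
      apply: (@le_trans _ _ (near k z)%:E); first by rewrite lee_fin.
      by apply: (@le_nneseries_term R (fun k => (near k z)%:E)) => i; rewrite lee_fin.
    apply: (@le_trans _ _ (F z)); last by rewrite leeDr.
    apply: (@le_trans _ _ (far k z)%:E); first by rewrite lee_fin.
    by apply: (@le_nneseries_term R (fun k => (far k z)%:E)) => i; rewrite lee_fin.
move/andP: s01 => [s0 s1].
rewrite ge0_integralD//; apply: lte_add_pinfty.
  rewrite integral_nneseries//; last by move=> k z _; rewrite lee_fin.
  have r01 : 0 < h `^ (2 - 2 * s) < 1 by apply: ratio01; lra.
  have rE : h ^+ 2 * h ^+ n = hp * h `^ (2 - 2 * s).
    rewrite -powRD ?h_neq0 ?implybT// -exprD -powR_mulrn ?(ltW h0)//.
    by congr powR; rewrite /p natrD; ring.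
  have C0 : 0 <= 4 ^+ n / hp by rewrite divr_ge0 ?exprn_ge0// ltW.
  apply: le_lt_trans (nneseries_geometric_lty C0 r01).
  apply: lee_nneseries => [k _ _|k _]; first by apply: integral_ge0 => z _; rewrite lee_fin.
  rewrite integral_cst_cube ?mulr_ge0 ?invr_ge0 ?exprn_ge0 ?(ltW h0) ?(ltW hp0)//.
  rewrite lee_fin le_eqVlt; apply/orP; left; apply/eqP.
  have -> : h `^ (2 - 2 * s) = h ^+ 2 * h ^+ n / hp by rewrite rE mulrAC divff ?mul1r// gt_eqF.
  rewrite !exprMn -!exprM muln2 -addnn exprD [(n * k)%N]mulnC [hp^-1 ^+ k]exprVn exprS.
  have hpk : hp ^+ k != 0 by rewrite expf_neq0// gt_eqF.
  rewrite (_ : 4 ^+ n = 2 ^+ n * 2 ^+ n :> R); last by rewrite -exprMn; congr (_ ^+ _); ring.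
  move: (hp ^+ k) hpk (h ^+ k) (h ^+ (k * n)) (2 ^+ n : R) => a a0 b c d.
  by field; rewrite a0 gt_eqF.
rewrite integral_nneseries//; last by move=> k z _; rewrite lee_fin.
have r01 : 0 < h `^ (2 * s) < 1 by apply: ratio01; lra.
have rE : hp = h ^+ n * h `^ (2 * s).
  by rewrite -powR_mulrn ?(ltW h0)// -powRD ?h_neq0 ?implybT.
have C0 : 0 <= (2 / h) ^+ n by rewrite exprn_ge0// divr_ge0// ltW.
apply: le_lt_trans (nneseries_geometric_lty C0 r01).
apply: lee_nneseries => [k _ _|k _]; first by apply: integral_ge0 => z _; rewrite lee_fin.
rewrite integral_cst_cube ?invr_ge0 ?exprn_ge0 ?(ltW h0) ?(ltW hp0)//.
rewrite lee_fin le_eqVlt; apply/orP; left; apply/eqP.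
have -> : (2 * h ^- k.+1) ^+ n = (2 / h) ^+ n / (h ^+ n) ^+ k.
  by rewrite exprS invfM mulrA exprMn exprVn exprAC.
have hn : (h ^+ n) ^+ k != 0 by rewrite !expf_neq0.
rewrite rE exprMn mulrC mulrA -[_ / _ * _]mulrA mulVf// mulr1.
by [].
Qed.

End KernelIntegrable.

(** * Positivity of the normalization constant *)

Section FracLapConst.
Context {R : realType}.

Lemma sin_le_id (t : R) : 0 <= t -> `|sin t| <= t.
Proof.
move=> t0; have [c _] := @MVT_segment R sin cos 0 t t0
  (fun x _ => is_derive_sin x)
  (continuous_subspaceT (@continuous_sin R)).
rewrite sin0 !subr0 => ->; rewrite normrM (ger0_norm t0).
by rewrite ler_piMl// cos_max.
Qed.

Lemma one_sub_cos_le_sqr (t : R) : 1 - cos t <= t ^+ 2.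
Proof.
wlog t0 : t / 0 <= t => [th|].
  have [/th//|t0] := leP 0 t.
  by rewrite -sqrrN -cosN; apply: th; rewrite oppr_ge0 ltW.
have [c] := @MVT_segment R cos (fun x => - sin x) 0 t t0
  (fun x _ => is_derive_cos x)
  (continuous_subspaceT (@continuous_cos R)).
rewrite in_itv/= => /andP[c0 ct]; rewrite cos0 subr0 => h.
have -> : 1 - cos t = sin c * t by rewrite -opprB h mulNr opprK.
rewrite expr2 ler_wpM2r//; apply: le_trans ct.
exact: le_trans (ler_norm _) (sin_le_id c0).
Qed.

Lemma cos1_lt1 : cos 1 < 1 :> R.
Proof.
have p1 : (1 : R) <= pi by apply: le_trans (@pi_ge2 R); rewrite ler1n.
rewrite -[ltRHS]cos0 ltr_cos ?ltr01// in_itv/= ?lexx ?pi_ge0//.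
by rewrite ler01 p1.
Qed.

Lemma cos_le_cos1 (t : R) : 1 <= t <= 2 -> cos t <= cos 1.
Proof.
move=> /andP[t1 t2]; have p2 := @pi_ge2 R; rewrite le_eqVlt.
move: t1; rewrite le_eqVlt => /predU1P[->|t1]; first by rewrite eqxx.
have tI : t \in `[0, pi] by rewrite in_itv/=; apply/andP; split; lra.
have oI : (1 : R) \in `[0, pi] by rewrite in_itv/=; apply/andP; split; lra.
by rewrite ltr_cos// t1 orbT.
Qed.

Context {n : nat} (s : R).
Hypothesis n0 : (0 < n)%N.
Hypothesis s01 : 0 < s < 1.

Let p : R := n%:R + 2 * s.
Let t (z : 'rV[R]_n) : R := \sum_(i < n | i == 0%N :> nat) z ord0 i.
Let g (z : 'rV[R]_n) : R := (1 - cos (t z)) / enorm z `^ p.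

Let tE z : t z = z ord0 (Ordinal n0).
Proof. by rewrite /t (big_pred1 (Ordinal n0)). Qed.

Let g_ge0 z : 0 <= g z.
Proof. by rewrite divr_ge0 ?powR_ge0// subr_ge0 cos_le1. Qed.

Let g_le z : g z <= 2 * truncated_kernel s z.
Proof.
rewrite /truncated_kernel mulrA ler_wpM2r ?invr_ge0 ?powR_ge0//.
have := cos_geN1 (t z); have := one_sub_cos_le_sqr (t z).
have : t z ^+ 2 <= enorm z ^+ 2.
  rewrite -real_normK ?num_real// lerXn2r ?nnegrE ?enorm_ge0//.
  by rewrite tE coord_le_enorm.
have := sqr_ge0 (enorm z).
by case: (leP 1 (enorm z ^+ 2)); lra.
Qed.

Let measurable_g : measurable_fun setT g.
Proof.
apply: measurable_funM.
  apply: measurable_funB => //.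
  have mt : measurable_fun setT t.
    by rewrite (_ : t = fun z => z ord0 (Ordinal n0));
      [exact: measurable_coord|exact/funext].
  apply: measurableT_comp mt.
  by apply: continuous_measurable_fun; exact: continuous_cos.
have me : measurable_fun setT (fun z : 'rV[R]_n => enorm z `^ (- p)).
  exact: measurableT_comp (measurable_powR (- p)) (@measurable_enorm R n).
by apply: eq_measurable_fun me => z _; rewrite powRN.
Qed.

(** The defining integral is finite because [1 - cos t <= min(2, t^2)], and
positive because its integrand is bounded below on the cube of the points with
all coordinates in [1, 2]. *)
Lemma fraclap_const_gt0 : 0 < fraclap_const n s.
Proof.
rewrite /fraclap_const invr_gt0 fine_gt0//; apply/andP; split; last first.
  apply: (@le_lt_trans _ _ (\int[leb n]_z (2%:E * (truncated_kernel s z)%:E))%E).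
    apply: ge0_le_integral => //.
    - by move=> z _; rewrite lee_fin; exact: g_ge0.
    - exact/measurable_EFinP.
    - apply/measurable_EFinP; apply: measurable_funM => //.
      exact: measurable_truncated_kernel.
    - by move=> z _; rewrite lee_fin; exact: g_le.
  rewrite ge0_integralZl_EFin//; last 2 first.
    by move=> z _; rewrite lee_fin; exact: truncated_kernel_ge0.
    by apply/measurable_EFinP; exact: measurable_truncated_kernel.
  by rewrite lte_mul_pinfty//; exact: integral_truncated_kernel_lty.
pose Q : set 'rV[R]_n := cube n (3 / 2) (1 / 2).
have mQ : measurable Q by exact: measurable_cube.
pose c : R := (1 - cos 1) / (n.+1%:R * 2) `^ p.
have c0 : 0 < c.
  by rewrite divr_gt0 ?subr_gt0 ?cos1_lt1// powR_gt0// mulr_gt0.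
have p0 : 0 < p.
  by move/andP: s01 => [? ?]; rewrite ltr_wpDl ?ler0n// mulr_gt0.
apply: (@lt_le_trans _ _ (\int[leb n]_(z in Q) (cst c%:E) z)%E).
  rewrite integral_cst// [X in (_ * X)%E]leb_cube; last lra.
  by rewrite -EFinM lte_fin mulr_gt0// exprn_gt0//; lra.
apply: (@le_trans _ _ (\int[leb n]_(z in Q) (g z)%:E)%E); last first.
  apply: ge0_subset_integral => //; first exact/measurable_EFinP.
  by move=> z _; rewrite lee_fin; exact: g_ge0.
apply: ge0_le_integral => //.
- by move=> z _; rewrite lee_fin ltW.
- by apply/measurable_EFinP; apply: measurable_funTS.
move=> z Qz; rewrite lee_fin.
have z12 i : 1 <= z ord0 i <= 2 by have := Qz i; lra.
apply: ler_pM; rewrite ?subr_ge0 ?cos_le1 ?invr_ge0 ?powR_ge0//.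
  by rewrite lerB// tE cos_le_cos1.
have e0 : 0 < enorm z.
  apply: lt_le_trans (coord_le_enorm z (Ordinal n0)).
  by rewrite normr_gt0; apply/eqP; have := z12 (Ordinal n0); lra.
rewrite lef_pV2 ?posrE ?powR_gt0 ?mulr_gt0//.
apply: ge0_ler_powR; rewrite ?nnegrE ?mulr_ge0 ?(ltW e0) ?(ltW p0)//.
apply: le_trans (enorm_le_normv z) _; rewrite ler_wpM2l//.
rewrite normvE; apply/bigmax_leP; split=> // -[i j] _ /=.
by rewrite (ord1 i) ler_norml; have := z12 j; lra.
Qed.

End FracLapConst.

(** * The Gagliardo form as an integral on the product space *)

(** A real-valued inner integral is 0 by convention where it diverges, so
Fubini's theorem identifies the two integrands almost everywhere only. Working
on the product space makes linearity and monotonicity of the iterated integrals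
immediate. *)
Lemma iterated_Rintegral d1 d2 (T1 : measurableType d1) (T2 : measurableType d2)
    (R : realType) (m1 : {sigma_finite_measure set T1 -> \bar R})
    (m2 : {sigma_finite_measure set T2 -> \bar R})
    (D1 : set T1) (D2 : set T2) (W : T1 * T2 -> R) :
  measurable D1 -> measurable D2 ->
  (m1 \x m2)%E.-integrable (D1 `*` D2) (EFin \o W) ->
  \int[m1]_(x in D1) \int[m2]_(y in D2) W (x, y) =
  \int[(m1 \x m2)%E]_(z in D1 `*` D2) W z.
Proof.
move=> mD1 mD2 iW; have mD : measurable (D1 `*` D2) by exact: measurableX.
pose f : T1 * T2 -> \bar R := EFin \o (W \_ (D1 `*` D2)).
have fi : (m1 \x m2)%E.-integrable setT f.
  move/(integrable_mkcond _ mD): iW; apply: eq_integrable => // z _.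
  by rewrite /f/= restrict_EFin.
rewrite [RHS]Rintegral_mkcond /Rintegral -[in RHS]/f -integral12_prod_meas1//.
rewrite integral_mkcond; congr fine; pose F := fubini_F m2 f.
have FE x : ((fun x => (fine (\int[m2]_(y in D2) (W (x, y))%:E))%:E) \_ D1) x =
    (fine (F x))%:E.
  rewrite /F /fubini_F /f patchE; case: ifPn => xD1.
    congr (fine _)%:E; rewrite [LHS]integral_mkcond; apply: eq_integral => y _ /=.
    rewrite !patchE; have [yD2|yD2] := boolP (y \in D2).
      by rewrite mem_set//; split; apply/set_mem.
    by rewrite memNset// => -[_ /= /mem_set]; exact/negP.
  rewrite integral0_eq// => y _ /=; rewrite patchE memNset// => -[/= /mem_set].
  by move=> h; move: xD1; rewrite h.
transitivity (\int[m1]_x (fine (F x))%:E)%E.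
  by apply: eq_integral => x _; exact: FE.
have Fi := integrable_fubini_F fi.
have mF := measurable_int _ Fi.
apply: ae_eq_integral => //.
- by apply/measurable_EFinP; apply: (measurableT_comp _ mF); exact: fine_measurable.
- have := integrable_ae measurableT Fi; apply: filterS => x /= /(_ I) h _.
  exact: fineK.
Qed.

Section Gagliardo.
Context {R : realType} {n : nat} (s : R).
Hypothesis s01 : 0 < s < 1.
Local Notation rV := 'rV[R]_n.
Local Notation leb2 := (leb n \x leb n)%E.
Implicit Types (u v : rV -> R) (Om : set rV).

Let p : R := n%:R + 2 * s.

Definition gagliardo_density u v (z : rV * rV) : R :=
  (u z.1 - u z.2) * (v z.1 - v z.2) / enorm (z.1 - z.2) `^ p.

(** Bounded Lipschitz functions that vanish outside [Om]. Both properties are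
put into a single inequality, whose right-hand side is the numerator of
[truncated_kernel]. *)
Definition lipschitz_in Om v : Prop :=
  [/\ measurable_fun setT v, forall x, ~ Om x -> v x = 0 &
      exists2 L : R, 0 <= L & forall x y,
        (v x - v y) ^+ 2 <= L * Num.min 1 (enorm (x - y) ^+ 2)].

Lemma measurable_enorm_sub_powR (q : R) :
  measurable_fun setT (fun z : rV * rV => enorm (z.1 - z.2) `^ q).
Proof.
apply: (measurableT_comp (measurable_powR q)).
exact: measurableT_comp (@measurable_enorm R n) (@measurable_fun_sub2 R n).
Qed.

Lemma measurable_gagliardo_density u v :
  measurable_fun setT u -> measurable_fun setT v ->
  measurable_fun setT (gagliardo_density u v).
Proof.
move=> mu mv.
have mB (w : rV -> R) : measurable_fun setT w ->
    measurable_fun setT (fun z : rV * rV => w z.1 - w z.2).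
  move=> mw; apply: measurable_funB.
    exact: measurableT_comp mw measurable_fst.
  exact: measurableT_comp mw measurable_snd.
apply: measurable_funM; first by apply: measurable_funM; exact: mB.
apply: eq_measurable_fun (measurable_enorm_sub_powR (- p)) => z _.
by rewrite powRN.
Qed.

Lemma gagliardo_density_ge0 v z : 0 <= gagliardo_density v v z.
Proof. by rewrite divr_ge0 ?powR_ge0// -expr2 sqr_ge0. Qed.

Lemma measurable_truncated_kernel_sub :
  measurable_fun setT (fun z : rV * rV => truncated_kernel s (z.1 - z.2)).
Proof.
exact: measurableT_comp (measurable_truncated_kernel s) (@measurable_fun_sub2 R n).
Qed.

(** Integrating first in the free variable gives the total mass of the kernel
times the volume of [Om], once for each of the two indicators. *)
Lemma integral_truncated_kernel_indic Om : measurable Om ->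
  (leb n Om < +oo)%E ->
  (\int[leb2]_z
    (truncated_kernel s (z.1 - z.2) * (\1_Om z.1 + \1_Om z.2))%:E < +oo)%E.
Proof.
move=> mOm Omoo.
have mk := measurable_truncated_kernel_sub.
have mI : measurable_fun setT (\1_Om : rV -> R) by exact: measurable_indic.
have m1 : measurable_fun setT (fun z : rV * rV => (\1_Om z.1 : R)).
  exact: measurableT_comp mI measurable_fst.
have m2 : measurable_fun setT (fun z : rV * rV => (\1_Om z.2 : R)).
  exact: measurableT_comp mI measurable_snd.
have k0 := @truncated_kernel_ge0 R n s.
pose K : \bar R := (\int[leb n]_z (truncated_kernel s z)%:E)%E.
have Koo : (K < +oo)%E by exact: integral_truncated_kernel_lty.
have K0 : (0 <= K)%E by apply: integral_ge0 => z _; rewrite lee_fin.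
have mkE : measurable_fun setT (EFin \o (@truncated_kernel R n s)).
  by apply/measurable_EFinP; exact: measurable_truncated_kernel.
have Kf : K \is a fin_num by rewrite ge0_fin_numE.
have bound : (\int[leb n]_x ((fine K)%:E * (\1_Om x)%:E) < +oo)%E.
  rewrite ge0_integralZl_EFin//; last 2 first.
    by apply/measurable_EFinP; exact: measurable_indic.
    exact: fine_ge0.
  by rewrite integral_indic// setIT lte_mul_pinfty// ?lee_fin ?fine_ge0.
under eq_integral do rewrite mulrDr EFinD.
rewrite ge0_integralD//; last 4 first.
- by move=> z _; rewrite lee_fin mulr_ge0.
- by apply/measurable_EFinP; exact: measurable_funM.
- by move=> z _; rewrite lee_fin mulr_ge0.
- by apply/measurable_EFinP; exact: measurable_funM.
apply: lte_add_pinfty.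
  rewrite fubini_tonelli1//; last 2 first.
  - by apply/measurable_EFinP; exact: measurable_funM.
  - by move=> z; rewrite lee_fin mulr_ge0.
  apply: le_lt_trans bound; rewrite le_eqVlt; apply/orP; left; apply/eqP.
  apply: eq_integral => x _; rewrite /fubini_F/=.
  under eq_integral do rewrite mulrC EFinM.
  rewrite ge0_integralZl_EFin; last 4 first.
  - exact: measurableT.
  - by move=> z _; rewrite lee_fin; exact: k0.
  - exact: measurableT_comp mkE (measurable_fun_subr x).
  - exact: ler0n.
  by rewrite (ge0_integral_reflect x mkE)// -/K muleC fineK.
rewrite fubini_tonelli2//; last 2 first.
- by apply/measurable_EFinP; exact: measurable_funM.
- by move=> z; rewrite lee_fin mulr_ge0.
apply: le_lt_trans bound; rewrite le_eqVlt; apply/orP; left; apply/eqP.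
apply: eq_integral => y _; rewrite /fubini_G/=.
under eq_integral do rewrite mulrC EFinM.
rewrite ge0_integralZl_EFin; last 4 first.
- exact: measurableT.
- by move=> z _; rewrite lee_fin; exact: k0.
- exact: measurableT_comp mkE (measurable_fun_subl y).
- exact: ler0n.
by rewrite (ge0_integral_shift y mkE)// -/K muleC fineK.
Qed.

Lemma gagliardo_density_integrable Om v : measurable Om ->
  (leb n Om < +oo)%E -> lipschitz_in Om v ->
  leb2.-integrable setT (EFin \o gagliardo_density v v).
Proof.
move=> mOm Omoo [mv v0 [L L0 vL]].
have mk := measurable_truncated_kernel_sub.
have mI : measurable_fun setT (\1_Om : rV -> R) by exact: measurable_indic.
have m1 : measurable_fun setT (fun z : rV * rV => (\1_Om z.1 : R)).
  exact: measurableT_comp mI measurable_fst.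
have m2 : measurable_fun setT (fun z : rV * rV => (\1_Om z.2 : R)).
  exact: measurableT_comp mI measurable_snd.
have k0 := @truncated_kernel_ge0 R n s.
pose B (z : rV * rV) := truncated_kernel s (z.1 - z.2) * (\1_Om z.1 + \1_Om z.2).
have mB : measurable_fun setT B.
  by apply: measurable_funM => //; exact: measurable_funD.
have B0 z : 0 <= B z by rewrite mulr_ge0// addr_ge0.
have Bi : leb2.-integrable setT (EFin \o B).
  apply/integrableP; split; first exact/measurable_EFinP.
  under eq_integral do rewrite /= ger0_norm//.
  exact: integral_truncated_kernel_indic.
apply: le_integrable (integrableZl measurableT L Bi) => //.
  by apply/measurable_EFinP; exact: measurable_gagliardo_density.
move=> [x y] _ /=; rewrite lee_fin [leLHS]ger0_norm ?gagliardo_density_ge0//.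
rewrite [leRHS]ger0_norm ?(mulr_ge0 L0 (B0 _))//.
have [Om0|Om1] := pselect (~ Om x /\ ~ Om y).
  rewrite /gagliardo_density/= !v0; [|tauto|tauto].
  by rewrite subrr mul0r mul0r; exact: mulr_ge0.
have ind1 : 1 <= \1_Om x + \1_Om y :> R.
  rewrite !indicE; have [/mem_set ->|xO] := pselect (Om x).
    by rewrite lerDl.
  have [/mem_set ->|yO] := pselect (Om y); first by rewrite lerDr.
  by exfalso; apply: Om1.
apply: (@le_trans _ _ (L * truncated_kernel s (x - y))); last first.
  by rewrite /B/= ler_wpM2l// ler_peMr.
rewrite /gagliardo_density /truncated_kernel/= mulrA.
by rewrite ler_wpM2r ?invr_ge0 ?powR_ge0// -expr2.
Qed.

Lemma gagliardo_density2_integrable Om u v : measurable Om ->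
  (leb n Om < +oo)%E -> lipschitz_in Om u -> lipschitz_in Om v ->
  leb2.-integrable setT (EFin \o gagliardo_density u v).
Proof.
move=> mOm Omoo lu lv.
have iu := gagliardo_density_integrable mOm Omoo lu.
have iv := gagliardo_density_integrable mOm Omoo lv.
have [mu _ _] := lu; have [mv _ _] := lv.
apply: le_integrable (integrableD measurableT iu iv) => //.
  by apply/measurable_EFinP; exact: measurable_gagliardo_density.
move=> z _ /=; rewrite lee_fin [leRHS]ger0_norm; last first.
  by rewrite addr_ge0// gagliardo_density_ge0.
rewrite /gagliardo_density -mulrDl normrM [`|_^-1|]ger0_norm ?invr_ge0 ?powR_ge0//.
rewrite ler_wpM2r ?invr_ge0 ?powR_ge0// normrM.
set a := u _ - _; set b := v _ - _.
rewrite -!expr2 -(real_normK (num_real a)) -(real_normK (num_real b)).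
by have := sqr_ge0 (`|a| - `|b|); have := sqr_ge0 (`|a| + `|b|); nra.
Qed.

Lemma gagliardoE Om D u v : measurable Om ->
  (leb n Om < +oo)%E -> lipschitz_in Om u -> lipschitz_in Om v ->
  measurable D ->
  gagliardo s D u v = \int[leb2]_(z in D `*` D) gagliardo_density u v z.
Proof.
move=> mOm Omoo lu lv mD; rewrite -iterated_Rintegral//.
apply: integrableS (gagliardo_density2_integrable mOm Omoo lu lv) => //.
exact: measurableX.
Qed.

End Gagliardo.

(** * Poincare inequality and control of the full seminorm *)

Lemma ge0_integral_tensor d1 d2 (T1 : measurableType d1) (T2 : measurableType d2)
    (R : realType) (m1 : {sigma_finite_measure set T1 -> \bar R})
    (m2 : {sigma_finite_measure set T2 -> \bar R}) (f : T1 -> R) (g : T2 -> R) :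
  measurable_fun setT f -> measurable_fun setT g ->
  (forall x, 0 <= f x) -> (forall y, 0 <= g y) ->
  (\int[m1 \x m2]_z (f z.1 * g z.2)%:E =
   (\int[m1]_x (f x)%:E) * (\int[m2]_y (g y)%:E))%E.
Proof.
move=> mf mg f0 g0.
have mfE : measurable_fun setT (EFin \o f) by exact/measurable_EFinP.
have mgE : measurable_fun setT (EFin \o g) by exact/measurable_EFinP.
have Ig : (0 <= \int[m2]_y (g y)%:E)%E.
  by apply: integral_ge0 => y _; rewrite lee_fin.
rewrite fubini_tonelli1//=; last 2 first.
- apply/measurable_EFinP; apply: measurable_funM.
    exact: measurableT_comp mf measurable_fst.
  exact: measurableT_comp mg measurable_snd.
- by move=> z; rewrite lee_fin mulr_ge0.
rewrite -ge0_integralZr//; last by move=> x _; rewrite lee_fin.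
apply: eq_integral => x _; rewrite /fubini_F/=.
under eq_integral do rewrite EFinM.
by rewrite ge0_integralZl_EFin// => y _; rewrite lee_fin.
Qed.

Section GagliardoBounds.
Context {R : realType} {n : nat} (s : R).
Hypothesis n0 : (0 < n)%N.
Hypothesis s01 : 0 < s < 1.
Local Notation rV := 'rV[R]_n.
Local Notation leb2 := (leb n \x leb n)%E.
Context (Om Om' : set rV) (M delta : R).
Hypothesis mOm : measurable Om.
Hypothesis mOm' : measurable Om'.
Hypothesis M0 : 0 <= M.
Hypothesis OmM : forall x, Om x -> `|x| <= M.
Hypothesis Om'M : forall x, Om' x -> `|x| <= M.
Hypothesis delta0 : 0 < delta.
Hypothesis sep : forall x y, Om x -> Om' y -> delta <= enorm (x - y).
Implicit Type v : rV -> R.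

Let p : R := n%:R + 2 * s.
Let p0 : 0 < p.
Proof. by move/andP: s01 => [? ?]; rewrite ltr_wpDl ?ler0n// mulr_gt0. Qed.

Lemma leb_bounded_lty (A : set rV) : measurable A ->
  (forall x, A x -> `|x| <= M) -> (leb n A < +oo)%E.
Proof.
move=> mA AM.
apply: (@le_lt_trans _ _ (leb n (cube n 0 (M + 1)))).
  apply: le_measure; rewrite ?inE//; first exact: measurable_cube.
  move=> x /AM xM i; rewrite !add0r -ltr_norml.
  apply: le_lt_trans (coord_le_normv x i) _.
  by apply: le_lt_trans xM _; rewrite ltrDl.
by rewrite leb_cube ?ltry// addr_ge0.
Qed.

Definition sqint v : \bar R := (\int[leb n]_x (v x ^+ 2)%:E)%E.

(** A cube of positive volume outside the ball that contains both domains. *)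
Definition far_cube : set rV := cube n (M + 2) 1.

Lemma far_cube_norm y : far_cube y -> M < `|y| <= M + 3.
Proof.
move=> Ey; apply/andP; split.
  apply: lt_le_trans (coord_le_normv y (Ordinal n0)).
  have /andP[e1 e2] := Ey (Ordinal n0); rewrite ger0_norm; have := M0; lra.
rewrite normvE; apply/bigmax_leP; split; first by rewrite addr_ge0.
move=> [i j] _ /=; rewrite (ord1 i) ler_norml.
by have /andP[e1 e2] := Ey j; have := M0; lra.
Qed.

Lemma Om'_disjoint x : Om' x -> ~ Om x.
Proof.
by move=> Om'x Omx; have := sep Omx Om'x; rewrite subrr enorm0 leNgt delta0.
Qed.

Lemma far_cube_out y : far_cube y -> ~ Om y /\ ~ Om' y.
Proof.
by move=> /far_cube_norm/andP[My _]; split=> [/OmM|/Om'M]; rewrite leNgt My.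
Qed.

Lemma lipschitz_in_bounded v : lipschitz_in Om v ->
  exists2 B : R, 0 <= B & forall x, `|v x| <= B.
Proof.
move=> [_ v0 [L L0 vL]]; exists (L + 1); first by rewrite addr_ge0.
pose y : rV := const_mx (M + 2).
have Ey : far_cube y by move=> i; rewrite mxE; have := M0; lra.
move=> x; have [/v0 yO _] := far_cube_out Ey.
have := vL x y; rewrite yO subr0 => h.
have {}h : `|v x| ^+ 2 <= L.
  rewrite real_normK ?num_real//; apply: le_trans h _.
  by rewrite ler_piMr// ge_min lexx.
have := normr_ge0 (v x); have := sqr_ge0 (`|v x| - 1); nra.
Qed.

Let dens v : rV * rV -> R := gagliardo_density s v v.
Let G v : R := gagliardo s (~` Om') v v.

Let mD : measurable (~` Om' `*` ~` Om').
Proof. by apply: measurableX; exact: measurableC. Qed.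

Let GE v : lipschitz_in Om v ->
  ((G v)%:E = \int[leb2]_(z in ~` Om' `*` ~` Om') (dens v z)%:E)%E.
Proof.
move=> lv; have Omoo := leb_bounded_lty mOm OmM.
rewrite /G (gagliardoE s01 mOm Omoo lv lv) ?fineK//; last exact: measurableC.
apply: integrable_fin_num => //.
by apply: integrableS (gagliardo_density_integrable s01 mOm Omoo lv).
Qed.

Lemma gagliardo_ge0 v : 0 <= G v.
Proof.
by apply: Rintegral_ge0 => x _; apply: Rintegral_ge0 => y _;
  exact: (gagliardo_density_ge0 s v (x, y)).
Qed.

Let mdens v : lipschitz_in Om v -> measurable_fun setT (EFin \o dens v).
Proof.
by move=> [mv _ _]; apply/measurable_EFinP; exact: measurable_gagliardo_density.
Qed.

Let cE : R := ((n.+1%:R * (2 * M + 3)) `^ p)^-1.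
Let cE0 : 0 < cE.
Proof. by rewrite invr_gt0 powR_gt0// mulr_gt0//; have := M0; lra. Qed.

(** Poincare inequality: every point of [Om] interacts, at a bounded distance,
with the unit-size cube [far_cube] where the function vanishes. *)
Lemma poincare v : lipschitz_in Om v ->
  (sqint v <= ((cE * 2 ^+ n)^-1 * G v)%:E)%E.
Proof.
move=> lv; have [mv v0 _] := lv.
have mE : measurable far_cube by exact: measurable_cube.
have mI : measurable_fun setT (\1_far_cube : rV -> R) by exact: measurable_indic.
have c0 : 0 < cE * 2 ^+ n by rewrite mulr_gt0// exprn_gt0.
suff h : ((cE * 2 ^+ n)%:E * sqint v <= (G v)%:E)%E.
  by rewrite EFinM lee_pdivlMl.
have IE : (\int[leb n]_y (\1_far_cube y)%:E = (2 ^+ n)%:E)%E.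
  rewrite integral_indic// setIT.
  by have := @leb_cube R n (M + 2) 1 ler01; rewrite mulr1.
have -> : ((cE * 2 ^+ n)%:E * sqint v =
    \int[leb2]_z ((cE * v z.1 ^+ 2) * \1_far_cube z.2)%:E)%E.
  rewrite (@ge0_integral_tensor _ _ _ _ _ _ _ (fun x => cE * v x ^+ 2)
    \1_far_cube)//.
  - rewrite IE EFinM muleAC; congr (_ * _)%E.
    under eq_integral do rewrite EFinM.
    rewrite ge0_integralZl_EFin//; last exact: ltW.
    + by move=> x _; rewrite lee_fin sqr_ge0.
    + by apply/measurable_EFinP; exact: measurable_funX.
  - by apply: measurable_funM => //; exact: measurable_funX.
  - by move=> x; rewrite mulr_ge0 ?sqr_ge0// ltW.
rewrite GE// [leRHS]integral_mkcond.
apply: ge0_le_integral => //.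
- by move=> z _; rewrite lee_fin mulr_ge0// mulr_ge0 ?sqr_ge0 ?(ltW cE0)//.
- apply/measurable_EFinP; apply: measurable_funM; last first.
    exact: measurableT_comp mI measurable_snd.
  apply: measurable_funM => //; apply: measurable_funX.
  exact: measurableT_comp mv measurable_fst.
- by apply/(measurable_restrictT _ mD); apply: measurable_funTS; exact: mdens.
move=> [x y] _; rewrite patchE/=; case: ifPn => [_|zD]; last first.
  rewrite lee_fin indicE; have [yE|yE] := boolP (y \in far_cube); last first.
    by rewrite mulr0.
  have [Om'x|Om'x] := pselect (Om' x).
    by rewrite (v0 x (Om'_disjoint Om'x)) expr0n/= mulr0 mul0r.
  move/negP: zD; case; apply/mem_set; split => //=.
  by have [_] := far_cube_out (set_mem yE).
rewrite lee_fin indicE; have [yE|yE] := boolP (y \in far_cube); last first.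
  by rewrite mulr0; exact: gagliardo_density_ge0.
rewrite mulr1 /dens /gagliardo_density/=.
have [/v0 -> _] := far_cube_out (set_mem yE).
rewrite subr0 -expr2 mulrC.
have [xO|/v0 ->] := pselect (Om x); last by rewrite expr0n/= !mul0r.
rewrite ler_wpM2l ?sqr_ge0//.
have /andP[My yM] := far_cube_norm (set_mem yE).
have xy : x - y != 0.
  by rewrite subr_eq0; apply: contraTneq My => <-; rewrite -leNgt OmM.
rewrite lef_pV2 ?posrE ?powR_gt0 ?enorm_gt0//; last first.
  by rewrite mulr_gt0//; have := M0; lra.
apply: ge0_ler_powR; rewrite ?nnegrE ?enorm_ge0 ?(ltW p0)//.
  by rewrite mulr_ge0//; have := M0; lra.
apply: le_trans (enorm_le_normv _) _; rewrite ler_wpM2l//.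
apply: le_trans (ler_normB _ _) _; have := OmM xO; lra.
Qed.

Definition poincare_const : R := (cE * 2 ^+ n)^-1.

Lemma poincare_const_gt0 : 0 < poincare_const.
Proof. by rewrite invr_gt0 mulr_gt0// exprn_gt0. Qed.

Let cd : R := (delta `^ p)^-1.
Let cd0 : 0 < cd. Proof. by rewrite invr_gt0 powR_gt0. Qed.

Definition restriction_const : R :=
  1 + 2 * (cd * fine (leb n Om')) * poincare_const.

Lemma restriction_const_gt0 : 0 < restriction_const.
Proof.
rewrite ltr_pwDl// !mulr_ge0 ?(ltW poincare_const_gt0) ?(ltW cd0)//.
exact: fine_ge0.
Qed.

Let dens_near (v : rV -> R) x y : (forall x, ~ Om x -> v x = 0) -> Om' y ->
  v x ^+ 2 / enorm (x - y) `^ p <= cd * v x ^+ 2.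
Proof.
move=> v0 Om'y.
have [xO|/v0 ->] := pselect (Om x); last by rewrite expr0n/= mul0r mulr0.
rewrite mulrC ler_wpM2r ?sqr_ge0//.
have d1 := sep xO Om'y; have e0 := lt_le_trans delta0 d1.
rewrite lef_pV2 ?posrE ?powR_gt0//.
by apply: ge0_ler_powR; rewrite ?nnegrE ?(ltW p0) ?(ltW delta0) ?(ltW e0).
Qed.

(** The full double integral exceeds the one over the complement of [Om'] only
by the interaction of [Om] with [Om'], whose kernel is bounded because the two
sets are at a positive distance; the Poincare inequality absorbs it. *)
Lemma gagliardo_full_le v : lipschitz_in Om v ->
  (\int[leb2]_z (dens v z)%:E <= (restriction_const * G v)%:E)%E.
Proof.
move=> lv; have [mv v0 _] := lv.
have mI : measurable_fun setT (\1_Om' : rV -> R) by exact: measurable_indic.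
have mv2 : measurable_fun setT (fun x => v x ^+ 2) by exact: measurable_funX.
have I0 z : 0 <= (\1_Om' z : R) by [].
pose A (z : rV * rV) := (cd * v z.1 ^+ 2) * \1_Om' z.2.
pose B (z : rV * rV) := \1_Om' z.1 * (cd * v z.2 ^+ 2).
have cv0 x : 0 <= cd * v x ^+ 2 by rewrite mulr_ge0 ?sqr_ge0 ?(ltW cd0).
have mcv : measurable_fun setT (fun x => cd * v x ^+ 2) by exact: measurable_funM.
have A0 z : 0 <= A z by exact: mulr_ge0.
have B0 z : 0 <= B z by exact: mulr_ge0.
have mA : measurable_fun setT (EFin \o A).
  apply/measurable_EFinP; apply: measurable_funM.
    exact: measurableT_comp mcv measurable_fst.
  exact: measurableT_comp mI measurable_snd.
have mB : measurable_fun setT (EFin \o B).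
  apply/measurable_EFinP; apply: measurable_funM.
    exact: measurableT_comp mI measurable_fst.
  exact: measurableT_comp mcv measurable_snd.
pose l := fine (leb n Om').
have l0 : 0 <= l by exact: fine_ge0.
have lE : (\int[leb n]_y (\1_Om' y)%:E = l%:E)%E.
  rewrite integral_indic// setIT fineK// ge0_fin_numE//.
  exact: leb_bounded_lty.
have cvE : (\int[leb n]_x (cd * v x ^+ 2)%:E = cd%:E * sqint v)%E.
  under eq_integral do rewrite EFinM.
  rewrite ge0_integralZl_EFin//; last exact: ltW.
  - by move=> x _; rewrite lee_fin sqr_ge0.
  - exact/measurable_EFinP.
have IA : (\int[leb2]_z (A z)%:E = (cd * l)%:E * sqint v)%E.
  rewrite (@ge0_integral_tensor _ _ _ _ _ _ _ (fun x => cd * v x ^+ 2)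
    \1_Om')// lE cvE muleAC; congr (_ * _)%E.
have IB : (\int[leb2]_z (B z)%:E = (cd * l)%:E * sqint v)%E.
  rewrite (@ge0_integral_tensor _ _ _ _ _ _ _ \1_Om'
    (fun x => cd * v x ^+ 2))// lE cvE muleA; congr (_ * _)%E.
  by rewrite -EFinM mulrC.
pose Gz := (EFin \o dens v) \_ (~` Om' `*` ~` Om').
have Gz0 z : (0 <= Gz z)%E.
  by rewrite /Gz patchE; case: ifP => // _; rewrite lee_fin gagliardo_density_ge0.
have mGz : measurable_fun setT Gz.
  by apply/(measurable_restrictT _ mD); apply: measurable_funTS; exact: mdens.
apply: (@le_trans _ _ (\int[leb2]_z (Gz z + ((A z)%:E + (B z)%:E)))%E).
  apply: ge0_le_integral => //.
  - by move=> z _; rewrite lee_fin; exact: gagliardo_density_ge0.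
  - exact: mdens.
  - by apply: emeasurable_funD => //; exact: emeasurable_funD.
  move=> [x y] _; rewrite /Gz patchE; case: ifPn => [_|zD].
    by rewrite leeDl// -EFinD lee_fin addr_ge0.
  rewrite add0e -EFinD lee_fin /A /B /dens /gagliardo_density/= -expr2.
  have [Om'x|Om'x] := pselect (Om' x).
    rewrite (v0 x (Om'_disjoint Om'x)) sub0r sqrrN !indicE (mem_set Om'x)/=.
    rewrite mul1r -[leLHS]add0r lerD ?mulr_ge0 ?sqr_ge0 ?(ltW cd0)//.
    by rewrite enormB; exact: dens_near.
  have Om'y : Om' y.
    by apply: contrapT => Om'y; move/negP: zD; apply; apply/mem_set.
  rewrite (v0 y (Om'_disjoint Om'y)) subr0 !indicE (mem_set Om'y)/= mulr1.
  by rewrite -[leLHS]addr0 lerD ?mulr_ge0 ?sqr_ge0 ?(ltW cd0)//; exact: dens_near.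
rewrite ge0_integralD//; last 2 first.
- by move=> z _; rewrite -EFinD lee_fin addr_ge0.
- exact: emeasurable_funD.
rewrite -integral_mkcond -/(dens v) ge0_integralD//; last 2 first.
- by move=> z _; rewrite lee_fin.
- by move=> z _; rewrite lee_fin.
rewrite [X in (_ + (X + _))%E]IA [X in (_ + (_ + X))%E]IB.
rewrite -[X in (X + _)%E](GE lv) -ge0_muleDl ?lee_fin ?mulr_ge0 ?(ltW cd0)//.
have pv := poincare lv.
apply: (@le_trans _ _ ((G v)%:E + (cd * l + cd * l)%:E * (poincare_const * G v)%:E))%E.
  by rewrite leeD2l// lee_wpmul2l// lee_fin addr_ge0 ?mulr_ge0 ?(ltW cd0).
rewrite -EFinM -EFinD lee_fin /restriction_const -/l le_eqVlt.
by apply/orP; left; apply/eqP; ring.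
Qed.

Lemma Hs_norm_le v : lipschitz_in Om v ->
  (Hs_norm s v <= (Num.sqrt (restriction_const * G v))%:E)%E.
Proof.
move=> lv; have [mv _ _] := lv.
have d0 z : (0 <= (EFin \o dens v) z)%E.
  by rewrite lee_fin; exact: gagliardo_density_ge0.
have -> : Hs_norm s v = (((\int[leb2]_z (dens v z)%:E) `^ 2^-1)%E).
  rewrite (fubini_tonelli1 (EFin \o dens v) (mdens lv) d0) /Hs_norm.
  congr (_ `^ _)%E; apply: eq_integral => x _; rewrite /fubini_F.
  apply: eq_integral => y _ /=.
  by rewrite /dens /gagliardo_density /= real_normK ?num_real// expr2.
have rG : 0 <= restriction_const * G v.
  by rewrite mulr_ge0 ?gagliardo_ge0// ltW// restriction_const_gt0.
rewrite -powR12_sqrt// -poweR_EFin.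
have S0 : (0 <= \int[leb2]_z (dens v z)%:E)%E.
  by apply: integral_ge0 => z _; rewrite lee_fin; exact: gagliardo_density_ge0.
apply: gt0_ler_poweR => //; last exact: gagliardo_full_le.
- by rewrite in_itv/= S0 leey.
- by rewrite in_itv/= lee_fin rG leey.
Qed.

End GagliardoBounds.

(** * The coupling integral *)

Section CouplingForm.
Context {R : realType} {n : nat}.
Local Notation rV := 'rV[R]_n.
Local Notation leb2 := (leb n \x leb n)%E.
Context (Om1 Om2 : set rV) (J : rV -> R).
Hypothesis mOm1 : measurable Om1.
Hypothesis mOm2 : measurable Om2.
Hypothesis Om1oo : (leb n Om1 < +oo)%E.
Hypothesis mJ : measurable_fun setT J.
Hypothesis J0 : {ae leb n, forall z, 0 <= J z}.
Hypothesis iJ : (leb n).-integrable setT (EFin \o J).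
Implicit Types (W : rV * rV -> R) (v : rV -> R).

(** The kernel enters through its absolute value: being nonnegative almost
everywhere only, it would not give a monotone functional otherwise. *)
Definition coupling W : R :=
  \int[leb2]_(z in Om1 `*` Om2) (`|J (z.1 - z.2)| * W z).

Let D := Om1 `*` Om2.
Let mD : measurable D. Proof. exact: measurableX. Qed.

Definition kernel_mass : R := fine (\int[leb n]_z `|J z|%:E)%E.

Let massE : (\int[leb n]_z `|J z|%:E = kernel_mass%:E)%E.
Proof.
rewrite /kernel_mass fineK// ge0_fin_numE; first by have /integrableP[] := iJ.
by apply: integral_ge0 => z _; rewrite lee_fin.
Qed.

Lemma kernel_mass_ge0 : 0 <= kernel_mass.
Proof. by apply: fine_ge0; apply: integral_ge0 => z _; rewrite lee_fin. Qed.

Let mJn : measurable_fun setT (EFin \o (fun z => `|J z|)).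
Proof. by apply/measurable_EFinP; exact: measurableT_comp. Qed.

Let Jn0 (z : rV) : (0 <= (EFin \o (fun z => `|J z|)%R) z)%E.
Proof. by rewrite lee_fin. Qed.

Let massx x : (\int[leb n]_y `|J (x - y)|%:E = kernel_mass%:E)%E.
Proof. by rewrite -massE -(ge0_integral_reflect x mJn Jn0). Qed.

Let massy y : (\int[leb n]_x `|J (x - y)|%:E = kernel_mass%:E)%E.
Proof. by rewrite -massE -(ge0_integral_shift y mJn Jn0). Qed.

Lemma measurable_J_sub : measurable_fun setT (fun z : rV * rV => J (z.1 - z.2)).
Proof. exact: measurableT_comp mJ (@measurable_fun_sub2 R n). Qed.

Let mk : measurable_fun setT (fun z : rV * rV => `|J (z.1 - z.2)|).
Proof. by apply: measurableT_comp => //; exact: measurable_J_sub. Qed.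

Lemma integral_kernel_fst (g : rV -> R) : measurable_fun setT g ->
  (forall x, 0 <= g x) ->
  (\int[leb2]_z (`|J (z.1 - z.2)| * g z.1)%:E =
   kernel_mass%:E * \int[leb n]_x (g x)%:E)%E.
Proof.
move=> mg g0.
rewrite fubini_tonelli1//; last 2 first.
- apply/measurable_EFinP; apply: measurable_funM => //.
  exact: measurableT_comp mg measurable_fst.
- by move=> z; rewrite lee_fin mulr_ge0.
rewrite -ge0_integralZl_EFin//; last 3 first.
- by move=> x _; rewrite lee_fin.
- exact/measurable_EFinP.
- exact: kernel_mass_ge0.
apply: eq_integral => x _; rewrite /fubini_F/=.
under eq_integral do rewrite mulrC EFinM.
rewrite ge0_integralZl_EFin//; last first.
  exact: measurableT_comp mJn (measurable_fun_subr x).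
by rewrite massx muleC.
Qed.

Lemma integral_kernel_snd (g : rV -> R) : measurable_fun setT g ->
  (forall x, 0 <= g x) ->
  (\int[leb2]_z (`|J (z.1 - z.2)| * g z.2)%:E =
   kernel_mass%:E * \int[leb n]_x (g x)%:E)%E.
Proof.
move=> mg g0.
rewrite fubini_tonelli2//; last 2 first.
- apply/measurable_EFinP; apply: measurable_funM => //.
  exact: measurableT_comp mg measurable_snd.
- by move=> z; rewrite lee_fin mulr_ge0.
rewrite -ge0_integralZl_EFin//; last 3 first.
- by move=> x _; rewrite lee_fin.
- exact/measurable_EFinP.
- exact: kernel_mass_ge0.
apply: eq_integral => y _; rewrite /fubini_G/=.
under eq_integral do rewrite mulrC EFinM.
rewrite ge0_integralZl_EFin//; last first.
  exact: measurableT_comp mJn (measurable_fun_subl y).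
by rewrite massy muleC.
Qed.

Lemma coupling_integrable W : measurable_fun setT W ->
  (exists B : R, forall z, `|W z| <= B) ->
  leb2.-integrable D (EFin \o (fun z => `|J (z.1 - z.2)| * W z)).
Proof.
move=> mW [B WB].
have mI : measurable_fun setT (\1_Om1 : rV -> R) by exact: measurable_indic.
have mI2 : measurable_fun setT (fun z : rV * rV => (\1_Om1 z.1 : R)).
  exact: measurableT_comp mI measurable_fst.
have iK : leb2.-integrable setT
    (EFin \o (fun z => `|J (z.1 - z.2)| * \1_Om1 z.1)).
  apply/integrableP; split.
    by apply/measurable_EFinP; exact: measurable_funM.
  under eq_integral do rewrite /= ger0_norm ?mulr_ge0//.
  rewrite integral_kernel_fst// integral_indic// setIT lte_mul_pinfty//.
  by rewrite lee_fin kernel_mass_ge0.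
have iKD := integrableS measurableT mD (@subsetT _ _) iK.
apply: le_integrable (integrableZl mD B iKD) => //.
  apply/measurable_EFinP; apply: measurable_funTS.
  exact: measurable_funM.
move=> [x y] [/= Omx _]; rewrite lee_fin indicE (mem_set Omx)/= mulr1.
rewrite !normrM normr_id mulrC ler_wpM2r//.
exact: le_trans (WB (x, y)) (ler_norm _).
Qed.

(** Every slice of the exceptional set is a reflected copy of a null set. *)
Lemma ae_kernel_ge0 : {ae leb2, forall z, 0 <= J (z.1 - z.2)}.
Proof.
pose N := [set z | ~ (0 <= J z)].
have mN : measurable N.
  rewrite (_ : N = J @^-1` `]-oo, 0[%classic).
    by rewrite -[X in measurable X]setTI; apply: mJ => //; exact: measurable_itv.
  by apply/seteqP; split=> z; rewrite /N/= in_itv/= ltNge => /negP.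
have N0 : leb n N = 0%E by apply: measure_negligible.
exists [set z : rV * rV | N (z.1 - z.2)]; split=> //.
- rewrite -[X in measurable X]setTI.
  exact: (@measurable_fun_sub2 R n measurableT _ mN).
- rewrite /= /product_measure1 integral0_eq// => x _ /=.
  rewrite -N0 -(leb_reflect x mN); congr (leb n _).
  by apply/seteqP; split=> y; rewrite /xsection/= inE.
Qed.

Lemma couplingE W : measurable_fun setT W ->
  (exists B : R, forall z, `|W z| <= B) ->
  \int[leb n]_(x in Om1) \int[leb n]_(y in Om2) (J (x - y) * W (x, y)) =
  coupling W.
Proof.
move=> mW WB; have iW := coupling_integrable mW WB.
have mJW : measurable_fun setT (fun z : rV * rV => J (z.1 - z.2) * W z).
  by apply: measurable_funM => //; exact: measurable_J_sub.
rewrite (@iterated_Rintegral _ _ _ _ _ _ _ _ _ (fun z : rV * rV => J (z.1 - z.2) * W z))//.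
  congr fine; apply: ae_eq_integral => //.
  - by apply/measurable_EFinP; exact: measurable_funTS.
  - by apply/measurable_EFinP; apply: measurable_funTS; exact: measurable_funM.
  by apply: filterS ae_kernel_ge0 => z z0 _; rewrite ger0_norm.
apply: le_integrable iW => //.
  by apply/measurable_EFinP; exact: measurable_funTS.
by move=> z _ /=; rewrite lee_fin !normrM normr_id.
Qed.

Lemma couplingD a W W' : measurable_fun setT W ->
  (exists B : R, forall z, `|W z| <= B) -> measurable_fun setT W' ->
  (exists B : R, forall z, `|W' z| <= B) ->
  coupling (fun z => a * W z + W' z) = a * coupling W + coupling W'.
Proof.
move=> mW WB mW' WB'; have iW := coupling_integrable mW WB.
have iW' := coupling_integrable mW' WB'.
rewrite /coupling -RintegralZl// -RintegralD//.
  by apply: eq_Rintegral => z _; ring.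
exact: (integrableZl mD a iW).
Qed.

Lemma le_coupling W W' : measurable_fun setT W ->
  (exists B : R, forall z, `|W z| <= B) -> measurable_fun setT W' ->
  (exists B : R, forall z, `|W' z| <= B) -> (forall z, W z <= W' z) ->
  coupling W <= coupling W'.
Proof.
move=> mW WB mW' WB' WW'; have iW := coupling_integrable mW WB.
have iW' := coupling_integrable mW' WB'.
by apply: le_Rintegral => // z _; rewrite ler_wpM2l.
Qed.

Lemma coupling_ge0 W : (forall z, 0 <= W z) -> 0 <= coupling W.
Proof. by move=> W0; apply: Rintegral_ge0 => z _; rewrite mulr_ge0. Qed.

Lemma coupling_le_ext W (c : R) : measurable_fun setT W ->
  (exists B : R, forall z, `|W z| <= B) -> (forall z, 0 <= W z) ->
  (\int[leb2]_z (`|J (z.1 - z.2)| * W z)%:E <= c%:E)%E -> coupling W <= c.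
Proof.
move=> mW WB W0 h; have iW := coupling_integrable mW WB.
rewrite -lee_fin /coupling /Rintegral fineK; last exact: integrable_fin_num.
apply: le_trans h; apply: ge0_subset_integral => //.
- by apply/measurable_EFinP; exact: measurable_funM.
- by move=> z _; rewrite lee_fin mulr_ge0.
Qed.

Lemma coupling_sqr_fst v : measurable_fun setT v ->
  (exists B : R, forall x, `|v x| <= B) -> forall c : R,
  (sqint v <= c%:E)%E -> coupling (fun z => v z.1 ^+ 2) <= kernel_mass * c.
Proof.
move=> mv [B vB] c vc; have mv2 : measurable_fun setT (fun x => v x ^+ 2).
  exact: measurable_funX.
apply: coupling_le_ext.
- exact: measurableT_comp mv2 measurable_fst.
- exists (B ^+ 2) => z; rewrite normrX lerXn2r ?nnegrE//.
  exact: le_trans (vB z.1).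
- by move=> z; exact: sqr_ge0.
rewrite (integral_kernel_fst mv2); last by move=> x; exact: sqr_ge0.
by rewrite EFinM lee_wpmul2l// lee_fin kernel_mass_ge0.
Qed.

Lemma coupling_sqr_snd v : measurable_fun setT v ->
  (exists B : R, forall x, `|v x| <= B) -> forall c : R,
  (sqint v <= c%:E)%E -> coupling (fun z => v z.2 ^+ 2) <= kernel_mass * c.
Proof.
move=> mv [B vB] c vc; have mv2 : measurable_fun setT (fun x => v x ^+ 2).
  exact: measurable_funX.
apply: coupling_le_ext.
- exact: measurableT_comp mv2 measurable_snd.
- exists (B ^+ 2) => z; rewrite normrX lerXn2r ?nnegrE//.
  exact: le_trans (vB z.2).
- by move=> z; exact: sqr_ge0.
rewrite (integral_kernel_snd mv2); last by move=> x; exact: sqr_ge0.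
by rewrite EFinM lee_wpmul2l// lee_fin kernel_mass_ge0.
Qed.

End CouplingForm.

(** * Lipschitz continuity of piecewise affine functions *)

Section PiecewiseAffine.
Context {R : realType}.

(** A propagation argument: the supremum of the parameters up to which the
estimate from 0 holds satisfies it too, and is not less than 1. *)
Lemma locally_lipschitz_segment (phi : R -> R) (L : R) : 0 <= L ->
  (forall t, \forall t' \near t, `|phi t' - phi t| <= L * `|t' - t|) ->
  `|phi 1 - phi 0| <= L.
Proof.
move=> L0 loc.
pose S : set R := [set t | 0 <= t <= 1 /\ `|phi t - phi 0| <= L * t].
have S0 : S 0 by split; rewrite ?lexx ?ler01// subrr normr0 mulr0.
have S1 : ubound S 1 by move=> t [/andP[]].
have hS : has_sup S by split; [exists 0|exists 1].
pose m := sup S.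
have m0 : 0 <= m by exact: ub_le_sup hS.2 _ S0.
have m1 : m <= 1 by exact: ge_sup hS.1 _.
have /nbhs_ballP[e /= e0 he] := loc m.
have Sm : `|phi m - phi 0| <= L * m.
  have [t St mt] := sup_adherent e0 hS.
  have [/andP[t0 t1] ht] := St.
  have tm : t <= m by exact: ub_le_sup hS.2 _ St.
  have : `|phi t - phi m| <= L * `|t - m|.
    by apply: he; rewrite /ball/= ger0_norm ?subr_ge0// ltrBlDr -ltrBlDl.
  rewrite [`|t - m|]distrC (ger0_norm (_ : 0 <= m - t)) ?subr_ge0// => h.
  have -> : phi m - phi 0 = (phi t - phi 0) - (phi t - phi m) by ring.
  apply: le_trans (ler_normB _ _) _; lra.
have [m1'|m1'] := ltP m 1; last first.
  have m1E : m = 1 by apply/eqP; rewrite eq_le m1 m1'.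
  by move: Sm; rewrite m1E mulr1.
exfalso; pose t := Num.min 1 (m + e / 2).
have mt : m < t by rewrite lt_min m1' ltrDl divr_gt0.
have te : t <= m + e / 2 by rewrite ge_min lexx orbT.
have t1 : t <= 1 by rewrite ge_min lexx.
have St : S t.
  split; first by rewrite t1 andbT; lra.
  have : `|phi t - phi m| <= L * `|t - m|.
    apply: he; rewrite /ball/= distrC ger0_norm ?subr_ge0 ?(ltW mt)//; lra.
  rewrite (ger0_norm (_ : 0 <= t - m)) ?subr_ge0 ?(ltW mt)// => h.
  have -> : phi t - phi 0 = (phi t - phi m) + (phi m - phi 0) by ring.
  apply: le_trans (ler_normD _ _) _; lra.
by have := ub_le_sup hS.2 St; rewrite leNgt mt.
Qed.

Context {n : nat}.
Local Notation rV := 'rV[R]_n.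

Lemma dotrB (a x y : rV) : dotr a (x - y) = dotr a x - dotr a y.
Proof.
by rewrite /dotr -sumrB; apply: eq_bigr => i _; rewrite !mxE mulrBr.
Qed.

Lemma dotr_le (a x : rV) : `|dotr a x| <= (\sum_i `|a ord0 i|) * `|x|.
Proof.
rewrite /dotr mulr_suml; apply: le_trans (ler_norm_sum _ _ _) _.
by apply: ler_sum => i _; rewrite normrM ler_wpM2l// coord_le_normv.
Qed.

Lemma continuous_dotr (a : rV) : continuous (dotr a).
Proof.
move=> x; apply/(@cvgrPdist_le _ _ _ (nbhs x) (nbhs_filter x)) => e e0.
pose K := \sum_i `|a ord0 i| + 1.
have K0 : 0 < K by rewrite ltr_wpDl// sumr_ge0.
have eK : 0 < e / K by rewrite divr_gt0.
apply: (@filterS _ (nbhs x) (nbhs_filter x) _ _ _ (nbhsx_ballx x _ eK)).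
move=> y xyb.
rewrite -dotrB; apply: le_trans (dotr_le _ _) _.
have xy : `|x - y| < e / K by move: xyb; rewrite -ball_normE.
apply: (@le_trans _ _ (K * `|x - y|)); first by rewrite ler_wpM2r// lerDl.
by rewrite mulrC -ler_pdivlMr// ltW.
Qed.

Lemma near_all_seq (T : eqType) (l : seq T) (x : rV) (P : T -> rV -> Prop) :
  (forall c, \forall y \near x, P c y) ->
  \forall y \near x, forall c, c \in l -> P c y.
Proof.
have FF := nbhs_filter x; move=> h; elim: l => [|c l IH].
  exact: (@filterE _ (nbhs x)).
apply: (@filterS2 _ (nbhs x) FF _ _ _ _ (h c) IH) => y hc hl c'.
by rewrite inE => /predU1P[->|]; [|exact: hl].
Qed.

(** Near a given point, only the affine pieces that agree with the function at
that point are active, so the function varies there at most as fast as they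
do. *)
Lemma piecewise_affine_lipschitz (v : rV -> R) (l : seq (rV * R)) :
  continuous v ->
  (forall x, exists2 c, c \in l & v x = dotr c.1 x + c.2) ->
  exists2 L : R, 0 <= L & forall x y, `|v y - v x| <= L * `|y - x|.
Proof.
move=> cv hl.
pose L : R := \sum_(c <- l) \sum_i `|c.1 ord0 i|.
have s0 (c : rV * R) : 0 <= \sum_i `|c.1 ord0 i| by exact: sumr_ge0.
have L0 : 0 <= L by exact: sumr_ge0.
have cL c : c \in l -> \sum_i `|c.1 ord0 i| <= L.
  by move=> cl; rewrite /L (big_rem c)//= lerDl sumr_ge0.
exists L => //.
have loc x : \forall y \near x, `|v y - v x| <= L * `|y - x|.
  have : \forall y \near x, forall c, c \in l ->
      v y = dotr c.1 y + c.2 -> v x = dotr c.1 x + c.2.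
    apply: near_all_seq => c.
    have [vx|vx] := eqVneq (v x) (dotr c.1 x + c.2); first exact: (@filterE _ (nbhs x)).
    have cg : continuous (fun y => v y - (dotr c.1 y + c.2)).
      move=> y; apply: (@cvgB _ _ _ _ (nbhs_filter y)); first exact: (cv y).
      apply: (@cvgD _ _ _ _ (nbhs_filter y)); last exact: cvg_cst.
      exact: (@continuous_dotr c.1 y).
    have g0 : v x - (dotr c.1 x + c.2) != 0 by rewrite subr_eq0.
    have := @cvgr_neq0 _ _ _ (nbhs x) (nbhs_filter x) _ _ (cg x) g0.
    apply: (@filterS _ (nbhs x) (nbhs_filter x)) => y /= yn yE.
    by move: yn; rewrite yE subrr eqxx.
  apply: (@filterS _ (nbhs x) (nbhs_filter x)) => y hy; have [c cl yE] := hl y.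
  rewrite yE (hy c cl yE) opprD addrACA subrr addr0 -dotrB.
  apply: le_trans (dotr_le _ _) _.
  by rewrite ler_wpM2r// cL.
move=> x y; pose phi t := v (x + t *: (y - x)).
have -> : v y - v x = phi 1 - phi 0.
  by rewrite /phi scale1r scale0r addr0 [x + _]addrC subrK.
apply: locally_lipschitz_segment; first by rewrite mulr_ge0.
move=> t.
have cz : x + t' *: (y - x) @[t' --> t] --> x + t *: (y - x).
  by apply: cvgD; [exact: cvg_cst|apply: cvgZr_tmp].
have := cz _ (loc (x + t *: (y - x))).
apply: (@filterS _ (nbhs t) (nbhs_filter t)) => t' /= h; apply: le_trans h _.
by rewrite opprD addrACA subrr add0r -scalerBl normrZ mulrAC mulrA.
Qed.

End PiecewiseAffine.

(** * Finite element spaces *)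

Section P1Space.
Context {R : realType} {n : nat}.
Local Notation rV := 'rV[R]_n.
Context (Om : set rV) (T : seq 'M[R]_(n.+1, n)).
Hypothesis oOm : open Om.
Hypothesis TOm : closure Om = \bigcup_(P in [set` T]) simplex P.
Implicit Types v : rV -> R.

Lemma P1_continuous v : P1_space Om T v -> continuous v.
Proof.
move=> [cv _ v0]; apply/continuous_subspace_setT.
have -> : [set: rV] = closure Om `|` ~` Om.
  apply/seteqP; split=> // x _; have [Ox|Ox] := pselect (Om x).
    by left; exact: subset_closure.
  by right.
apply: withinU_continuous => //; first exact: closed_closure.
  exact: open_closedC.
apply: (@subspace_eq_continuous _ _ _ (fun=> 0)).
  by move=> x /set_mem xO; exact: esym (v0 x xO).
by apply: continuous_subspaceT; exact: cst_continuous.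
Qed.

(** The affine pieces are those of the simplices and the zero function, which is
active outside the domain. *)
Lemma P1_lipschitz v : P1_space Om T v ->
  exists2 L : R, 0 <= L & forall x y, `|v y - v x| <= L * `|y - x|.
Proof.
move=> Vv; have cv := P1_continuous Vv; have [_ aff v0] := Vv.
have /choice[c hc] : forall P : 'M[R]_(n.+1, n), exists c : rV * R,
    P \in T -> forall x, simplex P x -> v x = dotr c.1 x + c.2.
  move=> P; have [/aff[a [b ab]]|PT] := pselect (P \in T); last by exists (0, 0).
  by exists (a, b).
apply: (@piecewise_affine_lipschitz _ _ _ ((0, 0) :: map c T)) => // x.
have [Ox|/v0 vx] := pselect (Om x); last first.
  exists (0, 0); first exact: mem_head.
  by rewrite vx /dotr big1 ?addr0// => i _; rewrite mxE mul0r.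
have := subset_closure Ox; rewrite TOm => -[P /= PT Px].
by exists (c P); [rewrite inE map_f ?orbT|exact: hc].
Qed.

Lemma P1_lipschitz_in v (M : R) : (0 < n)%N -> 0 <= M ->
  (forall x, Om x -> `|x| <= M) -> P1_space Om T v -> lipschitz_in Om v.
Proof.
move=> n0 M0 OmM Vv; have [L L0 vL] := P1_lipschitz Vv; have [_ _ v0] := Vv.
pose y0 : rV := const_mx (M + 1).
have y0n : M < `|y0|.
  apply: lt_le_trans (coord_le_normv y0 (Ordinal n0)).
  by rewrite mxE ger0_norm ?ltrDl// addr_ge0.
have y0O : ~ Om y0 by move=> /OmM; rewrite leNgt y0n.
pose B := L * (M + `|y0|).
have B0 : 0 <= B by rewrite mulr_ge0// addr_ge0.
have vB x : `|v x| <= B.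
  have [Ox|/v0 ->] := pselect (Om x); last by rewrite normr0.
  have := vL y0 x; rewrite (v0 _ y0O) subr0 => h; apply: le_trans h _.
  rewrite ler_wpM2l//; apply: le_trans (ler_normB _ _) _.
  by rewrite lerD2r OmM.
split; [|exact: v0|].
  by apply: continuous_measurable_rV; exact: P1_continuous Vv.
exists ((2 * B) ^+ 2 + L ^+ 2); first by rewrite addr_ge0 ?sqr_ge0.
move=> x y; rewrite -(real_normK (num_real (v x - v y))).
have h1 : `|v x - v y| ^+ 2 <= (2 * B) ^+ 2.
  have h : `|v x - v y| <= 2 * B.
    by rewrite mulr_natl mulr2n; apply: le_trans (ler_normB _ _) (lerD _ _).
  by rewrite lerXn2r ?nnegrE// mulr_ge0.
have h2 : `|v x - v y| ^+ 2 <= L ^+ 2 * enorm (x - y) ^+ 2.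
  have h : `|v x - v y| <= L * enorm (x - y).
    apply: le_trans (vL y x) _; rewrite ler_wpM2l//; exact: normv_le_enorm.
  by rewrite -exprMn lerXn2r ?nnegrE// mulr_ge0// enorm_ge0.
have e0 := sqr_ge0 (enorm (x - y)); have b0 := sqr_ge0 (2 * B).
have l0 := sqr_ge0 L.
by case: (leP 1 (enorm (x - y) ^+ 2)) => h; nra.
Qed.

Lemma subspace_P1 : subspace (P1_space Om T : set (rV -> R^o)).
Proof.
split.
  split=> [|P _|//].
    by apply: continuous_subspaceT; exact: cst_continuous.
  exists 0, 0 => x _; rewrite /dotr big1 ?addr0// => i _.
  by rewrite mxE mul0r.
move=> a u v Vu Vv; have cu := P1_continuous Vu; have cv := P1_continuous Vv.
have [_ au u0] := Vu; have [_ av v0] := Vv; split.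
- have cuv : continuous (fun x => a * u x + v x).
    move=> x; apply: (@cvgD _ _ _ _ (nbhs_filter x)); last exact: (cv x).
    apply: (@cvgM _ _ _ (nbhs_filter x)); last exact: (cu x).
    exact: (@cst_continuous _ _ a x).
  exact: continuous_subspaceT.
- move=> P PT; have [a1 [b1 h1]] := au P PT; have [a2 [b2 h2]] := av P PT.
  exists (a *: a1 + a2), (a * b1 + b2) => x Px.
  have -> : (a *: u + v) x = a * u x + v x by [].
  rewrite h1// h2//; have -> : dotr (a *: a1 + a2) x = a * dotr a1 x + dotr a2 x.
    rewrite /dotr mulr_sumr -big_split/=; apply: eq_bigr => i _.
    by rewrite !mxE; ring.
  by ring.
- move=> x Ox; have -> : (a *: u + v) x = a * u x + v x by [].
  by rewrite u0// v0// mulr0 addr0.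
Qed.

Definition vertices : seq rV := [seq row j P | P <- T, j <- enum 'I_n.+1].

Definition vertex_value (i : nat) (v : rV -> R^o) : R := v (nth 0 vertices i).

Lemma vertex_in_simplex (P : 'M[R]_(n.+1, n)) j : simplex P (row j P).
Proof.
exists (delta_mx ord0 j); split.
- by move=> i; rewrite mxE ler0n.
- by move=> i; rewrite finset.in_setT.
- by rewrite (bigD1 j)//= !mxE !eqxx big1 ?addr0// => i ij;
    rewrite !mxE (negbTE ij) andbF.
- by rewrite -rowE.
Qed.

(** On a simplex, the value at a barycentric combination of the vertices is the
same combination of the values at the vertices. *)
Lemma vertex_value_separates v : P1_space Om T v ->
  (forall i, (i < size vertices)%N -> vertex_value i v = 0) -> v = 0.
Proof.
move=> [cv aff v0] ev; apply/funext => x.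
have [Ox|/v0->//] := pselect (Om x).
have := subset_closure Ox; rewrite TOm => -[P /= PT Px].
have [a [b ab]] := aff P PT.
have vert j : dotr a (row j P) + b = 0.
  rewrite -ab; last exact: vertex_in_simplex.
  have rV : row j P \in vertices.
    by apply/allpairsP; exists (P, j); rewrite /= mem_enum.
  have := ev (index (row j P) vertices).
  by rewrite index_mem /vertex_value nth_index//; exact.
rewrite ab//; case: Px => w [_ _ w1 ->].
transitivity (\sum_j w ord0 j * (dotr a (row j P) + b)); last first.
  by rewrite big1// => j _; rewrite vert mulr0.
under [RHS]eq_bigr do rewrite mulrDr.
rewrite big_split/= -mulr_suml w1 mul1r; congr (_ + _).
rewrite /dotr; under [RHS]eq_bigr do rewrite mulr_sumr.
rewrite exchange_big/=; apply: eq_bigr => i _.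
rewrite mxE mulr_sumr; apply: eq_bigr => j _.
by rewrite !mxE; ring.
Qed.

End P1Space.

(** * Separation of the domains and definiteness *)

Section Separation.
Context {R : realType} {n : nat}.
Local Notation rV := 'rV[R]_n.
Implicit Types A B : set rV.

Lemma bounded_set_le A : bounded_set A -> exists2 M : R, 0 <= M &
  forall x, A x -> `|x| <= M.
Proof.
move=> [M [_ hM]]; exists (Num.max 0 M + 1); first by rewrite addr_ge0// le_max lexx.
by move=> x Ax; apply: hM => //; rewrite ltr_pwDr// le_max lexx orbT.
Qed.

(** Otherwise a cluster point of points of [A] that approach [B] would lie in
both closures. *)
Lemma disjoint_closure_separated A B : bounded_set A ->
  closure A `&` closure B = set0 ->
  exists2 delta : R, 0 < delta & forall x y, A x -> B y -> delta <= enorm (x - y).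
Proof.
move=> /bounded_set_le[M M0 AM] AB.
suff [k hk] : exists k : nat, forall x y, A x -> B y -> k.+1%:R^-1 <= `|x - y|.
  exists k.+1%:R^-1; first by rewrite invr_gt0.
  by move=> x y Ax By; apply: le_trans (hk x y Ax By) (normv_le_enorm _).
apply: contrapT => hN.
have /choice[xy hxy] : forall k : nat, exists z : rV * rV,
    [/\ A z.1, B z.2 & `|z.1 - z.2| < k.+1%:R^-1].
  move=> k; apply: contrapT => nz; apply: hN; exists k => x y Ax By.
  by rewrite leNgt; apply/negP => h; apply: nz; exists (x, y).
have cK : compact (closure A).
  apply: bounded_closed_compact; last exact: closed_closure.
  exists M; split; first exact: num_real.
  move=> N MN x clx; apply: le_trans (ltW MN).
  have cl : closed [set y : rV | `|y| <= M].
    apply: (@preimage_closed _ _ (fun y : rV => `|y|) [set r | r <= M]).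
      by move=> y _; exact: norm_continuous.
    exact: closed_le.
  by have := closureS AM clx; rewrite -(closure_id _).1//; exact: cl.
have [p [clAp clp]] : closure A `&` cluster ((fun k => (xy k).1) @ \oo) !=set0.
  apply: cK; exists 0%N => // k _; apply: subset_closure.
  by have [] := hxy k.
have nBp : ~ closure B p.
  by move=> clBp; have : (closure A `&` closure B) p by []; rewrite AB.
have : exists2 e : R, 0 < e & forall y, B y -> e <= `|p - y|.
  move: nBp => /existsNP[U /not_implyP[/nbhs_ballP[e /= e0 eU] UB]].
  exists e => // y By; rewrite leNgt; apply/negP => py; apply: UB.
  by exists y; split=> //; apply: eU; rewrite -ball_normE.
move=> [e e0 he].
pose N := Num.truncn (e / 2)^-1.
have N2 k : (N <= k)%N -> k.+1%:R^-1 < e / 2.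
  move=> Nk; rewrite invf_plt ?posrE ?divr_gt0//.
  by apply: lt_le_trans (truncnS_gt _) _; rewrite ler_nat ltnS.
have [_ [[k /= Nk <-] pk]] : [set (xy k).1 | k in [set k | (N <= k)%N]] `&` ball p (e / 2) !=set0.
  apply: clp; last by apply: nbhsx_ballx; rewrite divr_gt0.
  by exists N => // k /= Nk; exists k.
have [_ Bk dk] := hxy k; have := he _ Bk; rewrite leNgt => /negP; apply.
have -> : p - (xy k).2 = (p - (xy k).1) + ((xy k).1 - (xy k).2).
  by rewrite addrA subrK.
apply: le_lt_trans (ler_normD _ _) _; rewrite [e]splitr ltrD//.
  by move: pk; rewrite -ball_normE.
exact: lt_trans dk (N2 k Nk).
Qed.

End Separation.

Section LipschitzIn.
Context {R : realType} {n : nat}.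
Local Notation rV := 'rV[R]_n.
Implicit Types (Om : set rV) (s : R).

Lemma subspace_lipschitz_in Om :
  subspace (lipschitz_in Om : set (rV -> R^o)).
Proof.
split.
  split; [exact: measurable_cst|by []|].
  by exists 0 => // x y; rewrite subrr expr0n/= mul0r.
move=> a u v [mu u0 [L L0 uL]] [mv v0 [L' L'0 vL]]; split.
- apply: measurable_funD => //; exact: measurable_funM.
- by move=> x Ox; have -> : (a *: u + v) x = a * u x + v x by [];
    rewrite u0// v0// mulr0 addr0.
exists (2 * a ^+ 2 * L + 2 * L').
  by rewrite addr_ge0 ?(mulr_ge0 _ L'0)// mulr_ge0// mulr_ge0// sqr_ge0.
move=> x y; have -> : (a *: u + v) x - (a *: u + v) y =
    a * (u x - u y) + (v x - v y).
  have ex z : (a *: u + v) z = a * u z + v z by [].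
  by rewrite !ex; ring.
set m := Num.min _ _; have hu := uL x y; have hv := vL x y.
have hu' : a ^+ 2 * (u x - u y) ^+ 2 <= a ^+ 2 * (L * m).
  by rewrite ler_wpM2l// sqr_ge0.
have := sqr_ge0 (a * (u x - u y) - (v x - v y)); rewrite -/m in hv.
by move: (u x - u y) (v x - v y) hu' hv => b c; nra.
Qed.

(** A function of the class is continuous, so that it is bounded away from 0 on
a small cube around a point where it does not vanish. *)
Lemma sqint_gt0 Om (v : rV -> R) : lipschitz_in Om v -> v <> (fun=> 0) ->
  (0 < sqint v)%E.
Proof.
move=> [mv v0 [L L0 vL]] /eqP vn0.
have [x0 vx0] : exists x0, v x0 != 0.
  apply: contrapT => h; move/eqP: vn0; apply; apply/funext => x.
  by apply/eqP/negPn/negP => vx; apply: h; exists x.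
pose a := `|v x0|; have a0 : 0 < a by rewrite normr_gt0.
pose r := a / (2 * (L + 1) * n.+1%:R).
have d0 : 0 < 2 * (L + 1) * n.+1%:R.
  by rewrite !mulr_gt0// ltr_wpDl.
have r0 : 0 < r by rewrite divr_gt0.
pose Q : set rV := (fun y => x0 - y) @^-1` cube n 0 r.
have mc : measurable (cube n (0 : R) r) by exact: measurable_cube.
have mQ : measurable Q.
  by rewrite -[X in measurable X]setTI; exact: (measurable_fun_subr x0).
have lQ : leb n Q = ((2 * r) ^+ n)%:E by rewrite leb_reflect// leb_cube// ltW.
apply: (@lt_le_trans _ _ (\int[leb n]_(z in Q) (cst ((a / 2) ^+ 2)%:E) z)%E).
  rewrite integral_cst// [X in (_ * X)%E]lQ -EFinM lte_fin.
  by rewrite mulr_gt0// exprn_gt0// ?divr_gt0// mulr_gt0.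
apply: (@le_trans _ _ (\int[leb n]_(z in Q) (v z ^+ 2)%:E)%E); last first.
  apply: ge0_subset_integral => //.
  - by apply/measurable_EFinP; exact: measurable_funX.
  - by move=> z _; rewrite lee_fin sqr_ge0.
apply: ge0_le_integral => //.
- by move=> z _; rewrite lee_fin sqr_ge0.
- apply/measurable_EFinP; apply: measurable_funTS; exact: measurable_funX.
move=> y Qy; rewrite lee_fin.
have hy : enorm (x0 - y) <= n.+1%:R * r.
  apply: le_trans (enorm_le_normv _) _; rewrite ler_wpM2l//.
  rewrite normvE; apply/bigmax_leP; split; first exact: ltW.
  move=> [i j] _ /=; rewrite (ord1 i) ler_norml.
  by have /andP[h1 h2] := Qy j; apply/andP; split; lra.
have hv : (v x0 - v y) ^+ 2 <= (a / 2) ^+ 2.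
  apply: le_trans (vL x0 y) _.
  apply: (@le_trans _ _ (L * enorm (x0 - y) ^+ 2)).
    by rewrite ler_wpM2l// ge_min lexx orbT.
  have -> : a / 2 = (L + 1) * (n.+1%:R * r).
    by rewrite /r; field; rewrite !gt_eqF//; lra.
  rewrite exprMn; apply: ler_pM => //; rewrite ?sqr_ge0//.
    by have := sqr_ge0 L; have := L0; rewrite sqrrD; nra.
  by rewrite lerXn2r ?nnegrE ?enorm_ge0// mulr_ge0// ltW.
have hv' : `|v x0 - v y| <= a / 2.
  have a2 : 0 <= a / 2 by rewrite divr_ge0// ltW.
  rewrite leNgt; apply/negP => h; move: hv; rewrite leNgt => /negP; apply.
  rewrite -(real_normK (num_real (v x0 - v y))).
  by rewrite ltrXn2r// ?nnegrE// (le_trans a2)// ltW.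
have : a / 2 <= `|v y|.
  have := lerB_normD (v x0) (v y - v x0); rewrite [v x0 + _]addrC subrK [X in _ - X]distrC -/a; lra.
move=> h; rewrite -(real_normK (num_real (v y))) lerXn2r// nnegrE.
by rewrite divr_ge0// ltW.
Qed.

End LipschitzIn.

(** * Energy and load on one domain *)

Section FractionalForm.
Context {R : realType} {n : nat} (s : R).
Hypothesis n0 : (0 < n)%N.
Hypothesis s01 : 0 < s < 1.
Local Notation rV := 'rV[R]_n.
Context (Om Om' : set rV) (M delta : R).
Hypothesis mOm : measurable Om.
Hypothesis mOm' : measurable Om'.
Hypothesis M0 : 0 <= M.
Hypothesis OmM : forall x, Om x -> `|x| <= M.
Hypothesis Om'M : forall x, Om' x -> `|x| <= M.
Hypothesis delta0 : 0 < delta.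
Hypothesis sep : forall x y, Om x -> Om' y -> delta <= enorm (x - y).

Let lip : set (rV -> R^o) := lipschitz_in Om.

Definition fraclap_form (u v : rV -> R^o) : R :=
  fraclap_const n s / 2 * gagliardo s (~` Om') u v.

Let alpha0 : 0 < fraclap_const n s / 2.
Proof. by rewrite divr_gt0// fraclap_const_gt0. Qed.

Let Omoo : (leb n Om < +oo)%E.
Proof. exact: (leb_bounded_lty M0). Qed.

Lemma linear_fraclap_form w : lip w -> linear_on lip (fraclap_form w).
Proof.
move=> lw a u v lu lv; rewrite /fraclap_form.
have mC : measurable (~` Om') by exact: measurableC.
have mD : measurable (~` Om' `*` ~` Om') by exact: measurableX.
have luv : lip (a *: u + v) by apply: (subspace_lipschitz_in Om).2.
rewrite !(gagliardoE s01 mOm Omoo)//.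
have iu := integrableS measurableT mD (@subsetT _ _)
  (gagliardo_density2_integrable s01 mOm Omoo lw lu).
have iv := integrableS measurableT mD (@subsetT _ _)
  (gagliardo_density2_integrable s01 mOm Omoo lw lv).
rewrite mulrCA -mulrDr; congr (_ * _).
rewrite -RintegralZl// -RintegralD//; last exact: (integrableZl mD a iu).
apply: eq_Rintegral => z _; rewrite /gagliardo_density.
have ex x : (a *: u + v) x = a * u x + v x by [].
by rewrite !ex; ring.
Qed.

Lemma fraclap_formC u v : fraclap_form u v = fraclap_form v u.
Proof.
rewrite /fraclap_form /gagliardo; congr (_ * _).
apply: eq_Rintegral => x _.
by apply: eq_Rintegral => y _; rewrite [X in X / _]mulrC.
Qed.

Lemma fraclap_form_ge0 v : 0 <= fraclap_form v v.
Proof. by rewrite mulr_ge0 ?(ltW alpha0)//; exact: gagliardo_ge0. Qed.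

Definition energy_poincare_const : R :=
  @poincare_const R n s M / (fraclap_const n s / 2).

Lemma energy_poincare_const_gt0 : 0 < energy_poincare_const.
Proof. by rewrite divr_gt0// poincare_const_gt0. Qed.

Lemma energy_poincare v : lip v ->
  (sqint v <= (energy_poincare_const * fraclap_form v v)%:E)%E.
Proof.
move=> lv; rewrite /energy_poincare_const /fraclap_form mulrA divfK ?gt_eqF//.
exact: (poincare n0 s01 mOm mOm' M0 OmM Om'M delta0 sep lv).
Qed.

Lemma fraclap_form_gt0 v : lip v -> v != 0 -> 0 < fraclap_form v v.
Proof.
move=> lv /eqP vn0; rewrite -(pmulr_rgt0 _ energy_poincare_const_gt0) -lte_fin.
by apply: lt_le_trans (energy_poincare lv); exact: (sqint_gt0 lv).
Qed.

Definition energy_norm_const : R :=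
  @restriction_const R n s Om' M delta / (fraclap_const n s / 2).

Lemma energy_norm_const_gt0 : 0 < energy_norm_const.
Proof.
rewrite divr_gt0//; exact: restriction_const_gt0.
Qed.

Lemma Hs_norm_le_energy v : lip v ->
  (Hs_norm s v <= (Num.sqrt (energy_norm_const * fraclap_form v v))%:E)%E.
Proof.
move=> lv; rewrite /energy_norm_const /fraclap_form mulrA divfK ?gt_eqF//.
exact: (Hs_norm_le n0 s01 mOm mOm' M0 OmM Om'M delta0 sep lv).
Qed.

Context (f : rV -> R).
Hypothesis sqf : square_integrable Om f.

Definition load (v : rV -> R^o) : R := \int[leb n]_(x in Om) (f x * v x).

Let f2 : R := \int[leb n]_(x in Om) (f x ^+ 2).

Let mf : measurable_fun Om f. Proof. by case: sqf. Qed.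
Let if2 : (leb n).-integrable Om (EFin \o (fun x => f x ^+ 2)).
Proof. by case: sqf. Qed.

Let iv2 v : lip v -> (leb n).-integrable setT (EFin \o (fun x => v x ^+ 2)).
Proof.
move=> lv; have [mv _ _] := lv; apply/integrableP; split.
  by apply/measurable_EFinP; exact: measurable_funX.
under eq_integral do rewrite /= ger0_norm ?sqr_ge0//.
by apply: le_lt_trans (energy_poincare lv) _; exact: ltry.
Qed.

Let iv2D v : lip v -> (leb n).-integrable Om (EFin \o (fun x => v x ^+ 2)).
Proof. by move=> lv; apply: integrableS (iv2 lv). Qed.

Let ifv v : lip v -> (leb n).-integrable Om (EFin \o (fun x => f x * v x)).
Proof.
move=> lv; have [mv _ _] := lv.
apply: le_integrable (integrableD mOm if2 (iv2D lv)) => //.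
  apply/measurable_EFinP; apply: measurable_funM => //.
  exact: measurable_funTS.
move=> x _ /=; rewrite lee_fin [leRHS]ger0_norm ?addr_ge0 ?sqr_ge0//.
rewrite normrM -(real_normK (num_real (f x))) -(real_normK (num_real (v x))).
by have := sqr_ge0 (`|f x| - `|v x|); have := sqr_ge0 (`|f x| + `|v x|); nra.
Qed.

Lemma linear_load : linear_on lip load.
Proof.
move=> a u v lu lv; rewrite /load.
have iu := ifv lu; have iv := ifv lv.
rewrite -RintegralZl// -RintegralD//; last exact: (integrableZl mOm a iu).
apply: eq_Rintegral => z _.
have -> : (a *: u + v) z = a * u z + v z by [].
by ring.
Qed.

(** Young's inequality; the parameter [e] is left free so that the energy of the
half step can absorb the last term. *)
Lemma load_le v (e : R) : 0 < e -> lip v ->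
  2 * load v <= e^-1 * f2 + e * (energy_poincare_const * fraclap_form v v).
Proof.
move=> e0 lv; have iv := iv2D lv; have i2 := ifv lv.
have h : \int[leb n]_(x in Om) (v x ^+ 2) <=
    energy_poincare_const * fraclap_form v v.
  rewrite -lee_fin /Rintegral fineK; last exact: integrable_fin_num.
  apply: le_trans (energy_poincare lv); have [mv _ _] := lv.
  apply: ge0_subset_integral => //.
  - by apply/measurable_EFinP; exact: measurable_funX.
  - by move=> x _; rewrite lee_fin sqr_ge0.
apply: (@le_trans _ _ (e^-1 * f2 + e * \int[leb n]_(x in Om) (v x ^+ 2))); last first.
  by rewrite lerD2l ler_wpM2l// ltW.
rewrite /load /f2 -!RintegralZl// -RintegralD//; last 2 first.
- exact: (integrableZl mOm e^-1 if2).
- exact: (integrableZl mOm e iv).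
apply: le_Rintegral => //.
- exact: (integrableZl mOm 2 i2).
- exact: (integrableD mOm (integrableZl mOm e^-1 if2) (integrableZl mOm e iv)).
move=> x _; have ei : e * e^-1 = 1 by rewrite divff// gt_eqF.
have : 0 <= e^-1 * (f x - e * v x) ^+ 2.
  by rewrite mulr_ge0 ?sqr_ge0// invr_ge0 ltW.
have -> : e^-1 * (f x - e * v x) ^+ 2 = e^-1 * f x ^+ 2 + (e * e^-1) * e * v x ^+ 2
  - 2 * (e * e^-1) * f x * v x by ring.
by rewrite ei; lra.
Qed.

End FractionalForm.

(** * The two half steps and their coupling *)

Section TwoDomains.
Context {R : realType} {n : nat} (s1 s2 : R).
Hypothesis n0 : (0 < n)%N.
Hypothesis s101 : 0 < s1 < 1.
Hypothesis s201 : 0 < s2 < 1.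
Local Notation rV := 'rV[R]_n.
Context (Om1 Om2 : set rV) (M delta : R) (J f1 f2 : rV -> R).
Hypothesis mOm1 : measurable Om1.
Hypothesis mOm2 : measurable Om2.
Hypothesis M0 : 0 <= M.
Hypothesis Om1M : forall x, Om1 x -> `|x| <= M.
Hypothesis Om2M : forall x, Om2 x -> `|x| <= M.
Hypothesis delta0 : 0 < delta.
Hypothesis sep : forall x y, Om1 x -> Om2 y -> delta <= enorm (x - y).
Hypothesis mJ : measurable_fun setT J.
Hypothesis J0 : {ae leb n, forall z, 0 <= J z}.
Hypothesis iJ : (leb n).-integrable setT (EFin \o J).
Hypothesis sqf1 : square_integrable Om1 f1.
Hypothesis sqf2 : square_integrable Om2 f2.

Let sep' x y : Om2 x -> Om1 y -> delta <= enorm (x - y).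
Proof. by move=> xO yO; rewrite enormB; exact: sep. Qed.

Let Om1oo : (leb n Om1 < +oo)%E. Proof. exact: (leb_bounded_lty M0). Qed.

Let lip1 : set (rV -> R^o) := lipschitz_in Om1.
Let lip2 : set (rV -> R^o) := lipschitz_in Om2.
Let cpl : (rV * rV -> R) -> R := coupling Om1 Om2 J.

Definition exchange_form (u v : rV -> R^o) : R := cpl (fun z => u z.1 * v z.2).

Definition step_form1 (u v : rV -> R^o) : R :=
  @fraclap_form R n s1 Om2 u v + cpl (fun z => u z.1 * v z.1).

Definition step_form2 (u v : rV -> R^o) : R :=
  @fraclap_form R n s2 Om1 u v + cpl (fun z => u z.2 * v z.2).

Let bounded_meas (W : rV * rV -> R) : Prop :=
  measurable_fun setT W /\ exists B : R, forall z, `|W z| <= B.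

Let bounded_measM W W' : bounded_meas W -> bounded_meas W' ->
  bounded_meas (fun z => W z * W' z).
Proof.
move=> [mW [B WB]] [mW' [B' WB']]; split; first exact: measurable_funM.
by exists (B * B') => z; rewrite normrM ler_pM.
Qed.

Let bm11 u : lip1 u -> bounded_meas (fun z => u z.1).
Proof.
move=> lu; have [mu _ _] := lu; split; first exact: measurableT_comp mu measurable_fst.
by have [B _ uB] := lipschitz_in_bounded n0 M0 Om1M Om2M lu; exists B => z.
Qed.

Let bm22 v : lip2 v -> bounded_meas (fun z => v z.2).
Proof.
move=> lu; have [mu _ _] := lu; split; first exact: measurableT_comp mu measurable_snd.
by have [B _ uB] := lipschitz_in_bounded n0 M0 Om2M Om1M lu; exists B => z.
Qed.

Let cplD a W W' : bounded_meas W -> bounded_meas W' ->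
  cpl (fun z => a * W z + W' z) = a * cpl W + cpl W'.
Proof. by move=> [mW WB] [mW' WB']; exact: couplingD. Qed.

Lemma linear_exchange_form_l w : lip2 w -> linear_on lip1 (exchange_form^~ w).
Proof.
move=> lw a u v lu lv; rewrite /exchange_form -cplD; last 2 first.
- exact: bounded_measM (bm11 lu) (bm22 lw).
- exact: bounded_measM (bm11 lv) (bm22 lw).
congr cpl; apply/funext => z.
by have -> : (a *: u + v) z.1 = a * u z.1 + v z.1 by []; ring.
Qed.

Lemma linear_exchange_form_r v : lip1 v -> linear_on lip2 (exchange_form v).
Proof.
move=> lv a u w lu lw; rewrite /exchange_form -cplD; last 2 first.
- exact: bounded_measM (bm11 lv) (bm22 lu).
- exact: bounded_measM (bm11 lv) (bm22 lw).
congr cpl; apply/funext => z.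
by have -> : (a *: u + w) z.2 = a * u z.2 + w z.2 by []; ring.
Qed.

Lemma scalar_product_step_form1 : scalar_product_on lip1 step_form1.
Proof.
split.
- move=> w lw a u v lu lv; rewrite /step_form1.
  rewrite (linear_fraclap_form s101 mOm1 mOm2 M0 Om1M lw a lu lv).
  have -> : cpl (fun z => w z.1 * (a *: u + v) z.1) =
      a * cpl (fun z => w z.1 * u z.1) + cpl (fun z => w z.1 * v z.1).
    rewrite -cplD; last 2 first.
    - exact: bounded_measM (bm11 lw) (bm11 lu).
    - exact: bounded_measM (bm11 lw) (bm11 lv).
    congr cpl; apply/funext => z.
    by have -> : (a *: u + v) z.1 = a * u z.1 + v z.1 by []; ring.
  by rewrite mulrDr addrACA.
- move=> u v lu lv; rewrite /step_form1 fraclap_formC; congr (_ + cpl _).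
  by apply/funext => z; rewrite mulrC.
- move=> u lu u0; rewrite /step_form1 ltr_wpDr//.
    by apply: coupling_ge0 => z; rewrite -expr2 sqr_ge0.
  exact: (fraclap_form_gt0 n0 s101 mOm1 mOm2 M0 Om1M Om2M delta0 sep lu u0).
Qed.

Lemma scalar_product_step_form2 : scalar_product_on lip2 step_form2.
Proof.
split.
- move=> w lw a u v lu lv; rewrite /step_form2.
  rewrite (linear_fraclap_form s201 mOm2 mOm1 M0 Om2M lw a lu lv).
  have -> : cpl (fun z => w z.2 * (a *: u + v) z.2) =
      a * cpl (fun z => w z.2 * u z.2) + cpl (fun z => w z.2 * v z.2).
    rewrite -cplD; last 2 first.
    - exact: bounded_measM (bm22 lw) (bm22 lu).
    - exact: bounded_measM (bm22 lw) (bm22 lv).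
    congr cpl; apply/funext => z.
    by have -> : (a *: u + v) z.2 = a * u z.2 + v z.2 by []; ring.
  by rewrite mulrDr addrACA.
- move=> u v lu lv; rewrite /step_form2 fraclap_formC; congr (_ + cpl _).
  by apply/funext => z; rewrite mulrC.
- move=> u lu u0; rewrite /step_form2 ltr_wpDr//.
    by apply: coupling_ge0 => z; rewrite -expr2 sqr_ge0.
  exact: (fraclap_form_gt0 n0 s201 mOm2 mOm1 M0 Om2M Om1M delta0 sep' lu u0).
Qed.

Let cP1 : R := @energy_poincare_const R n s1 M.
Let cP2 : R := @energy_poincare_const R n s2 M.
Let cP10 : 0 < cP1. Proof. exact: energy_poincare_const_gt0. Qed.
Let cP20 : 0 < cP2. Proof. exact: energy_poincare_const_gt0. Qed.
Let NJ : R := @kernel_mass R n J.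
Let NJ0 : 0 <= NJ. Proof. exact: kernel_mass_ge0. Qed.

(** By the Poincare inequality this bounds the ratio between the coupling part
and the fractional part of either energy, for all finite element spaces
at once. *)
Let coupling_ratio : R := NJ * cP1 + NJ * cP2 + 1.
Let ratio0 : 0 < coupling_ratio.
Proof.
have h1 := mulr_ge0 NJ0 (ltW cP10); have h2 := mulr_ge0 NJ0 (ltW cP20).
exact: ltr_wpDl (addr_ge0 h1 h2) ltr01.
Qed.

Definition coupling_share : R := coupling_ratio / (1 + coupling_ratio).
Let q := coupling_share.

Lemma coupling_share01 : 0 < q < 1.
Proof.
rewrite /q /coupling_share; move: coupling_ratio ratio0 => r r0.
by rewrite divr_gt0 ?addr_gt0//= ltr_pdivrMr ?addr_gt0//; lra.
Qed.

Let share_le (j a : R) : 0 <= a -> j <= coupling_ratio * a -> j <= q * (a + j).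
Proof.
rewrite /q /coupling_share; move: coupling_ratio ratio0 => r r0 a0 ja.
by rewrite mulrAC ler_pdivlMr ?addr_gt0//; lra.
Qed.

Lemma coupling_share1 v : lip1 v ->
  cpl (fun z => v z.1 ^+ 2) <= q * step_form1 v v.
Proof.
move=> lv; have [mv _ _] := lv.
have [B _ vB] := lipschitz_in_bounded n0 M0 Om1M Om2M lv.
have ep := energy_poincare n0 s101 mOm1 mOm2 M0 Om1M Om2M delta0 sep lv.
have := coupling_sqr_fst mOm1 mOm2 Om1oo mJ iJ mv (ex_intro _ B vB) ep.
rewrite -/cpl -/NJ -/cP1 => h.
have a0 : 0 <= @fraclap_form R n s1 Om2 v v by exact: fraclap_form_ge0.
apply: share_le => //; apply: le_trans h _; rewrite mulrA ler_wpM2r//.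
rewrite /coupling_ratio; move: (mulr_ge0 NJ0 (ltW cP20)).
by move: (NJ * cP1) (NJ * cP2) => a b; lra.
Qed.

Lemma coupling_share2 v : lip2 v ->
  cpl (fun z => v z.2 ^+ 2) <= q * step_form2 v v.
Proof.
move=> lv; have [mv _ _] := lv.
have [B _ vB] := lipschitz_in_bounded n0 M0 Om2M Om1M lv.
have ep := energy_poincare n0 s201 mOm2 mOm1 M0 Om2M Om1M delta0 sep' lv.
have := coupling_sqr_snd mOm1 mOm2 Om1oo mJ iJ mv (ex_intro _ B vB) ep.
rewrite -/cpl -/NJ -/cP2 => h.
have a0 : 0 <= @fraclap_form R n s2 Om1 v v by exact: fraclap_form_ge0.
apply: share_le => //; apply: le_trans h _; rewrite mulrA ler_wpM2r//.
rewrite /coupling_ratio; move: (mulr_ge0 NJ0 (ltW cP10)).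
by move: (NJ * cP1) (NJ * cP2) => a b; lra.
Qed.

(** The mixed term is estimated by the two coupling parts ([2ab <= a^2 + b^2]
under the integral), each of which is a fixed share of its energy. *)
Lemma exchange_form_le u v : lip1 u -> lip2 v ->
  2 * exchange_form u v <= q * (step_form1 u u + step_form2 v v).
Proof.
move=> lu lv; have bu := bm11 lu; have bv := bm22 lv.
have buu := bounded_measM bu bu; have bvv := bounded_measM bv bv.
have buv := bounded_measM bu bv.
have bz : bounded_meas (fun=> 0).
  by split=> //; exists 0 => z; rewrite normr0.
have h : cpl (fun z => 2 * (u z.1 * v z.2) + 0) <=
    cpl (fun z => 1 * (u z.1 * u z.1) + v z.2 * v z.2).
  have bl : bounded_meas (fun z => 2 * (u z.1 * v z.2) + 0).
    have [mW [B WB]] := buv; split.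
      by apply: measurable_funD => //; exact: measurable_funM.
    by exists (2 * B) => z; rewrite addr0 normrM ger0_norm// ler_wpM2l.
  have br : bounded_meas (fun z => 1 * (u z.1 * u z.1) + v z.2 * v z.2).
    have [mW [B WB]] := buu; have [mW' [B' WB']] := bvv; split.
      by apply: measurable_funD => //; exact: measurable_funM.
    by exists (B + B') => z; rewrite mul1r; apply: le_trans (ler_normD _ _) (lerD _ _).
  have [? ?] := bl; have [? ?] := br.
  apply: le_coupling => // z; have := sqr_ge0 (u z.1 - v z.2); nra.
move: h; rewrite !cplD//.
have -> : cpl (fun=> 0) = 0.
  by rewrite /cpl /coupling /Rintegral integral0_eq// => z _; rewrite mulr0.
rewrite addr0 mul1r => h; apply: le_trans h _; rewrite mulrDr; apply: lerD.
  apply: le_trans (coupling_share1 lu); rewrite le_eqVlt; apply/orP; left.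
  by apply/eqP; congr cpl; apply/funext => z; rewrite expr2.
apply: le_trans (coupling_share2 lv); rewrite le_eqVlt; apply/orP; left.
by apply/eqP; congr cpl; apply/funext => z; rewrite expr2.
Qed.

Let load1 : (rV -> R^o) -> R := load Om1 f1.
Let load2 : (rV -> R^o) -> R := load Om2 f2.

Lemma linear_load1 : linear_on lip1 load1.
Proof. exact: (linear_load n0 s101 mOm1 mOm2 M0 Om1M Om2M delta0 sep sqf1). Qed.

Lemma linear_load2 : linear_on lip2 load2.
Proof. exact: (linear_load n0 s201 mOm2 mOm1 M0 Om2M Om1M delta0 sep' sqf2). Qed.

Let e1 : R := (1 - q) / cP1.
Let e2 : R := (1 - q) / cP2.

Definition load_const : R :=
  e1^-1 * (\int[leb n]_(x in Om1) (f1 x ^+ 2)) +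
  e2^-1 * (\int[leb n]_(x in Om2) (f2 x ^+ 2)).

Let q1 : 0 < 1 - q.
Proof. by have /andP[_ h] := coupling_share01; rewrite subr_gt0. Qed.

Let int_sqr_ge0 (A : set rV) (g : rV -> R) : 0 <= \int[leb n]_(x in A) (g x ^+ 2).
Proof. by apply: Rintegral_ge0 => x _; exact: sqr_ge0. Qed.

Lemma load1_le v : lip1 v -> 2 * load1 v <= load_const + (1 - q) * step_form1 v v.
Proof.
move=> lv; have e10 : 0 < e1 := divr_gt0 q1 cP10.
have := load_le n0 s101 mOm1 mOm2 M0 Om1M Om2M delta0 sep sqf1 e10 lv.
move/le_trans; apply; apply: lerD.
  rewrite lerDl; apply: mulr_ge0; last exact: int_sqr_ge0.
  by rewrite invr_ge0; exact: ltW (divr_gt0 q1 cP20).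
rewrite mulrA divfK ?gt_eqF// (ler_wpM2l (ltW q1))// lerDl.
by apply: coupling_ge0 => z; rewrite -expr2 sqr_ge0.
Qed.

Lemma load2_le v : lip2 v -> 2 * load2 v <= load_const + (1 - q) * step_form2 v v.
Proof.
move=> lv; have e20 : 0 < e2 := divr_gt0 q1 cP20.
have := load_le n0 s201 mOm2 mOm1 M0 Om2M Om1M delta0 sep' sqf2 e20 lv.
move/le_trans; apply; apply: lerD.
  rewrite lerDr; apply: mulr_ge0; last exact: int_sqr_ge0.
  by rewrite invr_ge0; exact: ltW (divr_gt0 q1 cP10).
rewrite mulrA divfK ?gt_eqF// (ler_wpM2l (ltW q1))// lerDl.
by apply: coupling_ge0 => z; rewrite -expr2 sqr_ge0.
Qed.

Section equations.
Context (V1 V2 : set (rV -> R^o)).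
Hypothesis V1lip : V1 `<=` lip1.
Hypothesis V2lip : V2 `<=` lip2.

(** The part of the coupling term that contains the unknown belongs to the
energy of the half step; the part with the other component is moved to the
right. *)
Lemma equation1P u1 u2 : V1 u1 -> V2 u2 ->
  equation1 s1 Om1 Om2 J f1 V1 u1 u2 <->
    solves1 V1 step_form1 exchange_form load1 u1 u2.
Proof.
move=> /V1lip l1 /V2lip l2.
suff key v1 : V1 v1 ->
  fraclap_const n s1 / 2 * gagliardo s1 (~` Om2) u1 v1 +
    \int[leb n]_(x in Om1) \int[leb n]_(y in Om2)
      (J (x - y) * (u1 x - u2 y) * v1 x) = step_form1 u1 v1 - exchange_form v1 u2.
  split=> h v Vv; have := h v Vv.
    by rewrite key// => /eqP; rewrite subr_eq => /eqP.
  by rewrite key// => ->; rewrite addrK.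
move=> /V1lip lv; rewrite /step_form1 -addrA; congr (_ + _).
have b1 := bounded_measM (bm11 l1) (bm11 lv).
have b2 := bounded_measM (bm11 lv) (bm22 l2).
have bB : bounded_meas (fun z => (-1) * (v1 z.1 * u2 z.2) + u1 z.1 * v1 z.1).
  have [mW [B WB]] := b2; have [mW' [B' WB']] := b1; split.
    by apply: measurable_funD => //; exact: measurable_funM.
  exists (B + B') => z; rewrite mulN1r.
  by apply: le_trans (ler_normD _ _) (lerD _ _) => //; rewrite normrN.
have [mB BB] := bB.
rewrite /exchange_form addrC -mulN1r -cplD// /cpl -(couplingE mOm1 mOm2 Om1oo mJ J0 iJ mB BB).
apply: eq_Rintegral => x _; apply: eq_Rintegral => y _ /=.
by ring.
Qed.

Lemma equation2P u1 u2 : V1 u1 -> V2 u2 ->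
  equation2 s2 Om1 Om2 J f2 V2 u1 u2 <->
    solves2 V2 step_form2 exchange_form load2 u1 u2.
Proof.
move=> /V1lip l1 /V2lip l2.
suff key v2 : V2 v2 ->
  fraclap_const n s2 / 2 * gagliardo s2 (~` Om1) u2 v2 +
    \int[leb n]_(x in Om1) \int[leb n]_(y in Om2)
      (J (x - y) * (u2 y - u1 x) * v2 y) = step_form2 u2 v2 - exchange_form u1 v2.
  split=> h v Vv; have := h v Vv.
    by rewrite key// => /eqP; rewrite subr_eq => /eqP.
  by rewrite key// => ->; rewrite addrK.
move=> /V2lip lv; rewrite /step_form2 -addrA; congr (_ + _).
have b1 := bounded_measM (bm22 l2) (bm22 lv).
have b2 := bounded_measM (bm11 l1) (bm22 lv).
have bB : bounded_meas (fun z => (-1) * (u1 z.1 * v2 z.2) + u2 z.2 * v2 z.2).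
  have [mW [B WB]] := b2; have [mW' [B' WB']] := b1; split.
    by apply: measurable_funD => //; exact: measurable_funM.
  exists (B + B') => z; rewrite mulN1r.
  by apply: le_trans (ler_normD _ _) (lerD _ _) => //; rewrite normrN.
have [mB BB] := bB.
rewrite /exchange_form addrC -mulN1r -cplD// /cpl -(couplingE mOm1 mOm2 Om1oo mJ J0 iJ mB BB).
apply: eq_Rintegral => x _; apply: eq_Rintegral => y _ /=.
by ring.
Qed.

End equations.

Lemma Hs_norm_le_step_form1 v : lip1 v -> (Hs_norm s1 v <=
  (Num.sqrt (@energy_norm_const R n s1 Om2 M delta * step_form1 v v))%:E)%E.
Proof.
move=> lv.
apply: le_trans (Hs_norm_le_energy n0 s101 mOm1 mOm2 M0 Om1M Om2M delta0 sep lv) _.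
have c0 := @energy_norm_const_gt0 R n s1 n0 s101 Om2 M delta M0 delta0.
rewrite lee_fin ler_wsqrtr// ler_wpM2l ?(ltW c0)// lerDl.
by apply: coupling_ge0 => z; rewrite -expr2 sqr_ge0.
Qed.

Lemma Hs_norm_le_step_form2 v : lip2 v -> (Hs_norm s2 v <=
  (Num.sqrt (@energy_norm_const R n s2 Om1 M delta * step_form2 v v))%:E)%E.
Proof.
move=> lv.
apply: le_trans (Hs_norm_le_energy n0 s201 mOm2 mOm1 M0 Om2M Om1M delta0 sep' lv) _.
have c0 := @energy_norm_const_gt0 R n s2 n0 s201 Om1 M delta M0 delta0.
rewrite lee_fin ler_wsqrtr// ler_wpM2l ?(ltW c0)// lerDl.
by apply: coupling_ge0 => z; rewrite -expr2 sqr_ge0.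
Qed.

End TwoDomains.

(** * Convergence of the alternating scheme *)

Section AlternatingSequence.
Context {E1 E2 : Type} (V1 : set E1) (V2 : set E2) (S1 S2 : E1 -> E2 -> Prop).

Definition alternating_sequence (u : nat -> E1 * E2) : Prop := forall i,
  [/\ V1 (u i.*2.+1).1 /\ S1 (u i.*2.+1).1 (u i.*2).2,
      (u i.*2.+1).2 = (u i.*2).2,
      V2 (u i.*2.+2).2 /\ S2 (u i.*2.+1).1 (u i.*2.+2).2 &
      (u i.*2.+2).1 = (u i.*2.+1).1].

Lemma alternating_sequence_exists x0 y0 :
  (forall y, V2 y -> exists2 x, V1 x & S1 x y) ->
  (forall x, V1 x -> exists2 y, V2 y & S2 x y) -> V2 y0 ->
  exists2 u, u 0%N = (x0, y0) & alternating_sequence u.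
Proof.
move=> ex1 ex2 Vy0.
have /choice[X hX] : forall y, exists x, V2 y -> V1 x /\ S1 x y.
  move=> y; have [/ex1[x Vx Sx]|nV] := pselect (V2 y); first by exists x.
  by exists x0.
have /choice[Y hY] : forall x, exists y, V1 x -> V2 y /\ S2 x y.
  move=> x; have [/ex2[y Vy Sy]|nV] := pselect (V1 x); first by exists y.
  by exists y0.
pose w (k : nat) : E1 * E2 := iter k (fun p => (X p.2, Y (X p.2))) (x0, y0).
have Vw k : V2 (w k).2.
  by elim: k => [//|k IH] /=; have [+ _] := hX _ IH; move=> /hY[].
(* w lists the even iterates; an odd one differs by a first half step *)
pose u k := if odd k then (X (w k./2).2, (w k./2).2) else w k./2.
exists u => // i; rewrite /u /= !odd_double !doubleK uphalf_double.
have [VX SX] := hX _ (Vw i); have [VY SY] := hY _ VX.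
by split.
Qed.

Lemma alternating_sequence_unique (u u' : nat -> E1 * E2) :
  (forall x x' y, V1 x -> V1 x' -> V2 y -> S1 x y -> S1 x' y -> x = x') ->
  (forall x y y', V1 x -> V2 y -> V2 y' -> S2 x y -> S2 x y' -> y = y') ->
  u 0%N = u' 0%N -> V2 (u 0%N).2 ->
  alternating_sequence u -> alternating_sequence u' -> u = u'.
Proof.
move=> un1 un2 u0 V0 au au'.
have key i : u i.*2 = u' i.*2 /\ V2 (u i.*2).2.
  elim: i => [//|i [IH VIH]].
  have [[V1u S1u] _ [V2u S2u] eu] := au i.
  have [[V1u' S1u'] _ [V2u' S2u'] eu'] := au' i.
  rewrite -IH in S1u'.
  have ex := un1 _ _ _ V1u V1u' VIH S1u S1u'; rewrite -ex in S2u' eu'.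
  have ey := un2 _ _ _ V1u V2u V2u' S2u S2u'.
  rewrite doubleS; split=> //.
  by rewrite [LHS]surjective_pairing [RHS]surjective_pairing eu eu' ey.
apply/funext => k; have [ko|ke] := boolP (odd k); last first.
  by rewrite -[k]odd_double_half (negbTE ke); have [] := key k./2.
rewrite -[k]odd_double_half ko add1n.
have [ek Vk] := key k./2.
have [[V1u S1u] e2 _ _] := au k./2; have [[V1u' S1u'] e2' _ _] := au' k./2.
rewrite -ek in S1u' e2'.
have ex := un1 _ _ _ V1u V1u' Vk S1u S1u'.
by rewrite [LHS]surjective_pairing [RHS]surjective_pairing e2 e2' ex.
Qed.

End AlternatingSequence.

Lemma scalar_product_onS (R : realFieldType) (E : lmodType R) (V W : set E) b :
  V `<=` W -> scalar_product_on W b -> scalar_product_on V b.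
Proof.
move=> VW [bl bs bp]; split.
- by move=> w /VW Ww a u v /VW Wu /VW Wv; exact: bl.
- by move=> u v /VW Wu /VW Wv; exact: bs.
- by move=> u /VW; exact: bp.
Qed.

Lemma linear_onS (R : realFieldType) (E : lmodType R) (V W : set E) l :
  V `<=` W -> linear_on W l -> linear_on V l.
Proof. by move=> VW ll a u v /VW Wu /VW Wv; exact: ll. Qed.

Theorem theorem5p6 (R : realType) (n : nat) (s1 s2 : R)
    (Om1 Om2 : set 'rV[R]_n) (J : 'rV[R]_n -> R)
    (I1 I2 : Type) (T1 : I1 -> seq 'M[R]_(n.+1, n))
    (T2 : I2 -> seq 'M[R]_(n.+1, n)) (f1 f2 u0 : 'rV[R]_n -> R) :
  (2 <= n)%N -> 0 < s1 < 1 -> 0 < s2 < 1 ->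
  lipschitz_polytope Om1 -> lipschitz_polytope Om2 ->
  closure Om1 `&` closure Om2 = set0 ->
  coupling_kernel (set_dist Om1 Om2) J ->
  mesh_family Om1 T1 -> mesh_family Om2 T2 ->
  square_integrable Om1 f1 -> square_integrable Om2 f2 ->
  exists2 C : R, 0 < C & forall (h : I1) (k : I2),
    let V1 := P1_space Om1 (T1 h) in
    let V2 := P1_space Om2 (T2 k) in
    V2 u0 ->
    (exists! u : nat -> ('rV[R]_n -> R) * ('rV[R]_n -> R),
       alternating_scheme s1 s2 Om1 Om2 J f1 f2 V1 V2 u0
         (fun i => (u i).1) (fun i => (u i).2)) /\
    (exists! u : ('rV[R]_n -> R) * ('rV[R]_n -> R),
       coupled_solution s1 s2 Om1 Om2 J f1 f2 V1 V2 u.1 u.2) /\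
    forall (u1i u2i : nat -> 'rV[R]_n -> R) (u1 u2 : 'rV[R]_n -> R),
      alternating_scheme s1 s2 Om1 Om2 J f1 f2 V1 V2 u0 u1i u2i ->
      coupled_solution s1 s2 Om1 Om2 J f1 f2 V1 V2 u1 u2 ->
      [/\ Hs_norm s1 (u1 \- u1i i) @[i --> \oo] --> 0%E,
          Hs_norm s2 (u2 \- u2i i) @[i --> \oo] --> 0%E &
          exists2 kappa : R, 0 < kappa < 1 & forall i : nat,
            (Hs_norm s1 (u1 \- u1i i)%R + Hs_norm s2 (u2 \- u2i i)%R
              <= (C * kappa ^+ i)%:E)%E].
Proof.
move=> n2 s101 s201 [oOm1 _ _ bOm1 _] [oOm2 _ _ bOm2 _] disj [mJ J0 _ iJ _].
move=> [mesh1 _] [mesh2 _] sqf1 sqf2.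
have n0 : (0 < n)%N by exact: leq_trans n2.
have mOm1 := open_measurable_rV oOm1; have mOm2 := open_measurable_rV oOm2.
have [M1 M10 Om1M1] := bounded_set_le bOm1.
have [M2 M20 Om2M2] := bounded_set_le bOm2.
pose M := Num.max M1 M2.
have M0 : 0 <= M by rewrite le_max M10.
have Om1M x : Om1 x -> `|x| <= M by move=> /Om1M1; rewrite le_max => ->.
have Om2M x : Om2 x -> `|x| <= M by move=> /Om2M2; rewrite le_max orbC => ->.
have [delta delta0 sep] := disjoint_closure_separated bOm1 disj.
pose b1 := step_form1 s1 Om1 Om2 J; pose b2 := step_form2 s2 Om1 Om2 J.
pose m := exchange_form Om1 Om2 J; pose q : R := @coupling_share R n s1 s2 M J.
pose l1 := load Om1 f1; pose l2 := load Om2 f2.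
pose K : R := load_const s1 s2 Om1 Om2 M J f1 f2.
have q01 : 0 < q < 1 := coupling_share01 n0 s101 s201 J M0.
pose rho := contraction_factor q.
have rho0 : 0 < rho := contraction_factor_gt0 q01.
have rho1 : rho < 1 := contraction_factor_lt1 q01.
pose c1 : R := @energy_norm_const R n s1 Om2 M delta.
pose c2 : R := @energy_norm_const R n s2 Om1 M delta.
have c10 : 0 < c1 := energy_norm_const_gt0 n0 s101 Om2 M0 delta0.
have c20 : 0 < c2 := energy_norm_const_gt0 n0 s201 Om1 M0 delta0.
(* the absolute value keeps the constant meaningful for every function u0,
   since it is fixed before u0 is known to be a finite element function *)
pose Mc := (4 * K / (1 - q) + 2 * `|b2 u0 u0|) / rho.
exists (Num.sqrt (c1 * Mc) + Num.sqrt (c2 * Mc) + 1).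
  by rewrite ltr_wpDl// addr_ge0// sqrtr_ge0.
move=> h k V1 V2 Vu0.
have [[_ cov1] _] := mesh1 h; have [[_ cov2] _] := mesh2 k.
have V1lip : V1 `<=` lipschitz_in Om1.
  by move=> v; exact: (P1_lipschitz_in oOm1 cov1 n0 M0 Om1M).
have V2lip : V2 `<=` lipschitz_in Om2.
  by move=> v; exact: (P1_lipschitz_in oOm2 cov2 n0 M0 Om2M).
have sV1 : subspace (V1 : set (_ -> R^o)) .
  exact: subspace_P1.
have sV2 : subspace (V2 : set (_ -> R^o)) .
  exact: subspace_P1.
have sb1 : scalar_product_on V1 b1.
  apply: scalar_product_onS V1lip _.
  exact: (scalar_product_step_form1 n0 s101 mOm1 mOm2 M0 Om1M Om2M delta0 sep mJ iJ).
have sb2 : scalar_product_on V2 b2.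
  apply: scalar_product_onS V2lip _.
  exact: (scalar_product_step_form2 n0 s201 mOm1 mOm2 M0 Om1M Om2M delta0 sep mJ iJ).
have ml w : V2 w -> linear_on V1 (m^~ w).
  move=> /V2lip lw; apply: linear_onS V1lip _.
  exact: (linear_exchange_form_l n0 mOm1 mOm2 M0 Om1M Om2M mJ iJ lw).
have mr v : V1 v -> linear_on V2 (m v).
  move=> /V1lip lv; apply: linear_onS V2lip _.
  exact: (linear_exchange_form_r n0 mOm1 mOm2 M0 Om1M Om2M mJ iJ lv).
have mq v w : V1 v -> V2 w -> 2 * m v w <= q * (b1 v v + b2 w w).
  move=> /V1lip lv /V2lip lw.
  exact: (exchange_form_le n0 s101 s201 mOm1 mOm2 M0 Om1M Om2M delta0 sep mJ iJ lv lw).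
have ll1 : linear_on V1 l1.
  apply: linear_onS V1lip _.
  exact: (linear_load1 n0 s101 mOm1 mOm2 M0 Om1M Om2M delta0 sep sqf1).
have ll2 : linear_on V2 l2.
  apply: linear_onS V2lip _.
  exact: (linear_load2 n0 s201 mOm1 mOm2 M0 Om1M Om2M delta0 sep sqf2).
have lK1 v : V1 v -> 2 * l1 v <= K + (1 - q) * b1 v v.
  move=> /V1lip lv.
  exact: (load1_le n0 s101 s201 J f2 mOm1 mOm2 M0 Om1M Om2M delta0 sep sqf1 lv).
have lK2 v : V2 v -> 2 * l2 v <= K + (1 - q) * b2 v v.
  move=> /V2lip lv.
  exact: (load2_le n0 s101 s201 J f1 mOm1 mOm2 M0 Om1M Om2M delta0 sep sqf2 lv).
have eq1P x y : V1 x -> V2 y ->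
    equation1 s1 Om1 Om2 J f1 V1 x y <-> solves1 V1 b1 m l1 x y.
  exact: (equation1P s1 n0 f1 mOm1 mOm2 M0 Om1M Om2M mJ J0 iJ V1lip V2lip).
have eq2P x y : V1 x -> V2 y ->
    equation2 s2 Om1 Om2 J f2 V2 x y <-> solves2 V2 b2 m l2 x y.
  exact: (equation2P s2 n0 f2 mOm1 mOm2 M0 Om1M Om2M mJ J0 iJ V1lip V2lip).
pose ev1 := vertex_value (T1 h); pose ev2 := vertex_value (T2 k).
pose N1 := size (vertices (T1 h)); pose N2 := size (vertices (T2 k)).
have evl1 i : (i < N1)%N -> linear_on V1 (ev1 i) by [].
have evl2 i : (i < N2)%N -> linear_on V2 (ev2 i) by [].
have sep1 u : V1 u -> (forall i, (i < N1)%N -> ev1 i u = 0) -> u = 0.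
  exact: vertex_value_separates.
have sep2 u : V2 u -> (forall i, (i < N2)%N -> ev2 i u = 0) -> u = 0.
  exact: vertex_value_separates.
split; last split.
- have ex1 y : V2 y -> exists2 x, V1 x & equation1 s1 Om1 Om2 J f1 V1 x y.
    move=> Vy; have [x Vx Sx] := solves1_exists sV1 sb1 ml ll1 evl1 sep1 Vy.
    by exists x => //; exact/eq1P.
  have ex2 x : V1 x -> exists2 y, V2 y & equation2 s2 Om1 Om2 J f2 V2 x y.
    move=> Vx; have [y Vy Sy] := solves2_exists sV2 sb2 mr ll2 evl2 sep2 Vx.
    by exists y => //; exact/eq2P.
  have [u ui ualt] := alternating_sequence_exists (cst 0) ex1 ex2 Vu0.
  exists u; split; first by split; rewrite ?ui.
  move=> u' [u'1 u'2 u'alt]; apply: alternating_sequence_unique ualt u'alt.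
  + move=> x x' y Vx Vx' Vy /(eq1P _ _ Vx Vy) Sx /(eq1P _ _ Vx' Vy) Sx'.
    exact: (solves1_unique sV1 sb1 Vx Vx' Sx Sx').
  + move=> x y y' Vx Vy Vy' /(eq2P _ _ Vx Vy) Sy /(eq2P _ _ Vx Vy') Sy'.
    exact: (solves2_unique sV2 sb2 Vy Vy' Sy Sy').
  + by rewrite ui [RHS]surjective_pairing u'1 u'2.
  + by rewrite ui.
- have [u [Vu1 Vu2] [Su1 Su2]] :=
    coupled_exists sV1 sV2 sb1 sb2 ml mr q01 mq ll1 ll2 evl1 evl2 sep1 sep2.
  exists u; split; first by split=> //; [exact/eq1P|exact/eq2P].
  move=> u' [Vu1' Vu2' /(eq1P _ _ Vu1' Vu2') Su1' /(eq2P _ _ Vu1' Vu2') Su2'].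
  exact: (coupled_unique sV1 sV2 sb1 sb2 ml mr q01 mq ll1 ll2 (u := u) (u' := u')).
move=> x y u1 u2 [x0 y0 alt] [Vu1 Vu2 /(eq1P _ _ Vu1 Vu2) Su1 /(eq2P _ _ Vu1 Vu2) Su2].
have Vy i : V2 (y i.*2).
  by case: i => [|i]; [rewrite y0|rewrite doubleS; have [_ _ [] ] := alt i].
have alt' : alternates V1 V2 b1 b2 m l1 l2 x y.
  move=> i; have [[Vx Ex] ey [Vy' Ey] ex] := alt i.
  by split=> //; split=> //; [exact/eq1P|exact/eq2P].
have Vy0 : V2 (y 0%N) by exact: (Vy 0%N).
have geo := alternates_geometric sV1 sV2 sb1 sb2 ml mr q01 mq ll1 ll2 lK1 lK2
  (u := (u1, u2)) (conj Vu1 Vu2) Su1 Su2 x0 Vy0 alt'.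
have rate i : [/\ V1 (x i), V2 (y i),
    b1 (u1 \- x i) (u1 \- x i) <= Mc * rho ^+ i &
    b2 (u2 \- y i) (u2 \- y i) <= Mc * rho ^+ i].
  have [Vx Vyi h1 h2] := geo i.
  have hM : (4 * K / (1 - q) + 2 * b2 (y 0%N) (y 0%N)) / rho * rho ^+ i <=
      Mc * rho ^+ i.
    rewrite ler_wpM2r ?exprn_ge0 ?(ltW rho0)// ler_wpM2r ?invr_ge0 ?(ltW rho0)//.
    by rewrite y0 lerD2l ler_wpM2l// ler_norm.
  by split=> //; [exact: le_trans h1 hM|exact: le_trans h2 hM].
(* rho contracts squared norms *)
pose kappa := Num.sqrt rho.
have kappa0 : 0 < kappa by rewrite sqrtr_gt0.
have kappa1 : kappa < 1 by rewrite -sqrtr1 ltr_sqrt.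
have kappaE i : Num.sqrt (rho ^+ i) = kappa ^+ i.
  by rewrite -(sqr_sqrtr (ltW rho0)) exprAC sqrtr_sqr ger0_norm// exprn_ge0// ltW.
have err (c B : R) i : 0 < c -> B <= Mc * rho ^+ i ->
    Num.sqrt (c * B) <= Num.sqrt (c * Mc) * kappa ^+ i.
  move=> c0 hB; have r0 : 0 <= rho ^+ i by rewrite exprn_ge0// ltW.
  rewrite -kappaE [leRHS]mulrC -sqrtrM// ler_wsqrtr// mulrCA.
  by rewrite ler_wpM2l ?(ltW c0)// mulrC.
have bound1 : forall i, (Hs_norm s1 (u1 \- x i)%R <= (Num.sqrt (c1 * Mc) * kappa ^+ i)%:E)%E.
  move=> i; have [Vx _ h1 _] := rate i.
  have lv : lipschitz_in Om1 (u1 \- x i) by apply/V1lip/(subspaceB sV1).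
  apply: le_trans (Hs_norm_le_step_form1 n0 s101 J mOm1 mOm2 M0 Om1M Om2M delta0 sep lv) _.
  by rewrite lee_fin; exact: err.
have bound2 : forall i, (Hs_norm s2 (u2 \- y i)%R <= (Num.sqrt (c2 * Mc) * kappa ^+ i)%:E)%E.
  move=> i; have [_ Vyi _ h2] := rate i.
  have lv : lipschitz_in Om2 (u2 \- y i) by apply/V2lip/(subspaceB sV2).
  apply: le_trans (Hs_norm_le_step_form2 n0 s201 J mOm1 mOm2 M0 Om1M Om2M delta0 sep lv) _.
  by rewrite lee_fin; exact: err.
have kcvg (c : R) : (c * kappa ^+ i)%:E @[i --> \oo] --> 0%E.
  apply: cvg_EFin; first by apply: nearW.
  by apply: cvg_geometric; rewrite ger0_norm// ltW.
have sq (F : nat -> \bar R) (c : R) : (forall i, 0 <= F i)%E ->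
    (forall i, F i <= (c * kappa ^+ i)%:E)%E -> F i @[i --> \oo] --> 0%E.
  move=> F0 Fc; apply: (squeeze_cvge _ (cvg_cst 0%E) (kcvg c)).
  by apply: nearW => i; rewrite F0 Fc.
split.
- by apply: sq bound1 => i; exact: poweR_ge0.
- by apply: sq bound2 => i; exact: poweR_ge0.
exists kappa; first by rewrite kappa0.
move=> i; apply: le_trans (leeD (bound1 i) (bound2 i)) _.
rewrite -EFinD lee_fin -mulrDl ler_wpM2r ?exprn_ge0 ?(ltW kappa0)//.
by rewrite lerDl.
Qed.
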